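(* Let $\alpha\in(0,2]$. The small amplitude periodic waves $\phi\in H^{\infty}_{per}(\mathbb{T})$ bifurcating from the zero solution at wave speed $c=\frac12$ (described in the context) are spectrally stable, i.e. $\sigma(J\mathcal{L}|_{X_0})\subset i\mathbb{R}$ in $X_0$.
   Context: $\mathbb{T}=[-\pi,\pi]$ and all functions are $2\pi$-periodic; $D^{\alpha}$ is the Fourier multiplier $\widehat{D^{\alpha}g}(\xi)=|\xi|^{\alpha}\widehat g(\xi)$, $\xi\in\mathbb{Z}$; $\Pi_0f:=f-\frac1{2\pi}\int_{-\pi}^{\pi}f\,dx$; $X_0=\{f\in L^2_{per}(\mathbb{T}):\int_{-\pi}^{\pi}f\,dx=0\}$; $H^\infty_{per}(\mathbb{T})=\bigcap_{s}H^s_{per}(\mathbb{T})$; $\langle\cdot,\cdot\rangle$ is the $L^2_{per}(\mathbb{T})$ inner product. Small amplitude periodic waves: there is a (small) $a_0>0$ such that for all $a\in(0,a_0)$ there is a unique even local $2\pi$-periodic zero-mean solution $\phi$, with wave speed $c=c(a)$, of $cD^\alpha\phi+(c-1)\phi=\frac12\Pi_0\phi^2$ on the local bifurcation curve through $(\phi,c)=(0,\frac12)$ tangent to $\cos x$; it has the form $\phi(x)=a\cos(x)+\frac{a^2}{2(2^\alpha-1)}\cos(2x)+O(a^3)$, $c=\frac12+O(a^2)$ with $c>\frac12$. These are the waves considered, for $a$ small. Linearized operator: $\mathcal{L}=cD^\alpha+c-1-\phi$ in $L^2_{per}(\mathbb{T})$ with domain $H^\alpha_{per}(\mathbb{T})$;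 $\mathcal{L}|_{X_0}=\mathcal{L}+\frac1{2\pi}\langle\phi,\cdot\rangle$ acting in $X_0$ with domain $H^\alpha_{per}(\mathbb{T})\cap X_0$; $J=(1+D^\alpha)^{-1}\partial_x$. (This is the linearization of the equation $u_t+u_x+uu_x+(D^\alpha u)_t=0$ about the traveling wave $\phi(x-ct)$, restricted to zero-mean functions.) *)

(* Defs.v *)
From HB Require Import structures.
From mathcomp Require Export all_boot all_order all_algebra.
From mathcomp Require Export all_classical all_reals all_analysis.
From mathcomp.real_closed Require Export complex.

Set Implicit Arguments.
Unset Strict Implicit.
Unset Printing Implicit Defensive.

Import Order.TTheory GRing.Theory Num.Theory.
Import numFieldNormedType.Exports.
Import ComplexField.Normc.

Local Open Scope classical_set_scope.
Local Open Scope ring_scope.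
Local Open Scope complex_scope.

(* Elements of L^2_per are represented by Borel functions on the line that are
   2pi-periodic; equality in L^2_per is [eqT], equality a.e. on T = [-pi, pi]. *)

Definition torus (R : realType) : set R := `[- pi, pi]%classic.
Arguments torus R : clear implicits.

Definition eqT (R : realType) (f g : R -> R[i]) : Prop :=
  f = g %[ae (@lebesgue_measure R) in torus R].

Definition integralT (R : realType) (f : R -> R[i]) : R[i] :=
  Rintegral (@lebesgue_measure R) (torus R) (fun x => complex.Re (f x))
  +i* Rintegral (@lebesgue_measure R) (torus R) (fun x => complex.Im (f x)).

Definition L2per (R : realType) (f : R -> R[i]) : Prop :=
  [/\ measurable_fun [set: R] (fun x => complex.Re (f x)),
      measurable_fun [set: R] (fun x => complex.Im (f x)),
      forall x, f (x + 2 * pi) = f x &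
      (\int[@lebesgue_measure R]_(x in torus R) (normc (f x) ^+ 2)%:E
        < +oo)%E].

Definition normL2 (R : realType) (f : R -> R[i]) : R :=
  Num.sqrt
    (Rintegral (@lebesgue_measure R) (torus R) (fun x => normc (f x) ^+ 2)).

(* Conjugate-linear in the first argument, so that <phi, .> is linear. *)
Definition innerL2 (R : realType) (f g : R -> R[i]) : R[i] :=
  integralT (fun x => (f x)^* * g x).

Definition mean (R : realType) (f : R -> R[i]) : R[i] :=
  ((2 * pi)^-1)%:C * integralT f.

Definition Pi0 (R : realType) (f : R -> R[i]) : R -> R[i] :=
  fun x => f x - mean f.

Definition X0 (R : realType) (f : R -> R[i]) : Prop :=
  L2per f /\ integralT f = 0.

Definition fourier (R : realType) (f : R -> R[i]) (n : int) : R[i] :=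
  mean (fun x => f x * (cos (n%:~R * x) -i* sin (n%:~R * x))).

(* For s >= 0, the Sobolev space H^s_per. *)
Definition Hper (R : realType) (s : R) (f : R -> R[i]) : Prop :=
  L2per f /\
  (\esum_(n in [set: int])
     ((1 + n%:~R ^+ 2) `^ s * normc (fourier f n) ^+ 2)%:E < +oo)%E.

Definition Hinfty (R : realType) (f : R -> R[i]) : Prop :=
  forall s : R, 0 <= s -> Hper s f.

(* Unbounded operators in L^2_per are given by their graphs: [A f g] means
   "f belongs to the domain of A and A f = g". *)

Definition multiplier (R : realType) (m : int -> R[i]) (f g : R -> R[i]) :
    Prop :=
  [/\ L2per f, L2per g & forall n, fourier g n = m n * fourier f n].

Definition Dalpha (R : realType) (alpha : R) : (R -> R[i]) -> (R -> R[i]) -> Prop :=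
  multiplier (fun n : int => ((`|n%:~R : R| `^ alpha))%:C).

(* J = (1 + D^alpha)^-1 d/dx, on its maximal domain in L^2_per. *)
Definition opJ (R : realType) (alpha : R) : (R -> R[i]) -> (R -> R[i]) -> Prop :=
  multiplier (fun n : int =>
    (0 +i* n%:~R) / (1 + (`|n%:~R : R| `^ alpha))%:C).

Definition toC (R : realType) (phi : R -> R) : R -> R[i] := fun x => (phi x)%:C.

Definition opL (R : realType) (alpha c : R) (phi : R -> R) (u w : R -> R[i]) :
    Prop :=
  [/\ Hper alpha u, L2per w &
      exists2 d, Dalpha alpha u d &
        eqT w (fun x => c%:C * d x + (c - 1)%:C * u x - (phi x)%:C * u x)].

Definition opL0 (R : realType) (alpha c : R) (phi : R -> R) (u w : R -> R[i]) :
    Prop :=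
  [/\ X0 u, X0 w &
      exists2 l, opL alpha c phi u l &
        eqT w (fun x => l x + ((2 * pi)^-1)%:C * innerL2 (toC phi) u)].

Definition opJL0 (R : realType) (alpha c : R) (phi : R -> R)
    (u v : R -> R[i]) : Prop :=
  X0 v /\ exists2 w, opL0 alpha c phi u w & opJ alpha w v.

Definition closure_op (R : realType) (X : (R -> R[i]) -> Prop)
    (A : (R -> R[i]) -> (R -> R[i]) -> Prop) (u v : R -> R[i]) : Prop :=
  [/\ X u, X v &
      forall e : R, 0 < e -> exists u' v',
        [/\ A u' v', normL2 (fun x => u x - u' x) < e
          & normL2 (fun x => v x - v' x) < e]].

(* lambda - A is a bijection from the domain of A onto X, with bounded
   inverse. *)
Definition resolvent_set (R : realType) (X : (R -> R[i]) -> Prop)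
    (A : (R -> R[i]) -> (R -> R[i]) -> Prop) : set R[i] :=
  [set lambda |
    [/\ forall u v, A u v -> eqT (fun x => lambda * u x - v x) (fun=> 0) ->
          eqT u (fun=> 0),
        forall f, X f ->
          exists u v, A u v /\ eqT (fun x => lambda * u x - v x) f &
        exists K : R, forall u v, A u v ->
          normL2 u <= K * normL2 (fun x => lambda * u x - v x)]].

Definition spectrum (R : realType) (X : (R -> R[i]) -> Prop)
    (A : (R -> R[i]) -> (R -> R[i]) -> Prop) : set R[i] :=
  ~` resolvent_set X A.

(* The composition of J with L|X0 has domain {u in H^alpha : L u in dom J},
   which is H^1 for alpha <= 1 but only H^alpha, where the order one operator
   J L|X0 is not closed, for alpha > 1; its closure has domain H^1 in all
   cases, and the spectrum is that of the closure. *)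
Definition spectrum_JL0 (R : realType) (alpha c : R) (phi : R -> R) :
    set R[i] :=
  spectrum (@X0 R) (closure_op (@X0 R) (opJL0 alpha c phi)).

Definition wave_eq (R : realType) (alpha c : R) (phi : R -> R) : Prop :=
  exists2 d, Dalpha alpha (toC phi) d &
    eqT (fun x => c%:C * d x + (c - 1)%:C * (phi x)%:C)
        (fun x => (2^-1)%:C * Pi0 (toC (fun y => phi y ^+ 2)) x).

(* (phi a, c a), 0 < a < a0, is the local bifurcation curve; the O(a^3)
   remainder is taken uniformly in x. *)
Record small_amplitude_waves (R : realType) (alpha a0 : R)
    (phi : R -> R -> R) (c : R -> R) : Prop := SmallAmplitudeWaves {
  saw_smooth : forall a, 0 < a < a0 -> Hinfty (toC (phi a)) ;
  saw_even : forall a, 0 < a < a0 -> forall x, phi a (- x) = phi a x ;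
  saw_zero_mean : forall a, 0 < a < a0 -> X0 (toC (phi a)) ;
  saw_eq : forall a, 0 < a < a0 -> wave_eq alpha (c a) (phi a) ;
  saw_speed : forall a, 0 < a < a0 -> 2^-1 < c a ;
  saw_phi_expansion : exists K : R, \forall a \near 0^'+, forall x,
    `|phi a x - (a * cos x + a ^+ 2 / (2 * (2 `^ alpha - 1)) * cos (2 * x))|
      <= K * a ^+ 3 ;
  saw_c_expansion : exists K : R, \forall a \near 0^'+,
    `|c a - 2^-1| <= K * a ^+ 2
}.

(* Main.v *)
Require Import Defs.
From mathcomp Require Import measurable_realfun ring lra zify.

(* On Fourier coefficients, (lambda - J L) u = f reads
     (lambda - i omega_n) u_n + J_n (phi u)^_n = f_n,   omega_n ~ c n.
   For Re lambda <> 0 the diagonal part is bounded below by a multiple of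
   1 + |n|, and the remaining part gains alpha derivatives, so it is compact:
   lambda is in the resolvent set as soon as lambda - J L is injective.

   If J L u = lambda u, then w = L u has coefficients -i lambda h_n, where
   h_n = (1 + |n|^alpha) / n u_n, and both <u, h> and <u, L u> are real, so that
   <u, L u> = <u, h> = 0 for Re lambda <> 0. Likewise <phi', h> = 0, because
   L phi' = 0; using the wave equation, this says that u is orthogonal to
   psi = phi + phi^2 / 2 = a cos x + O(a^2). Subtracting a multiple of phi', one
   gets z with z_1 = z_(-1), <z, L z> = 0 and <psi, z> = 0. The last relation
   makes z_1 small, of size O(a) |z|, whereas c |n|^alpha + c - 1 is bounded
   below for |n| >= 2 and nonnegative for |n| = 1; hence z = 0 for small a, then
   L u = L z = 0 and u = 0. *)

Set Implicit Arguments.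
Unset Strict Implicit.
Unset Printing Implicit Defensive.

Import Order.TTheory GRing.Theory Num.Theory.
Import numFieldNormedType.Exports.
Import ComplexField.Normc.

Local Open Scope classical_set_scope.
Local Open Scope ring_scope.
Local Open Scope complex_scope.

Local Notation "z ^*" := (Num.conj z) : complex_scope.

(** * Square-summable families and a Fredholm alternative *)

(** The obstacle is that the modes n = 1 and n = -1 are almost in the kernel: there c |n|^alpha + c
    - 1 = 2 c - 1 = O(a^2), while the potential phi has size a, so no perturbation argument makes
    the form of L positive on this plane. Its two directions are removed by different means. The odd
    one, close to phi', goes by subtracting a kernel element, which does not change L u. The even
    one, close to cos x, goes by orthogonality to psi. Off mode zero psi = c (1 + D^alpha) phi, a
    multiple of the gradient of the momentum, which is why <phi', h> = 0 turns into <psi, u> = 0.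
    The form vanishes because <u, L u> = -i lambda <u, h> equates a real number with a non-real
    multiple of a real number: Im (-i lambda) = - Re lambda. At mode zero the symbol c - 1 is
    negative for c near 1/2, but u_0 = 0 there, since the symbol of J vanishes and lambda <> 0.
    Compactness enters only in the form that the remaining operator contracts by 1/2 on sequences
    supported off a large finite set of modes. *)

Section complex_modulus.
Variable R : realType.
Implicit Types z w : R[i].

Lemma sqr_normcE z : normc z ^+ 2 = complex.Re z ^+ 2 + complex.Im z ^+ 2.
Proof. by case: z => a b /=; rewrite sqr_sqrtr // addr_ge0 ?sqr_ge0. Qed.

Lemma normc_ge0 z : 0 <= normc z.
Proof. by case: z => a b /=; exact: sqrtr_ge0. Qed.

Lemma normcR (x : R) : normc x%:C = `|x|.
Proof. by rewrite /= expr0n addr0 sqrtr_sqr. Qed.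

Lemma normcr0 : normc (0 : R[i]) = 0.
Proof. by rewrite -[0]/(0%:C) normcR normr0. Qed.

Lemma normcr1 : normc (1 : R[i]) = 1.
Proof. by rewrite -[1]/(1%:C) normcR normr1. Qed.

Lemma normcN z : normc (- z) = normc z.
Proof. by case: z => a b /=; rewrite !sqrrN. Qed.

Lemma normcBC z w : normc (z - w) = normc (w - z).
Proof. by rewrite -normcN opprB. Qed.

Lemma normcJ z : normc z^* = normc z.
Proof. by case: z => a b /=; rewrite sqrrN. Qed.

Lemma normcD z w : normc (z + w) <= normc z + normc w.
Proof. exact: le_normcD. Qed.

Lemma normcB z w : normc (z - w) <= normc z + normc w.
Proof. by rewrite -(normcN w); exact: normcD. Qed.

Lemma normc_lb z w : normc z - normc w <= normc (z + w).
Proof.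
by rewrite lerBlDr -{1}(addrK w z); exact: normcB.
Qed.

Lemma Re_le_normc z : `|complex.Re z| <= normc z.
Proof.
by rewrite -sqrtr_sqr; case: z => a b /=; rewrite ler_wsqrtr// lerDl sqr_ge0.
Qed.

Lemma Im_le_normc z : `|complex.Im z| <= normc z.
Proof.
by rewrite -sqrtr_sqr; case: z => a b /=; rewrite ler_wsqrtr// lerDr sqr_ge0.
Qed.

Lemma normc_le_ReIm z : normc z <= `|complex.Re z| + `|complex.Im z|.
Proof.
rewrite -(@ler_pXn2r _ 2) ?nnegrE ?normc_ge0 ?addr_ge0// sqr_normcE.
rewrite -(real_normK (num_real (complex.Re z))) -(real_normK (num_real (complex.Im z))).
by rewrite sqrrD lerD2r lerDl mulrn_wge0// mulr_ge0.
Qed.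

Lemma mul_conjc z : z^* * z = (normc z ^+ 2)%:C.
Proof. by rewrite sqr_normcE; case: z => a b; simpc; congr (_ +i* _); ring. Qed.

Lemma normc_eq0 z : (normc z == 0) = (z == 0).
Proof.
by apply/eqP/eqP => [/eq0_normc//|->]; rewrite normcr0.
Qed.

Lemma ReD z w : complex.Re (z + w) = complex.Re z + complex.Re w.
Proof. by case: z w => a b []. Qed.

Lemma ImD z w : complex.Im (z + w) = complex.Im z + complex.Im w.
Proof. by case: z w => a b []. Qed.

Lemma normc_sum (J : Type) (s : seq J) (P : pred J) (F : J -> R[i]) :
  normc (\sum_(j <- s | P j) F j) <= \sum_(j <- s | P j) normc (F j).
Proof.
elim/big_ind2: _ => [|x1 x2 y1 y2 h1 h2|//]; first by rewrite normcr0.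
exact: le_trans (normcD _ _) (lerD h1 h2).
Qed.

Lemma Re_sum (J : Type) (s : seq J) (P : pred J) (F : J -> R[i]) :
  complex.Re (\sum_(j <- s | P j) F j) = \sum_(j <- s | P j) complex.Re (F j).
Proof.
apply: (big_morph (@complex.Re R)) => // z w; exact: ReD.
Qed.

End complex_modulus.

Lemma sum_cauchy_schwarz (R : realType) (J : Type) (s : seq J) (x y : J -> R) :
  (\sum_(j <- s) x j * y j) ^+ 2
    <= (\sum_(j <- s) x j ^+ 2) * (\sum_(j <- s) y j ^+ 2).
Proof.
elim: s => [|j s IH]; first by rewrite !big_nil mulr0 expr0n.
rewrite !big_cons; set P := \sum_(_ <- _) _ * _ in IH *.
set X := \sum_(j <- s) x j ^+ 2 in IH *; set Y := \sum_(j <- s) y j ^+ 2 in IH *.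
have X0 : 0 <= X by apply: sumr_ge0 => k _; exact: sqr_ge0.
have Y0 : 0 <= Y by apply: sumr_ge0 => k _; exact: sqr_ge0.
(* Arithmetic-geometric mean inequality after squaring: [P ^ 2 <= X * Y] by induction, and the
   remaining difference is a perfect square. *)
have h : (2 * P * (x j * y j)) <= X * y j ^+ 2 + Y * x j ^+ 2.
  have Z0 : 0 <= X * y j ^+ 2 + Y * x j ^+ 2.
    by rewrite addr_ge0// mulr_ge0// sqr_ge0.
  apply: le_trans (ler_norm _) _.
  rewrite -(@ler_pXn2r _ 2) ?nnegrE// real_normK ?num_real//.
  apply: (@le_trans _ _ (4 * (X * Y) * (x j * y j) ^+ 2)).
    rewrite !exprMn; apply: ler_wpM2r; first by rewrite mulr_ge0 ?sqr_ge0.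
    by apply: ler_pM; rewrite ?sqr_ge0//; lra.
  rewrite -subr_ge0.
  have -> : (X * y j ^+ 2 + Y * x j ^+ 2) ^+ 2 - 4 * (X * Y) * (x j * y j) ^+ 2
    = (X * y j ^+ 2 - Y * x j ^+ 2) ^+ 2 by ring.
  exact: sqr_ge0.
rewrite -subr_ge0.
have -> : (x j ^+ 2 + X) * (y j ^+ 2 + Y) - (x j * y j + P) ^+ 2 =
  (X * y j ^+ 2 + Y * x j ^+ 2 - 2 * P * (x j * y j)) + (X * Y - P ^+ 2) by ring.
by rewrite addr_ge0// subr_ge0.
Qed.

Section square_summable.
Variables (R : realType) (I : eqType).
Implicit Types (u v : I -> R[i]) (B : R) (s : seq I).

(** Duplicate-free finite lists reduce summability to finite inequalities, so no infinite sum is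
    manipulated. [B] is any upper bound of the norm, not the norm itself. *)
Definition l2b u B :=
  0 <= B /\ forall s, uniq s -> \sum_(n <- s) normc (u n) ^+ 2 <= B ^+ 2.

Definition l2 u := exists B, l2b u B.

Lemma l2b_ge0 u B : l2b u B -> 0 <= B. Proof. by case. Qed.

Lemma l2b_le u B B' : B <= B' -> l2b u B -> l2b u B'.
Proof.
move=> BB' [B0 h]; split=> [|s us]; first exact: le_trans BB'.
by apply: le_trans (h s us) _; rewrite ler_pXn2r ?nnegrE//; exact: le_trans BB'.
Qed.

Lemma l2b_dom u v B : (forall n, normc (u n) <= normc (v n)) -> l2b v B -> l2b u B.
Proof.
move=> uv [B0 h]; split=> // s us; apply: le_trans (h s us).
by apply: ler_sum => n _; rewrite ler_pXn2r ?nnegrE ?normc_ge0.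
Qed.

Lemma l2b_coef u B n : l2b u B -> normc (u n) <= B.
Proof.
move=> [B0 /(_ [:: n] isT)]; rewrite big_seq1.
by rewrite ler_pXn2r ?nnegrE ?normc_ge0.
Qed.

Lemma l2b_add u v A B : l2b u A -> l2b v B -> l2b (fun n => u n + v n) (A + B).
Proof.
move=> [A0 hu] [B0 hv]; split=> [|s us]; first exact: addr_ge0.
have := hu s us; have := hv s us.
have := sum_cauchy_schwarz s (fun n => normc (u n)) (fun n => normc (v n)).
set P := \sum_(_ <- _) _ * _; set Y := \sum_(n <- s) normc (v n) ^+ 2.
set X := \sum_(n <- s) normc (u n) ^+ 2 => PXY YB XA.
have X0 : 0 <= X by apply: sumr_ge0 => k _; exact: sqr_ge0.
have Y0 : 0 <= Y by apply: sumr_ge0 => k _; exact: sqr_ge0.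
have PAB : P <= A * B.
  apply: le_trans (ler_norm _) _.
  rewrite -(@ler_pXn2r _ 2) ?nnegrE ?mulr_ge0// real_normK ?num_real//.
  by apply: le_trans PXY _; rewrite exprMn ler_pM.
apply: (@le_trans _ _ (X + 2 * P + Y)); last first.
  have -> : (A + B) ^+ 2 = A ^+ 2 + 2 * (A * B) + B ^+ 2 by ring.
  by apply: lerD => //; apply: lerD => //; lra.
rewrite /X /P /Y mulr_sumr -!big_split/=; apply: ler_sum => n _.
have -> : normc (u n) ^+ 2 + 2 * (normc (u n) * normc (v n)) + normc (v n) ^+ 2 =
  (normc (u n) + normc (v n)) ^+ 2 by ring.
by rewrite ler_pXn2r ?nnegrE ?normc_ge0 ?addr_ge0 ?normc_ge0// normcD.
Qed.

Lemma l2b_scale u B (k : R[i]) : l2b u B -> l2b (fun n => k * u n) (normc k * B).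
Proof.
move=> [B0 h]; split=> [|s us]; first by rewrite mulr_ge0 ?normc_ge0.
under eq_bigr do rewrite normcM exprMn.
by rewrite -mulr_sumr exprMn ler_wpM2l ?sqr_ge0 ?h.
Qed.

Lemma l2b_mul u B (m : I -> R[i]) K : 0 <= K -> (forall n, normc (m n) <= K) ->
  l2b u B -> l2b (fun n => m n * u n) (K * B).
Proof.
move=> K0 mK /(@l2b_scale u B K%:C); rewrite normcR ger0_norm//.
by apply: l2b_dom => n; rewrite !normcM normcR ger0_norm// ler_wpM2r ?normc_ge0.
Qed.

Lemma l2b_opp u B : l2b u B -> l2b (fun n => - u n) B.
Proof. by apply: l2b_dom => n; rewrite normcN. Qed.

Lemma l2b_sub u v A B : l2b u A -> l2b v B -> l2b (fun n => u n - v n) (A + B).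
Proof. by move=> hu hv; apply: l2b_add => //; exact: l2b_opp. Qed.

Lemma l2b0 : l2b (fun=> 0) 0.
Proof.
by split=> // s _; rewrite big1 ?expr0n// => n _; rewrite normcr0 expr0n.
Qed.

Lemma l2b_sum (J : Type) (r : seq J) (U : J -> I -> R[i]) (K : J -> R) :
  (forall j, l2b (U j) (K j)) ->
  l2b (fun n => \sum_(j <- r) U j n) (\sum_(j <- r) K j).
Proof.
move=> h; elim: r => [|j r IH].
  by rewrite big_nil; under eq_fun do rewrite big_nil; exact: l2b0.
by rewrite big_cons; under eq_fun do rewrite big_cons; exact: l2b_add.
Qed.

Lemma l2b_delta (i : I) : l2b (fun n => (n == i)%:R) 1.
Proof.
split=> // s us; rewrite expr1n.
under eq_bigr => n _.
  have -> : normc ((n == i)%:R : R[i]) ^+ 2 = (n == i)%:R.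
    by case: (n == i); rewrite ?normcr1 ?normcr0 ?expr1n ?expr0n.
  over.
rewrite -natr_sum.
have -> : (\sum_(n <- s) (n == i))%N = count_mem i s.
  by elim: s {us} => [|j s IH]; rewrite ?big_nil// big_cons IH.
by rewrite (count_uniq_mem _ us) lern1; case: (i \in s).
Qed.

(** A discrete Fatou lemma: a finite sum sees finitely many coordinates, so the bound survives
    coordinatewise limits. It carries the bounds in [neumann] and [mult_weight] to the limit. *)
Lemma l2b_closed u B : 0 <= B ->
  (forall s (e : R), 0 < e -> exists2 v, l2b v B & forall n, n \in s -> normc (u n - v n) <= e) ->
  l2b u B.
Proof.
move=> B0 h; split=> // s us; apply/ler_addgt0Pr => e e0.
(* For [d <= 1] each square grows by at most [d * (2 * B + 1)], so the total error is at most
   [d * M]. *)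
pose M := (size s)%:R * (2 * B + 1) + 1.
have M0 : 0 < M by rewrite ltr_wpDl// mulr_ge0// addr_ge0// mulr_ge0.
pose d := Num.min 1 (e / M).
have d0 : 0 < d by rewrite lt_min ltr01 divr_gt0.
have [v vB uv] := h s d d0.
apply: (@le_trans _ _ (\sum_(n <- s) (normc (v n) ^+ 2 + d * (2 * B + 1)))).
  rewrite big_seq [leRHS]big_seq; apply: ler_sum => n ns.
  have un : normc (u n) <= normc (v n) + d.
    rewrite -lerBlDl; apply: le_trans (uv n ns).
    by rewrite -(normcN (v n)) normc_lb.
  have vn := l2b_coef n vB.
  apply: (@le_trans _ _ ((normc (v n) + d) ^+ 2)).
    by rewrite ler_pXn2r// nnegrE ?normc_ge0// addr_ge0 ?normc_ge0 ?ltW.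
  have -> : (normc (v n) + d) ^+ 2 = normc (v n) ^+ 2 + d * (2 * normc (v n) + d) by ring.
  rewrite lerD2l ler_pM2l// lerD ?ler_pM2l//.
  by rewrite /d ge_min lexx.
rewrite big_split/=; apply: lerD; first by case: vB => _; exact.
rewrite big_const_seq count_predT iter_addr_0 -(mulr_natl (d * _)).
apply: (@le_trans _ _ (d * M)).
  rewrite mulrCA ler_pM2l// /M lerDl//.
by rewrite -ler_pdivlMr// /d ge_min lexx orbT.
Qed.

Lemma l2b_eq0 u : l2b u 0 -> u = fun=> 0.
Proof.
move=> h; apply/funext => n; apply/eqP; rewrite -normc_eq0.
by rewrite eq_le normc_ge0 andbT; exact: l2b_coef h.
Qed.

Lemma l2b_small_eq0 u : (forall e, 0 < e -> l2b u e) -> u = fun=> 0.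
Proof.
move=> h; apply: l2b_eq0; apply: l2b_closed => // s e e0.
exists (fun=> 0) => [|n _]; first exact: l2b0.
by rewrite subr0; exact: l2b_coef (h _ e0).
Qed.

Lemma l2D u v : l2 u -> l2 v -> l2 (fun n => u n + v n).
Proof. by move=> [A hA] [B hB]; exists (A + B); exact: l2b_add. Qed.

Lemma l2B u v : l2 u -> l2 v -> l2 (fun n => u n - v n).
Proof. by move=> [A hA] [B hB]; exists (A + B); exact: l2b_sub. Qed.

Lemma l2Z u (k : R[i]) : l2 u -> l2 (fun n => k * u n).
Proof. by move=> [A hA]; exists (normc k * A); exact: l2b_scale. Qed.

Lemma l2_sum (J : Type) (r : seq J) (U : J -> I -> R[i]) :
  (forall j, l2 (U j)) -> l2 (fun n => \sum_(j <- r) U j n).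
Proof.
move=> /choice[K hK]; exists (\sum_(j <- r) K j); exact: l2b_sum.
Qed.

End square_summable.

Section geometric_convergence.
Variable R : realType.

(** Adding and subtracting the geometric tail [2 B / 2^m] gives a nonincreasing [y] above a
    nondecreasing [z]; the limit is the supremum of [z]. *)
Lemma geometric_cvg (x : nat -> R) (B : R) :
  (forall m, `|x m.+1 - x m| <= B / 2 ^+ m) ->
  exists l, forall m, `|l - x m| <= 2 * B / 2 ^+ m.
Proof.
move=> h; pose y m := x m + 2 * B / 2 ^+ m; pose z m := x m - 2 * B / 2 ^+ m.
have step m : 2 * B / 2 ^+ m = 2 * B / 2 ^+ m.+1 + B / 2 ^+ m.
  by rewrite exprS; field; rewrite expf_neq0.
have B0 m : 0 <= B / 2 ^+ m := le_trans (normr_ge0 _) (h m).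
have yS m : y m.+1 <= y m.
  by rewrite /y (step m); move: (h m); rewrite ler_norml; lra.
have zS m : z m <= z m.+1.
  by rewrite /z (step m); move: (h m); rewrite ler_norml; lra.
have ym m k : (m <= k)%N -> y k <= y m.
  elim: k => [|k IH]; first by rewrite leqn0 => /eqP ->.
  by rewrite leq_eqVlt ltnS => /orP[/eqP -> //|/IH]; exact: le_trans (yS k).
have zm m k : (m <= k)%N -> z m <= z k.
  elim: k => [|k IH]; first by rewrite leqn0 => /eqP ->.
  rewrite leq_eqVlt ltnS => /orP[/eqP -> //|/IH zk].
  exact: le_trans zk (zS k).
have zy m k : z m <= y k.
  apply: (@le_trans _ _ (z (maxn m k))); first by rewrite zm// leq_maxl.
  apply: (@le_trans _ _ (y (maxn m k))); last by rewrite ym// leq_maxr.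
  by rewrite /z /y -mulrA; move: (B0 (maxn m k)); lra.
have hs : has_sup (range z).
  split; first by exists (z 0%N), 0%N.
  by exists (y 0%N) => _ [m _ <-]; exact: zy.
exists (sup (range z)) => m; rewrite ler_norml; apply/andP; split.
  rewrite lerBrDl -/(z m); apply: ub_le_sup; last by exists m.
  by case: hs.
rewrite lerBlDl -/(y m); apply: ge_sup; first by case: hs.
by move=> _ [k _ <-]; exact: zy.
Qed.

Lemma geometric_cvgc (x : nat -> R[i]) (B : R) :
  (forall m, normc (x m.+1 - x m) <= B / 2 ^+ m) ->
  exists l, forall m, normc (l - x m) <= 4 * B / 2 ^+ m.
Proof.
move=> h.
have [a ha] := @geometric_cvg (fun m => complex.Re (x m)) B
  (fun m => le_trans (eq_ind_r (fun t => `|t| <= _) (Re_le_normc _) (esym (raddfB (@complex.Re R : {additive Rcomplex R -> R}) (x m.+1) (x m)))) (h m)).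
have [b hb] := @geometric_cvg (fun m => complex.Im (x m)) B
  (fun m => le_trans (eq_ind_r (fun t => `|t| <= _) (Im_le_normc _) (esym (raddfB (@complex.Im R : {additive Rcomplex R -> R}) (x m.+1) (x m)))) (h m)).
exists (a +i* b) => m; apply: le_trans (normc_le_ReIm _) _.
have := ha m; have := hb m; case: (x m) => c d /=.
by rewrite -mulrA -[4 * B / _]mulrA; set t := B / _; lra.
Qed.

Lemma geometric_small (B e : R) : 0 < e -> exists m, B / 2 ^+ m <= e.
Proof.
move=> e0; pose M : R := Num.max B 0 / e.
have M0 : 0 <= M by apply: divr_ge0; rewrite ?le_max ?lexx ?orbT// ltW.
exists (Num.bound M); rewrite ler_pdivrMr ?exprn_gt0//.
apply: (@le_trans _ _ (Num.max B 0)); first by rewrite le_max lexx.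
rewrite -ler_pdivrMl// mulrC -/M.
apply: le_trans (ltW (archi_boundP M0)) _.
by rewrite -natrX ler_nat ltnW// ltn_expl.
Qed.

End geometric_convergence.

Section fredholm.
Variables (R : realType) (I : eqType).
Implicit Types (u v f g : I -> R[i]) (B : R).

Section neumann.
Variable S : (I -> R[i]) -> I -> R[i].
Hypothesis SB : forall u v, l2 u -> l2 v ->
  S (fun n => u n - v n) = fun n => S u n - S v n.
Hypothesis Scontr : forall u B, l2b u B -> l2b (S u) (B / 2).

(** Successive approximation from [f]: the increments halve at each step. The limit is within [4 B]
    of the first iterate [f], whence [5 B]. *)
Lemma neumann f B : l2b f B ->
  exists2 g, l2b g (5 * B) & forall n, g n = f n + S g n.
Proof.
move=> hf; have B0 := l2b_ge0 hf.
pose it m := iter m (fun g n => f n + S g n) f.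
have l2it m : l2 (it m).
  elim: m => [|m [A hA]]; first by exists B.
  by exists (B + A / 2); apply: l2b_add => //; exact: Scontr.
have dit m : l2b (fun n => it m.+1 n - it m n) (B / 2 / 2 ^+ m).
  elim: m => [|m IH].
    rewrite expr0 divr1; apply: l2b_dom (Scontr hf) => n.
    by rewrite /= addrC addKr.
  have -> : B / 2 / 2 ^+ m.+1 = B / 2 / 2 ^+ m / 2.
    by rewrite exprS; field; rewrite expf_neq0.
  apply: l2b_dom (Scontr IH) => n; rewrite SB//.
  by rewrite [it m.+2]/= [X in _ - X]/= opprD addrACA subrr add0r.
have ditk m k : l2b (fun n => it (m + k)%N n - it m n) (B / 2 ^+ m - B / 2 ^+ (m + k)).
  elim: k => [|k IH].
    by rewrite addn0 subrr; apply: l2b_dom (@l2b0 R I) => n; rewrite subrr normcr0.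
  have -> : B / 2 ^+ m - B / 2 ^+ (m + k.+1) =
    B / 2 / 2 ^+ (m + k) + (B / 2 ^+ m - B / 2 ^+ (m + k)).
    by rewrite addnS exprS; field; rewrite !expf_neq0.
  apply: l2b_dom (l2b_add (dit (m + k)%N) IH) => n.
  by rewrite addnS addrA subrK.
have /choice[g hg] : forall n, exists l, forall m, normc (l - it m n) <= 4 * (B / 2) / 2 ^+ m.
  by move=> n; apply: geometric_cvgc => m; exact: l2b_coef (dit m).
have git m : l2b (fun n => g n - it m n) (4 * B / 2 ^+ m).
  apply: l2b_closed => [|s e e0]; first by rewrite divr_ge0 ?mulr_ge0 ?exprn_ge0.
  have [k hk] := geometric_small (4 * (B / 2)) e0.
  exists (fun n => it (m + k)%N n - it m n).
    apply: l2b_le (ditk m k).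
    have : 0 <= B / 2 ^+ m by rewrite divr_ge0 ?exprn_ge0.
    have : 0 <= B / 2 ^+ (m + k) by rewrite divr_ge0 ?exprn_ge0.
    rewrite -[4 * B / _]mulrA; set a := B / _; set b := B / _; lra.
  move=> n _; rewrite opprB addrA subrK; apply: le_trans (hg n _) _.
  apply: le_trans hk; apply: ler_wpM2l; first by rewrite mulr_ge0// divr_ge0.
  by rewrite lef_pV2 ?posrE ?exprn_gt0// ler_eXn2l ?leq_addl// ltr1n.
have gB : l2b g (5 * B).
  have := l2b_add (git 0%N) hf; rewrite expr0 divr1.
  have -> : 4 * B + B = 5 * B by ring.
  by apply: l2b_dom => n; rewrite subrK.
exists g => // n; apply/eqP; rewrite -subr_eq0; apply/eqP.
pose h := (fun n => g n - (f n + S g n)); rewrite -/(h n).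
suff -> : h = fun=> 0 by [].
apply: l2b_small_eq0 => e e0.
have [m hm] := geometric_small (4 * B) e0.
apply: (@l2b_le _ _ _ (4 * B / 2 ^+ m.+1 + 4 * B / 2 ^+ m / 2)).
  apply: le_trans hm; rewrite exprS le_eqVlt; apply/orP; left; apply/eqP.
  by field; rewrite expf_neq0.
have gm : l2b (S (fun n => g n - it m n)) (4 * B / 2 ^+ m / 2) := Scontr (git m).
apply: l2b_dom (l2b_sub (git m.+1) gm) => k.
rewrite SB//; last by exists (5 * B).
rewrite le_eqVlt; apply/orP; left; apply/eqP; congr normc.
by rewrite /h -[it m.+1 k]/(f k + S (it m) k); ring.
Qed.

End neumann.

Variable C : (I -> R[i]) -> I -> R[i].
Hypothesis CD : forall u v, l2 u -> l2 v ->
  C (fun n => u n + v n) = fun n => C u n + C v n.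
Hypothesis CZ : forall k u, l2 u -> C (fun n => k * u n) = fun n => k * C u n.
Variable M : R.
Hypothesis M0 : 0 <= M.
Hypothesis Cbnd : forall u B, l2b u B -> l2b (C u) (M * B).
Variable s : seq I.
Hypothesis us : uniq s.
Hypothesis Csmall : forall u B, (forall n, n \in s -> u n = 0) ->
  l2b u B -> l2b (C u) (B / 2).
Hypothesis Cinj : forall g, l2 g -> (forall n, g n = C g n) -> g = fun=> 0.

(** [Csmall] stands in for compactness: [C] composed with [off] is a contraction, and what is left
    of [C] depends on the finitely many values on [s] only. *)
Let off g := fun n => if n \in s then 0 else g n.
Let S g := C (off g).

Let l2b_off g B : l2b g B -> l2b (off g) B.
Proof.
by apply: l2b_dom => n; rewrite /off; case: ifP => // _; rewrite normcr0 normc_ge0.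
Qed.

Let SB u v : l2 u -> l2 v -> S (fun n => u n - v n) = fun n => S u n - S v n.
Proof.
move=> [A hA] [B hB]; rewrite /S.
have hu : l2 (off u) by exists A; exact: l2b_off.
have hv : l2 (off v) by exists B; exact: l2b_off.
have -> : off (fun n => u n - v n) = fun n => off u n + (-1) * off v n.
  by apply/funext => n; rewrite /off; case: ifP; rewrite ?mulr0 ?addr0// mulN1r.
by rewrite CD ?CZ//; [apply/funext => n; rewrite mulN1r | exact: l2Z].
Qed.

Let Scontr u B : l2b u B -> l2b (S u) (B / 2).
Proof.
by move=> h; apply: Csmall; [move=> n ns; rewrite /off ns | exact: l2b_off].
Qed.

Let C_sum d (h : 'I_d -> R[i]) (U : 'I_d -> I -> R[i]) : (forall j, l2 (U j)) ->
  C (fun n => \sum_(j < d) h j * U j n) = fun n => \sum_(j < d) h j * C (U j) n.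
Proof.
move=> hU; have C0 : C (fun=> 0) = fun=> 0.
  apply: l2b_small_eq0 => e e0; apply: l2b_le (Cbnd (@l2b0 R I)).
  by rewrite mulr0 ltW.
suff /(_ (index_enum 'I_d)) : forall r, l2 (fun n => \sum_(j <- r) h j * U j n) /\
  C (fun n => \sum_(j <- r) h j * U j n) = fun n => \sum_(j <- r) h j * C (U j) n.
  by case.
elim=> [|j r [h1 h2]].
  under eq_fun do rewrite big_nil.
  under [X in _ /\ _ = X]eq_fun do rewrite big_nil.
  by split=> //; exists 0; exact: l2b0.
under eq_fun do rewrite big_cons.
under [X in _ /\ _ = X]eq_fun do rewrite big_cons.
split; first by apply: l2D => //; exact: l2Z.
by rewrite CD ?h2 ?CZ//; exact: l2Z.
Qed.

(* The equation restricted to s is a square linear system; off s the operator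
   is a contraction and a Neumann series applies. *)
Lemma fredholm : exists2 K, 0 <= K & forall f B, l2b f B ->
  exists2 g, l2b g (K * B) & forall n, g n = f n + C g n.
Proof.
pose d := size s; pose E (j : 'I_d) n : R[i] := (n == tnth (in_tuple s) j)%:R.
have EB j : l2b (E j) 1 by exact: l2b_delta.
have /choice[G hG] : forall j, exists G, l2b G (5 * (M * 1)) /\
    forall n, G n = C (E j) n + S G n.
  by move=> j; have [G] := neumann SB Scontr (Cbnd (EB j)); exists G.
have GB j : l2b (G j) (5 * M) by have [] := hG j; rewrite mulr1.
have l2G j : l2 (G j) by exists (5 * M).
(* A solution has the form [g + sum_j h_j G_j], where [h] lists its own values on [s]; consistency
   on [s] reads [h *m A = b], with [b] the values of [g]. *)
pose A : 'M[R[i]]_d := 1%:M - \matrix_(j, i) G j (tnth (in_tuple s) i).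
have offE g : g = fun n => off g n + \sum_(j < d) g (tnth (in_tuple s) j) * E j n.
  apply/funext => n; rewrite /off; case: ifPn => [ns|ns].
    rewrite add0r; have ni : (index n s < d)%N by rewrite index_mem.
    rewrite (bigD1 (Ordinal ni))//= big1 ?addr0.
      by rewrite /E !(tnth_nth n)/= nth_index// eqxx mulr1.
    move=> j; rewrite -val_eqE/= => ji; rewrite /E (tnth_nth n)/=.
    case: eqP => [nj|_]; last by rewrite mulr0.
    by move: ji; rewrite nj index_uniq// eqxx.
  rewrite big1 ?addr0// => j _; rewrite /E; case: eqP => [nj|_]; last by rewrite mulr0.
  by move: ns; rewrite nj (tnth_nth n)/= mem_nth.
have lift f g (h : 'I_d -> R[i]) : l2 g -> (forall n, g n = f n + S g n) ->
  (forall i, h i = g (tnth (in_tuple s) i) +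
     \sum_(j < d) h j * G j (tnth (in_tuple s) i)) ->
  let w := fun n => g n + \sum_(j < d) h j * G j n in
  forall n, w n = f n + C w n.
  move=> l2g gS hh w n.
  have l2h : l2 (fun n => \sum_(j < d) h j * G j n).
    by apply: l2_sum => j; exact: l2Z.
  have l2w : l2 w by exact: l2D.
  have ws j : w (tnth (in_tuple s) j) = h j by rewrite /w hh.
  have offw : off w = fun n => off g n + \sum_(j < d) h j * off (G j) n.
    apply/funext => m; rewrite /off /w; case: ifP => // _.
    by rewrite big1 ?addr0// => j _; rewrite mulr0.
  have l2off u : l2 u -> l2 (off u) by move=> [B hB]; exists B; exact: l2b_off.
  have l2E j : l2 (E j) by exists 1.
  rewrite {2}(offE w) CD; first last.
  - by apply: l2_sum => j; exact: l2Z.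
  - exact: l2off.
  rewrite C_sum// offw CD; first last.
  - by apply: l2_sum => j; apply: l2Z; exact: l2off.
  - exact: l2off.
  rewrite C_sum; last by move=> j; exact: l2off.
  rewrite {1}/w gS -!addrA; congr (_ + (_ + _)); rewrite -big_split/=.
  apply: eq_bigr => j _; rewrite ws -mulrDr; congr (_ * _).
  by have [_ ->] := hG j; rewrite addrC.
(* A row killed by [A] lifts, with zero data, to a fixed point of [C] whose values on [s] are that
   row; [Cinj] makes it vanish. *)
have Aunit : A \in unitmx.
  rewrite -row_free_unit; apply/inj_row_free => v vA0.
  have hv i : v 0 i = 0 + \sum_(j < d) v 0 j * G j (tnth (in_tuple s) i).
    move/matrixP/(_ 0 i): vA0; rewrite mulmxBr mulmx1 !mxE => /eqP.
    rewrite subr_eq0 => /eqP ->; rewrite add0r.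
    by apply: eq_bigr => j _; rewrite mxE.
  have S0 : S (fun=> 0) = fun=> 0.
    apply: l2b_small_eq0 => e e0; apply: l2b_le (Scontr (@l2b0 R I)).
    by rewrite mul0r ltW.
  have := @lift (fun=> 0) (fun=> 0) (fun j => v 0 j).
  have l20 : l2 (fun _ : I => 0 : R[i]) by exists 0; exact: l2b0.
  have S00 (n : I) : (0 : R[i]) = 0 + S (fun=> 0) n by rewrite S0 addr0.
  move=> /(_ l20 S00 hv); set w := (fun n => _) => wC.
  have w0 : w = fun=> 0.
    apply: Cinj => [|n]; last by rewrite {1}wC add0r.
    apply: l2D => //; by apply: l2_sum => j; exact: l2Z.
  apply/matrixP => k i; rewrite !ord1 mxE hv.
  by have /(congr1 (fun f => f (tnth (in_tuple s) i))) := w0.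
pose W := \sum_(i < d) \sum_(j < d) normc (invmx A i j).
have W0 : 0 <= W by do 2![apply: sumr_ge0 => ? _]; exact: normc_ge0.
pose D := \sum_(j < d) (W * 5) * (5 * M).
have D0 : 0 <= D by apply: sumr_ge0 => j _; rewrite !mulr_ge0.
exists (5 + D) => [|f B hf]; first by rewrite addr_ge0.
have B0 := l2b_ge0 hf.
have [g gB gS] := neumann SB Scontr hf.
pose b : 'rV[R[i]]_d := \row_i g (tnth (in_tuple s) i).
pose h : 'rV[R[i]]_d := b *m invmx A.
have hA : h *m A = b by rewrite mulmxKV.
have hh i : h 0 i = g (tnth (in_tuple s) i) + \sum_(j < d) h 0 j * G j (tnth (in_tuple s) i).
  have -> : g (tnth (in_tuple s) i) = b 0 i by rewrite mxE.
  rewrite -hA mulmxBr mulmx1 [in RHS]mxE [X in _ + X + _]mxE [X in _ - X + _]mxE.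
  have -> : \sum_j h 0 j * (\matrix_(j0, i0) G j0 (tnth (in_tuple s) i0)) j i =
      \sum_(j < d) h 0 j * G j (tnth (in_tuple s) i).
    by apply: eq_bigr => j _; congr (_ * _); rewrite mxE.
  by rewrite subrK.
have hB j : normc (h 0 j) <= W * 5 * B.
  rewrite mxE; apply: le_trans (normc_sum _ _ _) _.
  rewrite -mulrA /W mulr_suml; apply: ler_sum => i _.
  rewrite normcM mulrC mxE.
  apply: ler_pM; rewrite ?normc_ge0//; last exact: l2b_coef gB.
  by rewrite (bigD1 j)//= lerDl sumr_ge0// => k _; exact: normc_ge0.
exists (fun n => g n + \sum_(j < d) h 0 j * G j n); last first.
  by apply: lift => //; exists (5 * B).
have -> : (5 + D) * B = 5 * B + \sum_(j < d) (W * 5 * B) * (5 * M).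
  by rewrite mulrDl; congr (_ + _); rewrite mulr_suml; apply: eq_bigr => j _; ring.
apply: l2b_add => //; apply: l2b_sum => j.
have WB0 : 0 <= W * 5 * B by rewrite !mulr_ge0.
exact: (l2b_mul WB0 (fun=> hB j)).
Qed.

End fredholm.

(** * Complex integrals, Fourier coefficients and Bessel's inequality *)

Section complex_integral.
Variable R : realType.
Implicit Types (f g h : R -> R[i]) (k z : R[i]).

Local Notation mu := (@lebesgue_measure R).
Local Notation T := (torus R).

Lemma ae_imply (P Q : R -> Prop) : (forall x, P x -> Q x) ->
  {ae mu, forall x, P x} -> {ae mu, forall x, Q x}.
Proof. by move=> PQ; apply: filterS => //; exact: (ae_filter_ringOfSetsType mu). Qed.

Lemma ae_imply2 (P Q S : R -> Prop) : (forall x, P x -> Q x -> S x) ->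
  {ae mu, forall x, P x} -> {ae mu, forall x, Q x} -> {ae mu, forall x, S x}.
Proof. by move=> PQ; apply: filterS2 => //; exact: (ae_filter_ringOfSetsType mu). Qed.

Lemma measurable_torus :
  measurable (T : set (g_sigma_algebraType R.-ocitv.-measurable)).
Proof. exact: measurable_itv. Qed.
Hint Resolve measurable_torus : core.

Lemma torus_measure : mu T = (2 * pi)%:E.
Proof.
rewrite /torus lebesgue_measure_itv/= lte_fin gtrN ?pi_gt0// -EFinB.
by congr (_%:E); ring.
Qed.

Lemma torus_measure_fin : (mu T < +oo)%E.
Proof. by rewrite torus_measure ltry. Qed.

Definition measC f := measurable_fun [set: R] (fun x => complex.Re (f x)) /\
  measurable_fun [set: R] (fun x => complex.Im (f x)).

Definition perC f := forall x, f (x + 2 * pi) = f x.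

Definition intC f := mu.-integrable T (EFin \o (fun x => complex.Re (f x))) /\
  mu.-integrable T (EFin \o (fun x => complex.Im (f x))).

Lemma measC_D f g : measC f -> measC g -> measC (fun x => f x + g x).
Proof.
move=> [f1 f2] [g1 g2]; split.
- by under eq_fun do rewrite ReD; exact: measurable_funD.
- by under eq_fun do rewrite ImD; exact: measurable_funD.
Qed.

Lemma ReM z k : complex.Re (z * k) = complex.Re z * complex.Re k - complex.Im z * complex.Im k.
Proof. by case: z k => a b []. Qed.

Lemma ImM z k : complex.Im (z * k) = complex.Re z * complex.Im k + complex.Im z * complex.Re k.
Proof. by case: z k => a b []. Qed.

Lemma measC_M f g : measC f -> measC g -> measC (fun x => f x * g x).
Proof.
move=> [f1 f2] [g1 g2]; split.
- by under eq_fun do rewrite ReM; apply: measurable_funB; exact: measurable_funM.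
- by under eq_fun do rewrite ImM; apply: measurable_funD; exact: measurable_funM.
Qed.

Lemma measC_cst k : measC (fun=> k).
Proof. by split; exact: measurable_cst. Qed.

Lemma conjcR (x : R) : (x%:C)^* = x%:C.
Proof. exact: conjc_real. Qed.

Lemma conjcE (a b : R) : (a +i* b)^* = a -i* b.
Proof. by []. Qed.

Lemma conjcM z k : (z * k)^* = z^* * k^*.
Proof. exact: rmorphM. Qed.

Lemma conjcD z k : (z + k)^* = z^* + k^*.
Proof. exact: rmorphD. Qed.

Lemma conjcB z k : (z - k)^* = z^* - k^*.
Proof. exact: rmorphB. Qed.

Lemma ReJ z : complex.Re z^* = complex.Re z. Proof. by case: z. Qed.
Lemma ImJ z : complex.Im z^* = - complex.Im z. Proof. by case: z. Qed.

Lemma measC_J f : measC f -> measC (fun x => (f x)^*).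
Proof.
move=> [f1 f2]; split; first by under eq_fun do rewrite ReJ.
under eq_fun do rewrite ImJ; rewrite (_ : (fun _ => _) = -1 \*o (fun x => complex.Im (f x))); last first.
  by apply/funext => x; rewrite /= mulN1r.
exact: measurable_funM.
Qed.

Lemma measC_normc f : measC f -> measurable_fun [set: R] (fun x => normc (f x) ^+ 2).
Proof.
move=> [f1 f2]; under eq_fun do rewrite sqr_normcE.
by apply: measurable_funD; exact: measurable_funX.
Qed.

Lemma intC_dom f (G : R -> R) : measC f -> mu.-integrable T (EFin \o G) ->
  (forall x, normc (f x) <= G x) -> intC f.
Proof.
move=> [f1 f2] iG fG; split; apply: le_integrable iG => //.
- by apply/measurable_EFinP; exact: measurable_funTS.
- move=> x _ /=; rewrite lee_fin (le_trans (Re_le_normc _))// (le_trans (fG x))// ler_norm//.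
- by apply/measurable_EFinP; exact: measurable_funTS.
- move=> x _ /=; rewrite lee_fin (le_trans (Im_le_normc _))// (le_trans (fG x))// ler_norm//.
Qed.

Lemma integralT_D f g : intC f -> intC g ->
  integralT (fun x => f x + g x) = integralT f + integralT g.
Proof.
move=> [f1 f2] [g1 g2]; rewrite /integralT; simpc; congr (_ +i* _).
- by rewrite -RintegralD//; apply: eq_Rintegral => x _; rewrite ReD.
- by rewrite -RintegralD//; apply: eq_Rintegral => x _; rewrite ImD.
Qed.

Lemma integralT_Z f k : intC f -> integralT (fun x => k * f x) = k * integralT f.
Proof.
move=> [f1 f2]; rewrite /integralT; case: k => a b; simpc; congr (_ +i* _).
- rewrite -!RintegralZl// -RintegralB//.
  + by apply: eq_Rintegral => x _; case: (f x).
  + exact: (integrableZl measurable_torus a f1).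
  + exact: (integrableZl measurable_torus b f2).
- rewrite -!RintegralZl// -RintegralD//.
  + by apply: eq_Rintegral => x _; case: (f x).
  + exact: (integrableZl measurable_torus a f2).
  + exact: (integrableZl measurable_torus b f1).
Qed.

Lemma integralT_J f : intC f -> integralT (fun x => (f x)^*) = (integralT f)^*.
Proof.
move=> [f1 f2]; rewrite /integralT /=; congr (_ +i* _).
  by apply: eq_Rintegral => x _; rewrite ReJ.
rewrite -mulN1r -RintegralZl//; apply: eq_Rintegral => x _.
by rewrite ImJ mulN1r.
Qed.

Lemma integralT_eqT f g : measC f -> measC g -> eqT f g -> integralT f = integralT g.
Proof.
move=> [f1 f2] [g1 g2] fg; rewrite /integralT /Rintegral; congr (_ +i* _).
- congr fine; apply: ae_eq_integral => //.
  + by apply/measurable_EFinP; exact: measurable_funTS.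
  + by apply/measurable_EFinP; exact: measurable_funTS.
  + by apply: ae_imply fg => x /= h Tx; rewrite h.
- congr fine; apply: ae_eq_integral => //.
  + by apply/measurable_EFinP; exact: measurable_funTS.
  + by apply/measurable_EFinP; exact: measurable_funTS.
  + by apply: ae_imply fg => x /= h Tx; rewrite h.
Qed.

Lemma integralT_real (G : R -> R) : integralT (fun x => (G x)%:C) = (Rintegral mu T G)%:C.
Proof.
rewrite /integralT /=; congr (_ +i* _).
by rewrite Rintegral_cst// mul0r.
Qed.

End complex_integral.
#[global] Hint Resolve measurable_torus : core.

(** * The space L^2_per, its inner product and the Cauchy-Schwarz inequality *)

Section L2per_theory.
Variable R : realType.
Implicit Types (f g h : R -> R[i]) (k z : R[i]).

Local Notation mu := (@lebesgue_measure R).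
Local Notation T := (torus R).

Lemma L2per_measC f : L2per f -> measC f. Proof. by case. Qed.

Lemma L2per_sq_integrable f : L2per f ->
  mu.-integrable T (EFin \o (fun x => normc (f x) ^+ 2)).
Proof.
move=> hf; have [m1 m2 per fin] := hf; apply/integrableP; split.
  by apply/measurable_EFinP/measurable_funTS; apply: measC_normc.
by under eq_integral => x _ do rewrite /= ger0_norm ?sqr_ge0//.
Qed.

Lemma L2per_dom f (G : R -> R) : measC f -> perC f -> mu.-integrable T (EFin \o G) ->
  (forall x, normc (f x) ^+ 2 <= G x) -> L2per f.
Proof.
move=> [m1 m2] per iG fG; split => //.
have /integrableP[_ ] : mu.-integrable T (EFin \o (fun x => normc (f x) ^+ 2)).
  apply: le_integrable iG => //.
    by apply/measurable_EFinP/measurable_funTS; exact: measC_normc.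
  by move=> x _ /=; rewrite lee_fin ger0_norm ?sqr_ge0// (le_trans (fG x))// ler_norm.
by under eq_integral => x _ do rewrite /= ger0_norm ?sqr_ge0//.
Qed.

Lemma cst_integrable (K : R) : mu.-integrable T (EFin \o (fun=> K)).
Proof.
apply/integrableP; split; first exact: measurable_cst.
under eq_integral do rewrite /=.
by rewrite integral_cst// lte_mul_pinfty// ?lee_fin// torus_measure_fin.
Qed.

Lemma L2per_bounded f K : measC f -> perC f -> (forall x, normc (f x) <= K) -> L2per f.
Proof.
move=> mf pf fK; apply: (L2per_dom mf pf (cst_integrable (K ^+ 2))) => x.
by rewrite ler_pXn2r ?nnegrE ?normc_ge0// (le_trans (normc_ge0 _) (fK x)).
Qed.

Lemma L2per_mul f g K : measC f -> perC f -> (forall x, normc (f x) <= K) ->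
  L2per g -> L2per (fun x => f x * g x).
Proof.
move=> mf pf fK hg; have [g1 g2 pg _] := hg.
apply: (@L2per_dom _ (fun x => K ^+ 2 * normc (g x) ^+ 2)).
- by apply: measC_M.
- by move=> x; rewrite pf pg.
- exact: (integrableZl _ (K ^+ 2) (L2per_sq_integrable hg)).
move=> x; rewrite normcM exprMn ler_wpM2r ?sqr_ge0//.
by rewrite ler_pXn2r ?nnegrE ?normc_ge0// (le_trans (normc_ge0 _) (fK x)).
Qed.

Lemma L2per_Z k f : L2per f -> L2per (fun x => k * f x).
Proof. by apply: (@L2per_mul (fun=> k) f (normc k)) => //; exact: measC_cst. Qed.

Lemma L2per_D f g : L2per f -> L2per g -> L2per (fun x => f x + g x).
Proof.
move=> hf hg; have [_ _ pf _] := hf; have [_ _ pg _] := hg.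
apply: (@L2per_dom _ (fun x => 2 * (normc (f x) ^+ 2 + normc (g x) ^+ 2))).
- by apply: measC_D; exact: L2per_measC.
- by move=> x; rewrite pf pg.
- apply: (integrableZl _ 2 (integrableD _ (L2per_sq_integrable hf) (L2per_sq_integrable hg))) => //.
move=> x; apply: (@le_trans _ _ ((normc (f x) + normc (g x)) ^+ 2)).
  by rewrite ler_pXn2r ?nnegrE ?addr_ge0 ?normc_ge0 ?normcD.
by have := sqr_ge0 (normc (f x) - normc (g x)); lra.
Qed.

Lemma L2per_B f g : L2per f -> L2per g -> L2per (fun x => f x - g x).
Proof.
move=> hf hg; under eq_fun do rewrite -mulN1r.
by apply: L2per_D => //; exact: L2per_Z.
Qed.

Lemma L2per_J f : L2per f -> L2per (fun x => (f x)^*).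
Proof.
move=> hf; have [_ _ pf _] := hf.
apply: (L2per_dom _ _ (L2per_sq_integrable hf)) => [|x|x].
- by apply: measC_J; exact: L2per_measC.
- by rewrite pf.
- by rewrite normcJ.
Qed.

Lemma L2per_cst k : L2per (fun=> k).
Proof. by apply: (@L2per_bounded _ (normc k)) => //; exact: measC_cst. Qed.

Lemma L2per_sum (J : Type) (r : seq J) (U : J -> R -> R[i]) :
  (forall j, L2per (U j)) -> L2per (fun x => \sum_(j <- r) U j x).
Proof.
move=> h; elim: r => [|j r IH].
  by under eq_fun do rewrite big_nil; exact: L2per_cst.
by under eq_fun do rewrite big_cons; exact: L2per_D.
Qed.

Lemma intC_mul f g : L2per f -> L2per g -> intC (fun x => f x * g x).
Proof.
move=> hf hg; apply: (@intC_dom _ _ (fun x => normc (f x) ^+ 2 + normc (g x) ^+ 2)).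
- by apply: measC_M; exact: L2per_measC.
- exact: (integrableD _ (L2per_sq_integrable hf) (L2per_sq_integrable hg)).
move=> x; rewrite normcM; have := sqr_ge0 (normc (f x) - normc (g x)).
have := mulr_ge0 (normc_ge0 (f x)) (normc_ge0 (g x)); lra.
Qed.

Lemma intC_ip f g : L2per f -> L2per g -> intC (fun x => (f x)^* * g x).
Proof. by move=> hf; apply: intC_mul; exact: L2per_J. Qed.

Lemma intC_L2 f : L2per f -> intC f.
Proof.
move=> hf; have := intC_mul (L2per_cst 1) hf.
by congr (intC _); apply/funext => x; rewrite mul1r.
Qed.

Local Notation ip := (@innerL2 R).

Lemma ipDr f g h : L2per f -> L2per g -> L2per h ->
  ip f (fun x => g x + h x) = ip f g + ip f h.
Proof.
move=> hf hg hh; rewrite /innerL2 -integralT_D; [|exact: intC_ip..].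
by congr integralT; apply/funext => x; rewrite mulrDr.
Qed.

Lemma ipZr f g k : L2per f -> L2per g -> ip f (fun x => k * g x) = k * ip f g.
Proof.
move=> hf hg; rewrite /innerL2 -integralT_Z; last exact: intC_ip.
by congr integralT; apply/funext => x; rewrite mulrCA.
Qed.

Lemma ipBr f g h : L2per f -> L2per g -> L2per h ->
  ip f (fun x => g x - h x) = ip f g - ip f h.
Proof.
move=> hf hg hh; under eq_fun do rewrite -mulN1r.
by rewrite ipDr ?ipZr ?mulN1r//; exact: L2per_Z.
Qed.

Lemma ipC f g : L2per f -> L2per g -> ip g f = (ip f g)^*.
Proof.
move=> hf hg; rewrite /innerL2 -integralT_J; last exact: intC_ip.
by congr integralT; apply/funext => x; rewrite conjcM conjCK mulrC.
Qed.

Lemma ipDl f g h : L2per f -> L2per g -> L2per h ->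
  ip (fun x => g x + h x) f = ip g f + ip h f.
Proof.
move=> hf hg hh; rewrite ipC//; last exact: L2per_D.
by rewrite ipDr// conjcD -!ipC.
Qed.

Lemma ipZl f g k : L2per f -> L2per g -> ip (fun x => k * g x) f = k^* * ip g f.
Proof.
move=> hf hg; rewrite ipC//; last exact: L2per_Z.
by rewrite ipZr// conjcM -ipC.
Qed.

Lemma ipBl f g h : L2per f -> L2per g -> L2per h ->
  ip (fun x => g x - h x) f = ip g f - ip h f.
Proof.
move=> hf hg hh; rewrite ipC//; last exact: L2per_B.
by rewrite ipBr// conjcB -!ipC.
Qed.

Lemma ip_sumr (J : Type) (r : seq J) f (U : J -> R -> R[i]) :
  L2per f -> (forall j, L2per (U j)) ->
  ip f (fun x => \sum_(j <- r) U j x) = \sum_(j <- r) ip f (U j).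
Proof.
move=> hf hU; elim: r => [|j r IH].
  under eq_fun do rewrite big_nil; rewrite big_nil.
  by have := ipZr 0 hf (L2per_cst 0); rewrite !mul0r.
under eq_fun do rewrite big_cons; rewrite big_cons ipDr ?IH//.
exact: L2per_sum.
Qed.

Lemma normL2_ge0 f : 0 <= normL2 f. Proof. exact: sqrtr_ge0. Qed.

Lemma normL2_sqr f : normL2 f ^+ 2 = Rintegral mu T (fun x => normc (f x) ^+ 2).
Proof. by rewrite sqr_sqrtr// Rintegral_ge0// => x _; exact: sqr_ge0. Qed.

Lemma ip_norm f : ip f f = (normL2 f ^+ 2)%:C.
Proof.
rewrite normL2_sqr -integralT_real /innerL2.
by congr integralT; apply/funext => x; rewrite mul_conjc.
Qed.

Lemma normL2_Z k f : L2per f -> normL2 (fun x => k * f x) = normc k * normL2 f.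
Proof.
move=> hf; apply/eqP; rewrite -(@eqrXn2 _ 2) ?mulr_ge0 ?normc_ge0 ?normL2_ge0//.
rewrite -(inj_eq (@complexI R)) -ip_norm ipZl//; last exact: L2per_Z.
by rewrite ipZr// ip_norm mulrA mul_conjc -rmorphM exprMn.
Qed.

Lemma normL2D_sqr f g : L2per f -> L2per g ->
  normL2 (fun x => f x + g x) ^+ 2 =
    normL2 f ^+ 2 + normL2 g ^+ 2 + 2 * complex.Re (ip f g).
Proof.
move=> hf hg; apply: (@complexI R); rewrite -ip_norm.
rewrite ipDr//; last exact: L2per_D.
rewrite !ipDl// !ip_norm (ipC hf hg); case: (ip f g) => a b.
by apply/eqP; rewrite conjcE eq_complex /=; apply/andP; split; apply/eqP; ring.
Qed.

(** The norm of [s f - conj(z) g] is expanded for [s > 0]. The value [s = b^2 + d] with [d] tending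
    to 0, instead of [s = b^2], covers the case [b = 0] as well. *)
Lemma ip_cauchy_schwarz f g : L2per f -> L2per g ->
  normc (ip f g) <= normL2 f * normL2 g.
Proof.
move=> hf hg; set z := ip f g; set a := normL2 f; set b := normL2 g.
have a0 : 0 <= a by exact: normL2_ge0.
have b0 : 0 <= b by exact: normL2_ge0.
have key (s : R) : 0 < s -> normc z ^+ 2 * (2 * s - b ^+ 2) <= s ^+ 2 * a ^+ 2.
  move=> s0.
  have := sqr_ge0 (normL2 (fun x => s%:C * f x + (- z^*) * g x)).
  rewrite normL2D_sqr; [|exact: L2per_Z..].
  rewrite !normL2_Z// normcR ipZl ?ipZr//; last exact: L2per_Z.
  rewrite normcN normcJ -/a -/b -/z (gtr0_norm s0).
  have -> : complex.Re ((s%:C)^* * (- z^* * z)) = - (s * normc z ^+ 2).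
    by rewrite conjcR mulNr mulrN mul_conjc -rmorphM.
  by rewrite !exprMn; lra.
rewrite -(@ler_pXn2r _ 2) ?nnegrE ?normc_ge0 ?mulr_ge0// exprMn.
apply/ler_addgt0Pr => e e0.
pose d := e / (a ^+ 2 + 1).
have d0 : 0 < d by rewrite divr_gt0// ltr_wpDl// sqr_ge0.
have s0 : 0 < b ^+ 2 + d by rewrite ltr_wpDl// sqr_ge0.
have := key _ s0.
have h : normc z ^+ 2 * (b ^+ 2 + d) <= normc z ^+ 2 * (2 * (b ^+ 2 + d) - b ^+ 2).
  by apply: ler_wpM2l; [exact: sqr_ge0|lra].
move=> /(le_trans h); rewrite [_ * (_ + _)]mulrC (expr2 (b ^+ 2 + d)) -mulrA.
rewrite ler_pM2l//.
have -> : (b ^+ 2 + d) * a ^+ 2 = a ^+ 2 * b ^+ 2 + d * a ^+ 2 by ring.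
move/le_trans; apply; rewrite lerD2l /d.
by rewrite mulrAC ler_pdivrMr ?ltr_wpDl ?sqr_ge0// ler_pM2l// lerDl.
Qed.

Lemma normL2_D f g : L2per f -> L2per g ->
  normL2 (fun x => f x + g x) <= normL2 f + normL2 g.
Proof.
move=> hf hg.
rewrite -(@ler_pXn2r _ 2) ?nnegrE ?normL2_ge0 ?addr_ge0 ?normL2_ge0// normL2D_sqr//.
have := ip_cauchy_schwarz hf hg.
have := le_trans (ler_norm _) (Re_le_normc (ip f g)); lra.
Qed.

Lemma normL2_mul f g K : measC f -> perC f -> (forall x, normc (f x) <= K) ->
  L2per g -> normL2 (fun x => f x * g x) <= K * normL2 g.
Proof.
move=> mf pf fK hg; have K0 : 0 <= K := le_trans (normc_ge0 _) (fK 0).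
rewrite -(@ler_pXn2r _ 2) ?nnegrE ?normL2_ge0 ?mulr_ge0 ?normL2_ge0//.
rewrite exprMn !normL2_sqr -RintegralZl//; last exact: L2per_sq_integrable.
apply: le_Rintegral => //.
- by apply: L2per_sq_integrable; exact: L2per_mul hg.
- exact: (integrableZl _ _ (L2per_sq_integrable hg)).
move=> x _; rewrite normcM exprMn ler_wpM2r ?sqr_ge0//.
by rewrite ler_pXn2r ?nnegrE ?normc_ge0.
Qed.

Lemma normL2_eqT f g : measC f -> measC g -> eqT f g -> normL2 f = normL2 g.
Proof.
move=> mf mg fg; congr Num.sqrt; rewrite /Rintegral; congr fine.
apply: ae_eq_integral => //.
- by apply/measurable_EFinP/measurable_funTS; exact: measC_normc.
- by apply/measurable_EFinP/measurable_funTS; exact: measC_normc.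
- by apply: ae_imply fg => x /= h Tx; rewrite h.
Qed.

Lemma ip_eqTr f g h : L2per f -> L2per g -> L2per h -> eqT g h -> ip f g = ip f h.
Proof.
move=> hf hg hh gh; apply: integralT_eqT.
- by apply: measC_M; [apply: measC_J|]; exact: L2per_measC.
- by apply: measC_M; [apply: measC_J|]; exact: L2per_measC.
- by apply: ae_imply gh => x /= e Tx; rewrite e.
Qed.

End L2per_theory.

(** * Exponentials, trigonometric polynomials and Bessel's inequality *)

Section trigonometric_system.
Variable R : realType.
Implicit Types (f g : R -> R[i]) (n m : int) (a : int -> R[i]) (s : seq int).

Local Notation mu := (@lebesgue_measure R).
Local Notation T := (torus R).
Local Notation ip := (@innerL2 R).

Definition expi n (x : R) : R[i] := cos (n%:~R * x) +i* sin (n%:~R * x).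

Lemma expi0 x : expi 0 x = 1.
Proof. by rewrite /expi mulr0z mul0r cos0 sin0. Qed.

Lemma expiD n m x : expi (n + m) x = expi n x * expi m x.
Proof.
rewrite /expi intrD mulrDl cosD sinD; simpc.
by congr (_ +i* _); ring.
Qed.

Lemma expiJ n x : (expi n x)^* = expi (- n) x.
Proof. by rewrite /expi conjcE mulrNz mulNr cosN sinN. Qed.

Lemma normc_expi n x : normc (expi n x) = 1.
Proof. by rewrite /expi /= cos2Dsin2 sqrtr1. Qed.

Lemma expi_per n : perC (expi n).
Proof.
have e1 x : expi 1 (x + 2 * pi) = expi 1 x.
  rewrite /expi !mul1r; have -> : 2 * pi = pi *+ 2 :> R by rewrite mulr_natl.
  by rewrite cosD2pi sinD2pi.
have en (k : nat) x : expi k%:Z (x + 2 * pi) = expi k%:Z x.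
  elim: k => [|k IH]; first by rewrite !expi0.
  by rewrite -addn1 PoszD !expiD e1 IH.
move=> x; case: n => k; first exact: en.
by rewrite NegzE -!expiJ en.
Qed.

Lemma measC_expi n : measC (expi n).
Proof.
split; apply: continuous_measurable_fun => x.
- apply: continuous_comp; last exact: continuous_cos.
  exact: mulrl_continuous.
- apply: continuous_comp; last exact: continuous_sin.
  exact: mulrl_continuous.
Qed.

Lemma L2per_expi n : L2per (expi n).
Proof.
apply: (@L2per_bounded _ _ 1); [exact: measC_expi|exact: expi_per|].
by move=> x; rewrite normc_expi.
Qed.
Hint Resolve L2per_expi : core.

Lemma Rintegral_torus_FTC (f F : R -> R) : continuous f ->
  (forall x : R, is_derive x 1 F (f x)) -> Rintegral mu T f = F pi - F (- pi).
Proof.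
move=> cf dF; rewrite /Rintegral (@continuous_FTC2 _ f F)//.
- by rewrite gtrN// pi_gt0.
- by apply: continuous_subspaceT => x; exact: cf.
- have cF : continuous F.
    by move=> x; apply: differentiable_continuous; apply/derivable1_diffP; exact: ex_derive.
  split.
  + by move=> x _; exact: ex_derive.
  + by apply: cvg_at_right_filter; exact: cF.
  + by apply: cvg_at_left_filter; exact: cF.
- by move=> x _; rewrite derive1E; exact: derive_val.
Qed.

Lemma integralT_expi n : integralT (expi n) = if n == 0 then (2 * pi)%:C else 0.
Proof.
case: eqP => [->|/eqP n0].
  have -> : expi 0 = fun=> (1 : R)%:C by apply/funext => x; rewrite expi0.
  rewrite (@integralT_real _ (fun=> 1)) Rintegral_cst// mul1r.
  by congr (_%:C); exact: (congr1 fine (torus_measure R)).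
have nR : (n%:~R : R) != 0 by rewrite intr_eq0.
rewrite /integralT /expi /=.
have cc : continuous (fun x : R => cos (n%:~R * x)).
  move=> x; apply: continuous_comp; last exact: continuous_cos.
  exact: mulrl_continuous.
have cs : continuous (fun x : R => sin (n%:~R * x)).
  move=> x; apply: continuous_comp; last exact: continuous_sin.
  exact: mulrl_continuous.
have dl (x : R) : is_derive x 1 (fun y : R => n%:~R * y) n%:~R.
  by apply: is_derive_eq; rewrite scaler1.
have dS (x : R) : is_derive x 1 (fun y : R => n%:~R^-1 * sin (n%:~R * y)) (cos (n%:~R * x)).
  have h := is_derive1_comp (is_derive_sin (n%:~R * x)) (dl x).
  by apply: is_derive_eq; rewrite /GRing.scale/=; field.
have dC (x : R) : is_derive x 1 (fun y : R => - (n%:~R^-1 * cos (n%:~R * y))) (sin (n%:~R * x)).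
  have h := is_derive1_comp (is_derive_cos (n%:~R * x)) (dl x).
  by apply: is_derive_eq; rewrite /GRing.scale/=; field.
rewrite (Rintegral_torus_FTC cc dS) (Rintegral_torus_FTC cs dC).
have : expi n (- pi + 2 * pi) = expi n (- pi) := expi_per n (- pi).
have -> : - pi + 2 * pi = pi :> R by ring.
by rewrite /expi => -[-> ->]; rewrite !subrr.
Qed.

Lemma ip_expi n m : ip (expi n) (expi m) = if n == m then (2 * pi)%:C else 0.
Proof.
rewrite /innerL2.
have -> : (fun x : R => (expi n x)^* * expi m x) = expi (m - n).
  by apply/funext => x; rewrite expiJ addrC expiD.
by rewrite integralT_expi subr_eq0 eq_sym.
Qed.

Lemma twopi_gt0 : 0 < 2 * pi :> R. Proof. by rewrite mulr_gt0// pi_gt0. Qed.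

Lemma fourierE f n : fourier f n = ((2 * pi)^-1)%:C * ip (expi n) f.
Proof.
by congr (_ * integralT _); apply/funext => x; rewrite conjcE mulrC.
Qed.

Lemma ip_expi_fourier f n : ip (expi n) f = (2 * pi)%:C * fourier f n.
Proof. by rewrite fourierE mulrA -rmorphM divff ?mul1r// gt_eqF// twopi_gt0. Qed.

Lemma fourierD f g n : L2per f -> L2per g ->
  fourier (fun x => f x + g x) n = fourier f n + fourier g n.
Proof. by move=> hf hg; rewrite !fourierE ipDr// mulrDr. Qed.

Lemma fourierB f g n : L2per f -> L2per g ->
  fourier (fun x => f x - g x) n = fourier f n - fourier g n.
Proof. by move=> hf hg; rewrite !fourierE ipBr// mulrBr. Qed.

Lemma fourierZ f k n : L2per f -> fourier (fun x => k * f x) n = k * fourier f n.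
Proof. by move=> hf; rewrite !fourierE ipZr// mulrCA. Qed.

Lemma fourier_eqT f g n : L2per f -> L2per g -> eqT f g -> fourier f n = fourier g n.
Proof. by move=> hf hg fg; rewrite !fourierE (ip_eqTr _ hf hg fg). Qed.

Lemma fourier_expi m n : fourier (expi m) n = (n == m)%:R.
Proof.
rewrite fourierE ip_expi; case: eqP => _; last by rewrite mulr0.
by rewrite -rmorphM mulVf ?gt_eqF ?twopi_gt0.
Qed.

Definition trig s a (x : R) : R[i] := \sum_(n <- s) a n * expi n x.

Lemma L2per_trig s a : L2per (trig s a).
Proof. by apply: L2per_sum => n; exact: L2per_Z. Qed.
Hint Resolve L2per_trig : core.

Lemma sum_delta (K : nzRingType) s (b : int -> K) n : uniq s ->
  \sum_(m <- s) b m * (n == m)%:R = if n \in s then b n else 0.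
Proof.
move=> us; case: ifPn => ns.
  rewrite (bigD1_seq n)//= eqxx mulr1 big1 ?addr0// => m mn.
  by rewrite eq_sym (negbTE mn) mulr0.
rewrite big_seq big1// => m ms; case: eqP => [nm|_]; last by rewrite mulr0.
by rewrite nm ms in ns.
Qed.

Lemma fourier_trig s a n : uniq s -> fourier (trig s a) n = if n \in s then a n else 0.
Proof.
move=> us; rewrite fourierE ip_sumr//; last by move=> m; exact: L2per_Z.
rewrite mulr_sumr -(sum_delta _ _ us); apply: eq_bigr => m _.
by rewrite ipZr// mulrCA -fourierE fourier_expi.
Qed.

Lemma ip_trigr f s a : L2per f ->
  ip f (trig s a) = (2 * pi)%:C * \sum_(n <- s) (fourier f n)^* * a n.
Proof.
move=> hf; rewrite ip_sumr//; last by move=> m; exact: L2per_Z.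
rewrite mulr_sumr; apply: eq_bigr => n _; rewrite ipZr//.
by rewrite (ipC _ hf)// ip_expi_fourier conjcM conjcR; ring.
Qed.

Lemma normL2_trig s a : uniq s ->
  normL2 (trig s a) ^+ 2 = 2 * pi * \sum_(n <- s) normc (a n) ^+ 2.
Proof.
move=> us; apply: (@complexI R); rewrite -ip_norm ip_trigr// [RHS]rmorphM rmorph_sum/=.
congr (_ * _); rewrite !big_seq; apply: eq_bigr => n ns.
by rewrite fourier_trig// ns mul_conjc.
Qed.

Lemma pythagoras f s : L2per f -> uniq s ->
  normL2 (fun x => f x - trig s (fourier f) x) ^+ 2 =
    normL2 f ^+ 2 - 2 * pi * \sum_(n <- s) normc (fourier f n) ^+ 2.
Proof.
move=> hf us; set P := trig s (fourier f).
have hP : L2per P by exact: L2per_trig.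
have hfP := L2per_B hf hP.
have fE : f = fun x => (f x - P x) + P x by apply/funext => x; rewrite subrK.
have : normL2 f ^+ 2 = normL2 (fun x => f x - P x) ^+ 2 + normL2 P ^+ 2.
  rewrite {1}fE normL2D_sqr// [ip _ _]ip_trigr// big_seq big1 ?mulr0 ?addr0//.
  by move=> n ns; rewrite fourierB// fourier_trig// ns subrr conjC0 mul0r.
by rewrite (@normL2_trig s (fourier f) us) => h; rewrite [X in _ = X - _]h addrK.
Qed.

(** The L^2 norm of each exponential. Coefficients are normalized by the mean, so this factor
    converts their l2 bounds into L^2 norms. *)
Definition r2pi : R := Num.sqrt (2 * pi).

Lemma r2pi_gt0 : 0 < r2pi. Proof. by rewrite sqrtr_gt0 twopi_gt0. Qed.

Lemma r2pi_sqr : r2pi ^+ 2 = 2 * pi. Proof. by rewrite sqr_sqrtr// ltW// twopi_gt0. Qed.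

Lemma bessel f : L2per f -> l2b (fourier f) (normL2 f / r2pi).
Proof.
move=> hf; split=> [|s us]; first by rewrite divr_ge0 ?normL2_ge0// ltW// r2pi_gt0.
have := sqr_ge0 (normL2 (fun x => f x - trig s (fourier f) x)).
rewrite pythagoras// subr_ge0 expr_div_n r2pi_sqr => h.
by rewrite ler_pdivlMr ?twopi_gt0// mulrC.
Qed.

Lemma normL2_trig_l2b s a B : uniq s -> l2b a B -> normL2 (trig s a) <= r2pi * B.
Proof.
move=> us [B0 aB].
rewrite -(@ler_pXn2r _ 2) ?nnegrE ?normL2_ge0 ?mulr_ge0 ?(ltW r2pi_gt0)//.
by rewrite normL2_trig// exprMn r2pi_sqr ler_pM2l ?twopi_gt0// aB.
Qed.

Definition box (N : nat) : seq int := [seq i%:Z - N%:Z | i <- iota 0 (2 * N).+1].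

Arguments box : simpl never.

Lemma box_uniq N : uniq (box N).
Proof.
by rewrite map_inj_uniq ?iota_uniq// => i j /addIr/eqP; rewrite eqz_nat => /eqP.
Qed.

Lemma mem_box N n : (n \in box N) = (`|n| <= N)%N.
Proof.
apply/mapP/idP => [[j]|nN].
  by rewrite mem_iota => /andP[_ jN] ->; lia.
exists (absz (n + N%:Z)); first by rewrite mem_iota; lia.
by lia.
Qed.

(** [box N] is chosen so that its sum is within [e^2] of the supremum over all boxes. A list outside
    a larger box, joined to [box N], still fits in some box, so it has less than [e^2] left. *)
Lemma l2b_tail a B e : l2b a B -> 0 < e ->
  exists N, forall M, (N <= M)%N -> l2b (fun n => if n \in box M then 0 else a n) e.
Proof.
move=> [B0 aB] e0; pose F N := \sum_(n <- box N) normc (a n) ^+ 2.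
have hs : has_sup (range F).
  split; first by exists (F 0%N), 0%N.
  by exists (B ^+ 2) => _ [N _ <-]; exact: aB (box_uniq N).
have [_ [N _ <-] hN] := sup_adherent (exprn_gt0 2 e0) hs.
exists N => M NM; split=> [|s us]; first exact: ltW.
pose s' := [seq n <- s | n \notin box M].
have us' : uniq s' by rewrite filter_uniq.
have -> : \sum_(n <- s) normc (if n \in box M then 0 else a n) ^+ 2 =
    \sum_(n <- s') normc (a n) ^+ 2.
  rewrite big_filter [RHS]big_mkcond; apply: eq_bigr => n _.
  by case: ifP => _; rewrite ?normcr0 ?expr0n.
pose L := (M + \sum_(n <- s') `|n|)%N.
have hL : F N + \sum_(n <- s') normc (a n) ^+ 2 <= F L.
  rewrite /F -big_cat/=.
  have uc : uniq (box N ++ s').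
    rewrite cat_uniq box_uniq us' /= andbT; apply/hasPn => n.
    by rewrite mem_filter !mem_box => /andP[]; lia.
  have -> : \sum_(n <- box L) normc (a n) ^+ 2 =
      \sum_(n <- box N ++ s') normc (a n) ^+ 2 +
      \sum_(n <- box L | n \notin box N ++ s') normc (a n) ^+ 2.
    rewrite (bigID (fun n => n \in box N ++ s')); congr (_ + _).
    rewrite -big_filter; apply: perm_big; apply: uniq_perm => //.
      by rewrite filter_uniq// box_uniq.
    move=> n; rewrite mem_filter andb_idr// mem_cat !mem_box => /orP[nN|ns'].
      by rewrite /L; lia.
    by rewrite /L (big_rem n ns')/=; lia.
  by rewrite lerDl sumr_ge0// => n _; exact: sqr_ge0.
have : F L <= sup (range F) by apply: ub_le_sup; [case: hs|exists L].
by move: hN hL; lra.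
Qed.

End trigonometric_system.
#[global] Hint Resolve L2per_expi L2per_trig : core.

(** * Completeness of the trigonometric system *)

Section riesz_fischer.
Variable R : realType.
Implicit Types (f g : R -> R[i]) (n : int) (a : int -> R[i]) (s : seq int).

Local Notation mu := (@lebesgue_measure R).
Local Notation T := (torus R).

Lemma sum_box (V : nmodType) (N M : nat) (F : int -> V) : (N <= M)%N ->
  \sum_(n <- box N) F n = \sum_(n <- box M) (if n \in box N then F n else 0).
Proof.
move=> NM; rewrite -big_mkcond -[RHS]big_filter; apply: perm_big; apply: uniq_perm.
- exact: box_uniq.
- by rewrite filter_uniq// box_uniq.
- by move=> n; rewrite mem_filter !mem_box; lia.
Qed.

Lemma trig_boxB a (N M : nat) : (N <= M)%N ->
  (fun x => trig (box M) a x - trig (box N) a x) =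
  trig (box M) (fun n => if n \in box N then 0 else a n).
Proof.
move=> NM; apply/funext => x; rewrite /trig (sum_box _ NM) -sumrB.
by apply: eq_bigr => n _; case: ifP => _; rewrite ?subrr ?mul0r ?subr0.
Qed.

Lemma normc_dist (z w : R[i]) : `|normc z - normc w| <= normc (z - w).
Proof.
have := normcD (z - w) w; have := normcD (w - z) z.
rewrite !subrK (normcBC w) ler_norml; lra.
Qed.

Lemma einf_le_bound (u : (\bar R)^nat) (C : \bar R) :
  (forall k, (u k <= C)%E) -> (limn_einf u <= C)%E.
Proof.
move=> uC; rewrite limn_einf_lim; apply: lime_le; first exact: is_cvg_einfs.
apply: nearW => n; apply: le_trans (uC n).
by apply: ereal_inf_lbound; exists n => /=.
Qed.

Lemma real_eps0 (x C : R) : 0 <= x -> 0 <= C ->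
  (forall k, x <= C / 2 ^+ k) -> x = 0.
Proof.
move=> x0 C0 h; apply/eqP; rewrite eq_le x0 andbT.
apply/ler_addgt0Pr => d d0; rewrite add0r.
have [m hm] := geometric_small C d0; exact: le_trans (h m) hm.
Qed.

(** Completeness of L^2_per: a rapidly convergent subsequence of partial sums converges almost
    everywhere, and Fatou's lemma identifies the L^2 distance to its limit. *)
Lemma riesz_fischer a B : l2b a B ->
  exists W, [/\ L2per W, forall n, fourier W n = a n & normL2 W <= r2pi R * B].
Proof.
move=> aB; have B0 := l2b_ge0 aB.
have /choice[N0 hN0] : forall k : nat, exists N, forall M, (N <= M)%N ->
    l2b (fun n => if n \in box M then 0 else a n) (4^-1 ^+ k).
  by move=> k; apply: l2b_tail aB _; rewrite exprn_gt0// invr_gt0.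
(* Cumulative sums make the cut-offs nondecreasing and keep each one at least [N0 k]. *)
pose N k := (\sum_(i < k.+1) N0 i)%N.
have NS k : (N k <= N k.+1)%N by rewrite /N [X in (_ <= X)%N]big_ord_recr leq_addr.
have Nmon k l : (k <= l)%N -> (N k <= N l)%N.
  elim: l => [|l IH]; first by rewrite leqn0 => /eqP ->.
  by rewrite leq_eqVlt ltnS => /orP[/eqP -> //|/IH h]; exact: leq_trans h (NS l).
have tailN k : l2b (fun n => if n \in box (N k) then 0 else a n) (4^-1 ^+ k).
  by apply: hN0; rewrite /N big_ord_recr leq_addl.
pose F k := trig (box (N k)) a.
have L2F k : L2per (F k) by exact: L2per_trig.
have dF k l : (k <= l)%N -> normL2 (fun x => F l x - F k x) <= r2pi R * 4^-1 ^+ k.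
  move=> kl; rewrite trig_boxB; last exact: Nmon.
  exact: normL2_trig_l2b (box_uniq _) (tailN k).
pose sq k x := normc (F k.+1 x - F k x) ^+ 2.
have sqi k : mu.-integrable T (EFin \o sq k).
  by apply: L2per_sq_integrable; exact: L2per_B.
(* The k-th term integrates to at most [4^k * 2 pi * 16^-k], so [G] is integrable. Where it is
   finite, consecutive partial sums differ by at most [sqrt (G x) / 2^k]. *)
pose G x := (\sum_(0 <= k <oo) (4 ^+ k * sq k x)%:E)%E.
have isq k : mu.-integrable T (fun x => (4 ^+ k * sq k x)%:E).
  exact: (integrableZl (@measurable_torus R) (4 ^+ k) (sqi k)).
have msq k := measurable_int _ (isq k).
have sq0 k x : (0 <= (4 ^+ k * sq k x)%:E)%E.
  by rewrite lee_fin; apply: mulr_ge0; [exact: exprn_ge0|exact: sqr_ge0].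
have G_int : mu.-integrable T G.
  apply/integrableP; split.
    by apply: ge0_emeasurable_sum => // k x _ _; exact: sq0.
  have -> : (\int[mu]_(x in T) `|G x| = \int[mu]_(x in T) G x)%E.
    by apply: eq_integral => x _; rewrite gee0_abs// nneseries_ge0// => k _ _; exact: sq0.
  rewrite integral_nneseries//.
  apply: (@le_lt_trans _ _ (4 * pi)%:E); last by rewrite ltry.
  have pi40 : 0 <= 4 * pi :> R by rewrite mulr_ge0// pi_ge0.
  apply: le_trans (epsilon_trick0 xpredT pi40).
  apply: lee_nneseries => [k _ _|k _]; first by apply: integral_ge0 => x _; exact: sq0.
  rewrite -[X in (X <= _)%E]fineK; last exact: (integrable_fin_num _ (isq k)).
  rewrite -[fine _]/(Rintegral mu T (fun x => 4 ^+ k * sq k x)).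
  rewrite (RintegralZl _ _ (sqi k))// -normL2_sqr lee_fin.
  apply: (@le_trans _ _ (4 ^+ k * (r2pi R * 4^-1 ^+ k) ^+ 2)).
    rewrite ler_pM2l ?exprn_gt0// ler_pXn2r ?nnegrE ?normL2_ge0 ?dF//.
    by rewrite mulr_ge0 ?exprn_ge0// ltW// r2pi_gt0.
  rewrite exprMn r2pi_sqr.
  have -> : 4 ^+ k * (2 * pi * (4^-1 ^+ k) ^+ 2) = 2 * pi * (4^-1 : R) ^+ k.
    by rewrite expr2 exprVn; field; rewrite expf_neq0.
  have -> : 4 * pi / (2 ^ k.+1)%:R = 2 * pi * (2^-1 : R) ^+ k.
    by rewrite natrX exprS exprVn; field; rewrite expf_neq0.
  rewrite ler_pM2l ?twopi_gt0// lerXn2r ?nnegrE//.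
  by rewrite lef_pV2 ?posrE// ler_nat.
have good : {ae mu, forall x, T x -> exists (l : R[i]) (C : R), forall m, normc (l - F m x) <= C / 2 ^+ m}.
  have := integrable_ae (@measurable_torus R) G_int.
  apply: ae_imply => x Gx Tx; have {}Gx := Gx Tx.
  pose g := fine (G x).
  have g0 : 0 <= g by rewrite fine_ge0// nneseries_ge0.
  have [|l hl] := @geometric_cvgc _ (fun m => F m x) (Num.sqrt g).
    move=> m; rewrite -(@ler_pXn2r _ 2) ?nnegrE ?normc_ge0 ?divr_ge0 ?sqrtr_ge0 ?exprn_ge0//.
    rewrite expr_div_n sqr_sqrtr// ler_pdivlMr ?exprn_gt0// -exprM mulnC exprM.
    have -> : (2 : R) ^+ 2 = 4 by ring.
    rewrite mulrC -lee_fin /g fineK//.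
    have := @nneseries_lim_ge R (fun k => (4 ^+ k * sq k x)%:E) xpredT 0%N m.+1 (fun k _ _ => sq0 k x).
    apply: le_trans; rewrite big_nat_recr//= leeDr//.
    by apply: sume_ge0 => k _; exact: sq0.
  by exists l, (4 * Num.sqrt g).
(* Upper limits exist at every point, so [W] is measurable and periodic everywhere, with no
   exceptional set to handle. *)
pose W x := fine (limn_esup (fun k => (complex.Re (F k x))%:E)) +i*
            fine (limn_esup (fun k => (complex.Im (F k x))%:E)).
have mF k : measC (F k) := L2per_measC (L2F k).
have mW : measC W.
  split; apply: measurableT_comp => //; apply: measurable_fun_limn_esup => k.
    by apply/measurable_EFinP; have [] := mF k.
  by apply/measurable_EFinP; have [] := mF k.
have pW : perC W.
  move=> x; rewrite /W; have FE k : F k (x + 2 * pi) = F k x by have [_ _ ->] := L2F k.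
  by under eq_fun do rewrite FE; under [X in _ +i* fine (limn_esup X)]eq_fun do rewrite FE.
have goodW : {ae mu, forall x, T x -> exists C : R, forall m, normc (W x - F m x) <= C / 2 ^+ m}.
  apply: ae_imply good => x h Tx; have [l [C hl]] := h Tx; exists C.
  suff -> : W x = l by [].
  have cv (p : R[i] -> R) : (forall z w : R[i], p (z - w) = p z - p w) ->
      (forall z, `|p z| <= normc z) ->
      fine (limn_esup (fun k => (p (F k x))%:E)) = p l.
    move=> pB pn.
    have cvp : (fun k => p (F k x)) @ \oo --> p l.
      apply/cvgrPdist_le => e e0; have [m hm] := geometric_small C e0.
      exists m => // k /= mk; rewrite -pB; apply: le_trans (pn _) _.
      apply: le_trans (hl k) _; apply: le_trans hm; apply: ler_wpM2l.
        by have := le_trans (normc_ge0 _) (hl 0%N); rewrite expr0 divr1.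
      by rewrite lef_pV2 ?posrE ?exprn_gt0// ler_eXn2l ?ltr1n.
    have cvE : (fun k => (p (F k x))%:E) @ \oo --> (p l)%:E.
      by apply: cvg_EFin => //; exact: nearW.
    by rewrite is_cvg_limn_esupE ?(cvg_lim _ cvE)//; apply/cvg_ex; exists (p l)%:E.
  rewrite /W !cv; first by case: (l).
  - by move=> [? ?] [? ?].
  - exact: Im_le_normc.
  - by move=> [? ?] [? ?].
  - exact: Re_le_normc.
(* Fatou's lemma along the partial sums [F (m + k)], all within [r2pi R * 4^-1 ^+ m] of [F m]. *)
have WF m : L2per (fun x => W x - F m x) /\
    normL2 (fun x => W x - F m x) <= r2pi R * 4^-1 ^+ m.
  pose K := (r2pi R * 4^-1 ^+ m) ^+ 2.
  have mWF : measC (fun x => W x - F m x).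
    under eq_fun do rewrite -mulN1r; apply: measC_D => //.
    by apply: measC_M => //; exact: measC_cst.
  pose h k x := (normc (F (m + k)%N x - F m x) ^+ 2)%:E.
  have L2h k : L2per (fun x => F (m + k)%N x - F m x) by exact: L2per_B.
  have mh k := measurable_int _ (L2per_sq_integrable (L2h k)).
  have h0 k x : T x -> (0 <= h k x)%E by rewrite lee_fin sqr_ge0.
  have hK k : (\int[mu]_(x in T) h k x <= K%:E)%E.
    have ih := L2per_sq_integrable (L2h k).
    rewrite -[X in (X <= _)%E]fineK; last exact: (integrable_fin_num _ ih).
    rewrite -[fine _]/(Rintegral mu T (fun x => normc (F (m + k)%N x - F m x) ^+ 2)).
    rewrite -normL2_sqr lee_fin ler_pXn2r ?nnegrE ?normL2_ge0 ?dF ?leq_addr//.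
    by rewrite mulr_ge0 ?exprn_ge0// ltW// r2pi_gt0.
  have WK : (\int[mu]_(x in T) (normc (W x - F m x) ^+ 2)%:E <= K%:E)%E.
    apply: (@le_trans _ _ (\int[mu]_(x in T) limn_einf (h^~ x))%E); last first.
      by apply: le_trans (fatou _ _ mh h0) _ => //; exact: einf_le_bound.
    rewrite le_eqVlt; apply/orP; left; apply/eqP; apply: ae_eq_integral => //.
    - by apply/measurable_EFinP; apply: measurable_funTS; exact: (measC_normc mWF).
    - under eq_fun do rewrite /limn_einf; apply: measurableT_comp => //.
      by apply: measurable_fun_limn_esup => k; exact: measurableT_comp (mh k).
    apply: ae_imply goodW => x /= hx Tx; have [C hC] := hx Tx.
    have C0 : 0 <= C by have := le_trans (normc_ge0 _) (hC 0%N); rewrite expr0 divr1.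
    have cvh : (fun k => normc (F (m + k)%N x - F m x)) @ \oo --> normc (W x - F m x).
      apply/cvgrPdist_le => e e0; have [j hj] := geometric_small C e0.
      exists j => // k /= jk; apply: (@le_trans _ _ (normc (W x - F (m + k)%N x))).
        apply: le_trans (normc_dist _ _) _; rewrite opprB addrA subrK//.
      apply: le_trans (hC _) _; apply: le_trans hj; apply: ler_wpM2l => //.
      by rewrite lef_pV2 ?posrE ?exprn_gt0// ler_eXn2l ?ltr1n//; exact: leq_trans (leq_addl _ _).
    have cvh2 : h^~ x @ \oo --> (normc (W x - F m x) ^+ 2)%:E.
      apply: cvg_EFin; first exact: nearW.
      by apply: cvg_trans (cvgM cvh cvh); apply: near_eq_cvg; apply: nearW => k /=.
    by rewrite is_cvg_limn_einfE ?(cvg_lim _ cvh2)//; apply/cvg_ex; eexists; exact: cvh2.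
  have L2WF : L2per (fun x => W x - F m x).
    split; [by case: mWF|by case: mWF| |exact: le_lt_trans WK (ltry _)].
    by move=> x; rewrite pW; have [_ _ ->] := L2F m.
  split=> //; have K0 : 0 <= r2pi R * 4^-1 ^+ m.
    by rewrite mulr_ge0 ?exprn_ge0// ltW// r2pi_gt0.
  rewrite -(@ler_pXn2r _ 2) ?nnegrE ?normL2_ge0// -/K normL2_sqr -lee_fin.
  rewrite /Rintegral fineK//; exact: (integrable_fin_num _ (L2per_sq_integrable L2WF)).
have L2W : L2per W.
  have [h _] := WF 0%N; have := L2per_D h (L2F 0%N).
  by under eq_fun do rewrite subrK.
have e4 m : (4^-1 : R) ^+ m <= 1 / 2 ^+ m.
  rewrite div1r -exprVn lerXn2r ?nnegrE//.
  by rewrite lef_pV2 ?posrE// ler_nat.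
exists W; split=> // [n|].
  apply/eqP; rewrite -subr_eq0 -normc_eq0; apply/eqP.
  apply: (@real_eps0 _ 2) => // [|m]; first exact: normc_ge0.
  have [h1 h2] := WF m.
  have -> : fourier W n - a n = (fourier W n - fourier (F m) n) + (fourier (F m) n - a n).
    by rewrite addrA subrK.
  apply: le_trans (normcD _ _) _; apply: (@le_trans _ _ (4^-1 ^+ m + 4^-1 ^+ m)); last first.
    by have := e4 m; rewrite -[2 / _]mulr1 -mulrA [_ * 1]mulr1 -[_^-1]mul1r; lra.
  apply: lerD.
    rewrite -fourierB//; apply: le_trans (l2b_coef n (bessel h1)) _.
    by rewrite ler_pdivrMr ?r2pi_gt0// mulrC.
  rewrite fourier_trig ?box_uniq// normcBC.
  have := l2b_coef n (tailN m); case: ifP => _; rewrite ?subrr ?subr0//.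
apply/ler_addgt0Pr => e e0; have [m hm] := geometric_small (r2pi R) e0.
have [h1 h2] := WF m.
have -> : W = fun x => (W x - F m x) + F m x by apply/funext => x; rewrite subrK.
apply: le_trans (normL2_D h1 (L2F m)) _; rewrite addrC; apply: lerD.
  exact: normL2_trig_l2b (box_uniq _) aB.
apply: le_trans h2 _; apply: le_trans hm; rewrite ler_pM2l ?r2pi_gt0//.
by have := e4 m; rewrite div1r.
Qed.

End riesz_fischer.

(** * Indicators of arcs as limits of trigonometric polynomials *)

Section indicator_by_trigonometric_polynomials.
Variable R : realType.

Lemma bernoulli_lb (y : R) (M : nat) : 0 <= y <= 1 -> 1 - M%:R * y <= (1 - y) ^+ M.
Proof.
move=> /andP[y0 y1]; elim: M => [|M IH]; first by rewrite mul0r subr0 expr0.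
rewrite exprS; apply: (@le_trans _ _ ((1 - y) * (1 - M%:R * y))); last first.
  by apply: ler_wpM2l => //; lra.
rewrite -natr1; have := mulr_ge0 (mulr_ge0 (ler0n R M) y0) y0; lra.
Qed.

Lemma bernoulli_ub (y : R) (M : nat) : 0 <= y <= 1 -> (1 - y) ^+ M * (1 + M%:R * y) <= 1.
Proof.
move=> /andP[y0 y1]; apply: (@le_trans _ _ ((1 - y) ^+ M * (1 + y) ^+ M)).
  apply: ler_wpM2l; first by rewrite exprn_ge0//; lra.
  elim: M => [|M IH]; first by rewrite mul0r addr0 expr0.
  rewrite exprS; apply: (@le_trans _ _ ((1 + y) * (1 + M%:R * y))); last first.
    by apply: ler_wpM2l => //; lra.
  rewrite -natr1; have := mulr_ge0 (mulr_ge0 (ler0n R M) y0) y0; lra.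
rewrite -exprMn; apply: exprn_ile1; first by rewrite mulr_ge0; lra.
by have := mulr_ge0 y0 y0; lra.
Qed.

(* The step function of the Stone-Weierstrass theorem: (1 - t^N)^(2^N) tends to
   1 for t < 1/2 and to 0 for t > 1/2. *)
Definition stepf (N : nat) (t : R) : R := (1 - t ^+ N) ^+ (2 ^ N).

Lemma stepf_ge0 N t : 0 <= t <= 1 -> 0 <= stepf N t.
Proof.
by move=> /andP[t0 t1]; rewrite /stepf exprn_ge0// subr_ge0 exprn_ile1.
Qed.

Lemma stepf_le1 N t : 0 <= t <= 1 -> stepf N t <= 1.
Proof.
move=> /andP[t0 t1]; rewrite /stepf exprn_ile1// ?subr_ge0 ?exprn_ile1//.
by rewrite lerBlDr lerDl exprn_ge0.
Qed.

(** Bernoulli's inequality gives [stepf N t >= 1 - (2 t)^N]. *)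
Lemma stepf_cvg1 t : 0 <= t -> t < 2^-1 -> stepf ^~ t @ \oo --> (1 : R).
Proof.
move=> t0 t2; have t01 : 0 <= t <= 1 by rewrite t0/=; lra.
have c : (fun N => 1 - (2 * t) ^+ N) @ \oo --> (1 : R).
  rewrite -[X in _ --> X]subr0; apply: cvgB; first exact: cvg_cst.
  by apply: cvg_expr; rewrite ger0_norm ?mulr_ge0//; lra.
apply: squeeze_cvgr c (@cvg_cst _ _ _ _ _); apply: nearW => N.
rewrite stepf_le1// andbT /stepf.
have tN : 0 <= t ^+ N <= 1 by rewrite exprn_ge0// exprn_ile1//; lra.
by have := bernoulli_lb (2 ^ N) tN; rewrite natrX -exprMn.
Qed.

(** Here [stepf N t * (1 + (2 t)^N) <= 1], so [(2 t)^-N] is a majorant. *)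
Lemma stepf_cvg0 t : t <= 1 -> 2^-1 < t -> stepf ^~ t @ \oo --> (0 : R).
Proof.
move=> t1 t2; have t0 : 0 < t by apply: lt_trans t2.
have t01 : 0 <= t <= 1 by rewrite ltW.
have c : (fun N => ((2 * t)^-1) ^+ N) @ \oo --> (0 : R).
  apply: cvg_expr; rewrite ger0_norm ?invr_ge0 ?mulr_ge0 ?(ltW t0)//.
  by rewrite invf_lt1 ?mulr_gt0//; lra.
apply: squeeze_cvgr (@cvg_cst _ _ _ _ _) c; apply: nearW => N.
rewrite stepf_ge0//=.
have tN : 0 <= t ^+ N <= 1 by rewrite exprn_ge0 ?(ltW t0)// exprn_ile1 ?(ltW t0).
have := bernoulli_ub (2 ^ N) tN; rewrite natrX -exprMn -/(stepf N t) => h.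
have p : 0 < (2 * t) ^+ N by rewrite exprn_gt0// mulr_gt0.
rewrite exprVn -[leRHS]mul1r ler_pdivlMr//; apply: le_trans h.
by rewrite mulrDr mulr1 lerDr stepf_ge0.
Qed.

(* Affine in cos (x - m), so that t < 1/2 on the arc from -pi to x0. *)
Definition arct (x0 x : R) : R :=
  2^-1 - (cos (x - (x0 - pi) / 2) - cos ((x0 + pi) / 2)) / 4.

Lemma arct_bounds x0 x : 0 <= arct x0 x <= 1.
Proof.
rewrite /arct; have := cos_le1 (x - (x0 - pi) / 2); have := cos_geN1 (x - (x0 - pi) / 2).
by have := cos_le1 ((x0 + pi) / 2); have := cos_geN1 ((x0 + pi) / 2); lra.
Qed.

(** [(x0 - pi) / 2] is the midpoint of the arc and [(x0 + pi) / 2] its half-length; the cosine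
    decreases on [0, pi]. *)
Lemma arct_lt x0 x : - pi < x -> x < x0 -> x0 < pi -> arct x0 x < 2^-1.
Proof.
move=> x1 x2 x3; rewrite /arct ltrBlDr ltrDl divr_gt0// subr_gt0 -(cos_norm (x - _)).
rewrite ltr_cos ?in_itv/= ?normr_ge0/=; last 2 first.
- by rewrite ler_norml; lra.
- by lra.
by rewrite ltr_norml; lra.
Qed.

Lemma arct_gt x0 x : - pi < x0 -> x0 < x -> x < pi -> 2^-1 < arct x0 x.
Proof.
move=> x1 x2 x3; rewrite /arct.
suff : cos (x - (x0 - pi) / 2) < cos ((x0 + pi) / 2) by lra.
have [h|h] := leP (x - (x0 - pi) / 2) pi.
  by rewrite ltr_cos ?in_itv/=; lra.
(* Past pi, the distance to the midpoint is measured the other way around the circle. *)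
have -> : cos (x - (x0 - pi) / 2) = cos (pi *+ 2 - (x - (x0 - pi) / 2)).
  by rewrite [in RHS]addrC cosD2pi cosN.
rewrite mulr2n ltr_cos ?in_itv/=.
by lra.
by lra.
by lra.
Qed.

End indicator_by_trigonometric_polynomials.

(** * Functions are determined by their Fourier coefficients *)

Section uniqueness.
Variable R : realType.
Implicit Types (f g p : R -> R[i]) (n : int).

Local Notation mu := (@lebesgue_measure R).
Local Notation T := (torus R).

(* If all the integrals of g over the arcs from -pi vanish, so does the
   primitive of g, whose derivative is g almost everywhere. *)
Lemma ae_eq0_stepf (g : R -> R) : mu.-integrable T (EFin \o g) ->
  (forall x0 N, Rintegral mu T (fun x => g x * stepf N (arct x0 x)) = 0) ->
  {ae mu, forall x, T x -> g x = 0}.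
Proof.
move=> ig h.
have mg : measurable_fun T g by apply/measurable_EFinP; exact: measurable_int ig.
(* At [x0], [pi] and [- pi] the function [arct x0] equals 1/2, where [stepf] does not converge to an
   indicator; these points are discarded. *)
have ae_ne (y : R) : {ae mu, forall x : R, x != y}.
  exists [set y]; split => //; first exact: lebesgue_measure_set1.
  by move=> x /= /negP; rewrite negbK => /eqP.
(* Dominated convergence: [stepf N (arct x0 x)] tends to the indicator of the arc, and every
   integral in the sequence is 0. *)
have arc x0 : - pi < x0 < pi -> (\int[mu]_(x in T) ((g \_ `]-oo, x0]) x)%:E = 0)%E.
  move=> /andP[x01 x02].
  have marct : measurable_fun [set: R] (arct x0).
    apply: continuous_measurable_fun => x; apply: cvgB; first exact: cvg_cst.
    apply: cvgMl; apply: cvgB; last exact: cvg_cst.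
    apply: (@cvg_comp _ _ _ (fun x => x - (x0 - pi) / 2) cos); last exact: continuous_cos.
    by apply: cvgB; [exact: cvg_id|exact: cvg_cst].
  have mstep N : measurable_fun [set: R] (fun x => stepf N (arct x0 x)).
    apply: measurable_funX; apply: measurable_funB; first exact: measurable_cst.
    exact: measurable_funX.
  have [] := @dominated_convergence _ _ _ mu T (@measurable_torus R)
     (fun N x => (g x * stepf N (arct x0 x))%:E) (fun x => ((g \_ `]-oo, x0]) x)%:E)
     (fun x => `|g x|%:E).
  - by move=> N; apply/measurable_EFinP; apply: measurable_funM => //; apply: measurable_funTS; exact: mstep.
  - apply/measurable_EFinP; apply: (measurable_restrict _ _ _).1 => //.
    exact: (measurable_funS (@measurable_torus R) (@subIsetl _ _ _) mg).
  - apply: (ae_imply2 _ (ae_ne x0)); last first.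
      apply: (ae_imply2 _ (ae_ne pi) (ae_ne (- pi))) => x; move: x.
      by move=> x h1 h2; exact: (conj h1 h2).
    move=> x xx0 [xp xmp] Tx.
    have /andP[x1 x2] : - pi < x < pi.
      move: Tx; rewrite /torus /= in_itv/= => /andP[y1 y2].
      by rewrite !lt_neqAle y1 y2 eq_sym xmp xp.
    apply: cvg_EFin; first exact: nearW.
    have /andP[a1 a2] := arct_bounds x0 x.
    rewrite patchE; case: ifPn => [|].
      rewrite inE /= in_itv/= => xle.
      rewrite -[X in _ --> X]mulr1; apply: cvgMr; apply: stepf_cvg1 => //.
      by apply: arct_lt => //; rewrite lt_neqAle xx0.
    rewrite notin_setE /= in_itv/= => /negP; rewrite -ltNge => xlt.
    rewrite -[X in _ --> X](mulr0 (g x)); apply: cvgMr; apply: stepf_cvg0 => //.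
    exact: arct_gt.
  - exact: (integrable_norm ig).
  - apply: aeW => x N _ /=; rewrite lee_fin normrM ler_piMr//.
    by rewrite ger0_norm ?stepf_ge0 ?stepf_le1// arct_bounds.
  move=> _ _ cv; have step0 N : (\int[mu]_(x in T) (g x * stepf N (arct x0 x))%:E = 0)%E.
    have ist : mu.-integrable T (fun x => (g x * stepf N (arct x0 x))%:E).
      apply: le_integrable ig => //.
        by apply/measurable_EFinP; apply: measurable_funM => //; apply: measurable_funTS; exact: mstep.
      move=> x _ /=; rewrite lee_fin normrM ler_piMr//.
      by rewrite ger0_norm ?stepf_ge0 ?stepf_le1// arct_bounds.
    rewrite -[LHS]fineK; last exact: (integrable_fin_num _ ist).
    by rewrite -[fine _]/(Rintegral mu T (fun x => g x * stepf N (arct x0 x))) h.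
  have := cvg_lim (@ereal_hausdorff R) cv.
  rewrite (_ : [sequence _]_n = fun=> 0%E); last by apply/funext => N; exact: step0.
  by rewrite lim_cst// => ->.
(* Extension by zero gives a primitive on the whole line. It vanishes on (-pi, pi), hence so does
   its derivative there. *)
pose gT := g \_ T.
have igT : mu.-integrable [set: R] (EFin \o gT).
  by rewrite /gT -restrict_EFin -integrable_mkcond.
pose F y := Rintegral mu `]-oo, y] gT.
have F0 y : - pi < y < pi -> F y = 0.
  move=> hy; rewrite /F /gT -Rintegral_mkcondr setIC Rintegral_mkcondr.
  by rewrite /Rintegral arc.
have iy y : mu.-integrable `]-oo, y] (EFin \o gT).
  by apply: integrableS igT => //; exact: measurable_itv.
have lF := FTC1Ny iy (integrable_locally (@measurable_torus R) ig).
apply: (ae_imply2 _ (ae_imply2 (fun x (h1 : x != pi) (h2 : x != - pi) => conj h1 h2) (ae_ne pi) (ae_ne (- pi))) lF).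
move=> x [xp xmp] [_ Fx] Tx.
have /andP[x1 x2] : - pi < x < pi.
  move: Tx; rewrite /torus /= in_itv/= => /andP[y1 y2].
  by rewrite !lt_neqAle y1 y2 eq_sym xmp xp.
have -> : g x = gT x by rewrite /gT patchE mem_set.
rewrite -Fx derive1E (@near_eq_derive _ _ _ _ (cst 0)) ?derive_cst//.
near=> y; rewrite -[LHS]/(F y) F0//; apply/andP; split; near: y.
- exact: lt_nbhsr.
- exact: lt_nbhsl.
Unshelve. all: by end_near. Qed.

Lemma fourier_shift f k n : L2per f ->
  fourier (fun x => expi k x * f x) n = fourier f (n - k).
Proof.
move=> hf; rewrite !fourierE; congr (_ * integralT _); apply/funext => x.
by rewrite mulrA !expiJ -expiD opprB addrC.
Qed.

Lemma L2per_expi_mul f k : L2per f -> L2per (fun x => expi k x * f x).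
Proof.
apply: (@L2per_mul _ _ _ 1); [exact: measC_expi|exact: expi_per|].
by move=> x; rewrite normc_expi.
Qed.

Lemma arctE (x0 : R) : exists c0 c1 c2 : R[i],
  forall x, (arct x0 x)%:C = c0 + c1 * expi 1 x + c2 * expi (-1) x.
Proof.
pose m := (x0 - pi) / 2; pose h := (x0 + pi) / 2.
exists (2^-1 + cos h / 4)%:C, (8^-1%:C * (- cos m +i* sin m)), (8^-1%:C * (- cos m -i* sin m)).
move=> x; rewrite -(opprK 1) -expiJ opprK /expi conjcE /arct -/m -/h cosB !mul1r.
apply/eqP; rewrite eq_complex /=; by apply/andP; split; apply/eqP; field.
Qed.

(** The class [Z] of functions with vanishing coefficients is stable under multiplication by
    exponentials, hence by polynomials in [arct x0], in particular by [stepf N (arct x0 x)].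
    Coefficient 0 of the product is the integral that [ae_eq0_stepf] needs. *)
Lemma fourier_eq0 f : L2per f -> (forall n, fourier f n = 0) -> eqT f (fun=> 0).
Proof.
move=> hf f0; pose Z (h : R -> R[i]) := L2per h /\ forall n, fourier h n = 0.
have ZD h1 h2 : Z h1 -> Z h2 -> Z (fun x => h1 x + h2 x).
  move=> [a1 b1] [a2 b2]; split=> [|n]; first exact: L2per_D.
  by rewrite fourierD// b1 b2 addr0.
have ZZ k h1 : Z h1 -> Z (fun x => k * h1 x).
  move=> [a1 b1]; split=> [|n]; first exact: L2per_Z.
  by rewrite fourierZ// b1 mulr0.
have Ze k h1 : Z h1 -> Z (fun x => expi k x * h1 x).
  move=> [a1 b1]; split=> [|n]; first exact: L2per_expi_mul.
  by rewrite fourier_shift.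
have Zt x0 h1 : Z h1 -> Z (fun x => (arct x0 x)%:C * h1 x).
  move=> Zh; have [c0 [c1 [c2 tE]]] := arctE x0.
  have := ZD _ _ (ZD _ _ (ZZ c0 _ Zh) (ZZ c1 _ (Ze 1 _ Zh))) (ZZ c2 _ (Ze (-1) _ Zh)).
  by congr Z; apply/funext => x; rewrite tE; ring.
have ZtN x0 N h1 : Z h1 -> Z (fun x => ((arct x0 x) ^+ N)%:C * h1 x).
  move=> Zh; elim: N => [|N IH].
    by move: Zh; congr Z; apply/funext => x; rewrite expr0 mul1r.
  have := Zt x0 _ IH; congr Z; apply/funext => x.
  by rewrite exprS rmorphM mulrA.
have Zstep x0 N M h1 : Z h1 -> Z (fun x => ((1 - (arct x0 x) ^+ N) ^+ M)%:C * h1 x).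
  move=> Zh; elim: M => [|M IH].
    by move: Zh; congr Z; apply/funext => x; rewrite expr0 mul1r.
  have := ZD _ _ IH (ZZ (-1) _ (ZtN x0 N _ IH)); congr Z; apply/funext => x.
  by rewrite exprS [in RHS]rmorphM rmorphB rmorph1; ring.
have I0 x0 N : integralT (fun x => (stepf N (arct x0 x))%:C * f x) = 0.
  have [h1 /(_ 0)] := Zstep x0 N (2 ^ N)%N f (conj hf f0).
  rewrite fourierE => /eqP; rewrite mulf_eq0 (inj_eq (@complexI R)) invr_eq0.
  rewrite gt_eqF ?twopi_gt0//= => /eqP; apply: etrans.
  by congr integralT; apply/funext => x; rewrite expi0 conjC1 mul1r.
have [ir ii] := intC_L2 hf.
have h1 := @ae_eq0_stepf (fun x => complex.Re (f x)) ir (fun x0 N => _).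
have h2 := @ae_eq0_stepf (fun x => complex.Im (f x)) ii (fun x0 N => _).
apply: (ae_imply2 _ (h1 _) (h2 _)).
- move=> x /= rx ix Tx; have := rx Tx; have := ix Tx.
  by case: (f x) => u v /= -> ->.
- move=> x0 N; have [+ _] := I0 x0 N; apply: etrans.
  by apply: eq_Rintegral => x _; case: (f x) => u v /=; rewrite mul0r subr0 mulrC.
- move=> x0 N; have [_] := I0 x0 N; apply: etrans.
  by apply: eq_Rintegral => x _; case: (f x) => u v /=; rewrite mul0r addr0 mulrC.
Qed.

Lemma fourier_inj f g : L2per f -> L2per g -> (forall n, fourier f n = fourier g n) ->
  eqT f g.
Proof.
move=> hf hg fg; have := fourier_eq0 (L2per_B hf hg).
move=> /(_ (fun n => etrans (fourierB n hf hg) (etrans (congr1 (fun z => z - _) (fg n)) (subrr _)))).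
by apply: ae_imply => x /= h Tx; apply/eqP; rewrite -subr_eq0; apply/eqP; exact: h.
Qed.

(** [riesz_fischer] builds a function with these coefficients and this norm bound; by uniqueness it
    is [f] almost everywhere. *)
Lemma parseval f B : L2per f -> l2b (fourier f) B -> normL2 f <= r2pi R * B.
Proof.
move=> hf fB; have [W [hW Wf Wn]] := riesz_fischer fB.
rewrite (normL2_eqT (L2per_measC hf) (L2per_measC hW))//.
by apply: fourier_inj => // n; rewrite Wf.
Qed.

End uniqueness.

(** * Weighted sequences and multiplication operators *)

Section parseval_identity.
Variable R : realType.
Implicit Types (f g : R -> R[i]) (n : int).
Local Notation ip := (@innerL2 R).

Lemma trig_approx g (e : R) : L2per g -> 0 < e ->
  exists N : nat, forall M : nat, (N <= M)%N ->
    normL2 (fun x => g x - trig (box M) (fourier g) x) <= e.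
Proof.
move=> hg e0; have e0' : 0 < e / r2pi R by rewrite divr_gt0// r2pi_gt0.
have [N hN] := l2b_tail (bessel hg) e0'; exists N => M NM.
have -> : e = r2pi R * (e / r2pi R) by rewrite mulrC divfK// gt_eqF// r2pi_gt0.
apply: parseval; first by apply: L2per_B => //; exact: L2per_trig.
apply: l2b_dom (hN M NM) => n.
rewrite fourierB//.
by rewrite fourier_trig ?box_uniq//; case: ifP => _; rewrite ?subrr ?subr0 ?normcr0.
Qed.

Definition psum f g (M : nat) : R[i] :=
  \sum_(n <- box M) (fourier f n)^* * fourier g n.

Lemma ip_approx f g (e : R) : L2per f -> L2per g -> 0 < e ->
  exists N : nat, forall M : nat, (N <= M)%N ->
    normc (ip f g - (2 * pi)%:C * psum f g M) <= e.
Proof.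
move=> hf hg e0; have d0 : 0 < e / (normL2 f + 1).
  by rewrite divr_gt0// ltr_wpDl// normL2_ge0.
have [N hN] := trig_approx hg d0; exists N => M NM.
rewrite -ip_trigr// -ipBr//.
apply: le_trans (ip_cauchy_schwarz hf _) _; first by apply: L2per_B.
apply: (@le_trans _ _ (normL2 f * (e / (normL2 f + 1)))).
  by apply: ler_wpM2l; [exact: normL2_ge0|exact: hN].
rewrite mulrA ler_pdivrMr; last by rewrite ltr_wpDl// normL2_ge0.
by rewrite mulrC ler_pM2l// lerDl.
Qed.

(** Each inner product is the limit of [2 pi] times its sums over boxes. Identities can thus be
    checked on finite sums, which also allows reindexing n by -n as in [ip_odd]. *)
Lemma ip_ext f g f' g' : L2per f -> L2per g -> L2per f' -> L2per g' ->
  (forall M, psum f g M = psum f' g' M) -> ip f g = ip f' g'.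
Proof.
move=> hf hg hf' hg' E; apply/eqP; rewrite -subr_eq0 -normc_eq0; apply/eqP.
apply/eqP; rewrite eq_le normc_ge0 andbT; apply/ler_addgt0Pr => e e0; rewrite add0r.
have e2 : 0 < e / 2 by rewrite divr_gt0.
have [N1 h1] := ip_approx hf hg e2; have [N2 h2] := ip_approx hf' hg' e2.
have := h1 (maxn N1 N2) (leq_maxl _ _); have := h2 (maxn N1 N2) (leq_maxr _ _).
rewrite E; set p := _ * psum _ _ _ => {}h2 {}h1.
have -> : ip f g - ip f' g' = (ip f g - p) - (ip f' g' - p) by ring.
by apply: le_trans (normcB _ _) _; lra.
Qed.

Lemma ip_ext_coef f g f' g' : L2per f -> L2per g -> L2per f' -> L2per g' ->
  (forall n, (fourier f n)^* * fourier g n = (fourier f' n)^* * fourier g' n) ->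
  ip f g = ip f' g'.
Proof. by move=> hf hg hf' hg' E; apply: ip_ext => // M; apply: eq_bigr => n _. Qed.

Lemma synth_ex (a : int -> R[i]) :
  exists W, l2 a -> L2per W /\ forall n, fourier W n = a n.
Proof.
have [[B aB]|na] := pselect (l2 a); last by exists (fun=> 0).
by have [W [W1 W2 _]] := riesz_fischer aB; exists W.
Qed.

(** Inverse of [fourier] by choice, unspecified for sequences outside [l2]; being total, it lets
    operators on functions act on arbitrary sequences. *)
Definition synth (a : int -> R[i]) : R -> R[i] := sval (cid (synth_ex a)).

Lemma L2per_synth a : l2 a -> L2per (synth a).
Proof. by move=> h; have [] := svalP (cid (synth_ex a)) h. Qed.

Lemma fourier_synth a n : l2 a -> fourier (synth a) n = a n.
Proof. by move=> h; have [_] := svalP (cid (synth_ex a)) h; exact. Qed.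

Lemma l2_fourier f : L2per f -> l2 (fourier f).
Proof. by move=> hf; eexists; exact: bessel hf. Qed.

End parseval_identity.

Section weights.
Variable R : realType.
Implicit Types (n j : int) (s t : R) (u : int -> R[i]).

(** This form of the Japanese bracket is submultiplicative without a constant ([jb_sub]). *)
Definition jb n : R := 1 + `|n%:~R|.
Definition wt s n : R := jb n `^ s.

Lemma jb_ge1 n : 1 <= jb n. Proof. by rewrite /jb lerDl. Qed.
Lemma jb_gt0 n : 0 < jb n. Proof. exact: lt_le_trans (jb_ge1 n). Qed.
Lemma wt_gt0 s n : 0 < wt s n. Proof. exact/powR_gt0/jb_gt0. Qed.
Lemma wt_ge0 s n : 0 <= wt s n. Proof. exact/ltW/wt_gt0. Qed.

Lemma wtD s t n : wt (s + t) n = wt s n * wt t n.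
Proof. by rewrite /wt powRD// (gt_eqF (jb_gt0 n)) implybT. Qed.

Lemma wt0 n : wt 0 n = 1. Proof. exact: powRr0. Qed.
Lemma wt1 n : wt 1 n = jb n. Proof. exact/powRr1/ltW/jb_gt0. Qed.

Lemma wt_mono s t n : s <= t -> wt s n <= wt t n.
Proof. by move=> st; apply: ler_powR => //; exact: jb_ge1. Qed.

Lemma jb_sub n j : jb n <= jb (n - j) * jb j.
Proof.
rewrite /jb intrB; have h := ler_normD (n%:~R - j%:~R : R) j%:~R.
rewrite subrK in h.
by have := mulr_ge0 (normr_ge0 (n%:~R - j%:~R : R)) (normr_ge0 (j%:~R : R)); lra.
Qed.

Lemma jbN n : jb (- n) = jb n. Proof. by rewrite /jb intrN normrN. Qed.

(** Peetre's inequality. For negative [s] the roles of [n] and [n - j] are exchanged; the bound on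
    [s] allows one factor [jb j ^ 2] for all orders used. *)
Lemma wt_sub s n j : `|s| <= 2 -> wt s n <= wt s (n - j) * jb j ^+ 2.
Proof.
move=> s2; have jb2 : jb j `^ `|s| <= jb j ^+ 2.
  by rewrite -powR_mulrn ?(ltW (jb_gt0 j))//; apply: ler_powR => //; exact: jb_ge1.
apply: (@le_trans _ _ (wt s (n - j) * jb j `^ `|s|)); last first.
  by rewrite ler_pM2l// wt_gt0.
have [s0|s0] := leP 0 s.
  rewrite ger0_norm// /wt -powRM ?(ltW (jb_gt0 _))//.
  by apply: ge0_ler_powR; rewrite ?nnegrE ?mulr_ge0 ?(ltW (jb_gt0 _))// jb_sub.
rewrite ltr0_norm// /wt -[s]opprK !(powRN _ (- s)) opprK.
rewrite -[X in X <= _]mul1r ler_pdivrMr ?powR_gt0 ?jb_gt0//.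
rewrite mulrAC -mulrA -[leLHS](mulVf (lt0r_neq0 (powR_gt0 (- s) (jb_gt0 (n - j))))).
rewrite ler_pM2l ?invr_gt0 ?powR_gt0 ?jb_gt0// -powRM ?(ltW (jb_gt0 _))//.
apply: ge0_ler_powR; rewrite ?nnegrE ?mulr_ge0 ?(ltW (jb_gt0 _))//; first by lra.
have := jb_sub (n - j) (- j); rewrite opprK subrK jbN//.
Qed.

Definition l2w s u B := l2b (fun n => (wt s n)%:C * u n) B.

Lemma l2w_le s t u B : s <= t -> l2w t u B -> l2w s u B.
Proof.
move=> st; apply: l2b_dom => n; rewrite !normcM !normcR !ger0_norm ?wt_ge0//.
by rewrite ler_wpM2r ?normc_ge0 ?wt_mono.
Qed.

Lemma l2w0 u B : l2w 0 u B <-> l2b u B.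
Proof. by split; apply: l2b_dom => n; rewrite wt0 mul1r. Qed.

Lemma l2b_shift u B j : l2b u B -> l2b (fun n => u (n - j)) B.
Proof.
move=> [B0 h]; split=> // s us.
rewrite -(big_map (fun n => n - j) xpredT (fun n => normc (u n) ^+ 2)).
by apply: h; rewrite map_inj_uniq//; exact: addIr.
Qed.

Lemma l2w_shift s u B j : `|s| <= 2 -> l2w s u B ->
  l2w s (fun n => u (n - j)) (jb j ^+ 2 * B).
Proof.
move=> s2 /(@l2b_shift _ _ j) h.
have := l2b_scale (jb j ^+ 2)%:C h; rewrite normcR ger0_norm ?sqr_ge0//.
apply: l2b_dom => n.
rewrite !normcM !normcR !ger0_norm ?wt_ge0 ?sqr_ge0// mulrA ler_wpM2r ?normc_ge0//.
by rewrite mulrC wt_sub.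
Qed.

End weights.

(** * Multiplication operators on weighted sequences *)

Section multiplication.
Variable R : realType.
Implicit Types (f p : R -> R[i]) (n j : int).
Local Notation ip := (@innerL2 R).

Lemma fourier_mulE p f n : fourier (fun x => p x * f x) n =
  ((2 * pi)^-1)%:C * ip (fun x => (p x)^* * expi n x) f.
Proof.
rewrite fourierE; congr (_ * integralT _); apply/funext => x.
by rewrite conjcM conjCK; ring.
Qed.

Lemma L2per_Jexpi p n : L2per p -> L2per (fun x => (p x)^* * expi n x).
Proof.
move=> hp; have := L2per_expi_mul n (L2per_J hp).
by congr L2per; apply/funext => x; rewrite mulrC.
Qed.

Lemma fourier_mul_trig (s : seq int) a f n : L2per f ->
  fourier (fun x => trig s a x * f x) n = \sum_(j <- s) a j * fourier f (n - j).
Proof.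
move=> hf; have E : (fun x => trig s a x * f x) =
    (fun x => \sum_(j <- s) a j * (expi j x * f x)).
  by apply/funext => x; rewrite /trig mulr_suml; apply: eq_bigr => j _; rewrite mulrA.
rewrite E fourierE ip_sumr//; last by move=> j; apply: L2per_Z; exact: L2per_expi_mul.
rewrite mulr_sumr; apply: eq_bigr => j _; rewrite ipZr//; last exact: L2per_expi_mul.
by rewrite mulrCA -fourierE fourier_shift.
Qed.

Lemma normL2_Jexpi p n : normL2 (fun x => (p x)^* * expi n x) = normL2 p.
Proof.
congr Num.sqrt; apply: eq_Rintegral => x _.
by rewrite normcM normcJ normc_expi mulr1.
Qed.

Lemma fourier_mul_diff p q f n : L2per p -> L2per q -> L2per f ->
  normc (fourier (fun x => p x * f x) n - fourier (fun x => q x * f x) n) <=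
    normL2 (fun x => p x - q x) * normL2 f.
Proof.
move=> hp hq hf; rewrite !fourier_mulE -mulrBr -ipBl//; try exact: L2per_Jexpi.
have -> : (fun x => (p x)^* * expi n x - (q x)^* * expi n x) =
    (fun x => (p x - q x)^* * expi n x).
  by apply/funext => x; rewrite conjcB mulrBl.
have hpq := L2per_B hp hq.
rewrite normcM normcR ger0_norm; last by rewrite invr_ge0 ltW// twopi_gt0.
have := ip_cauchy_schwarz (L2per_Jexpi n hpq) hf; rewrite normL2_Jexpi.
apply: le_trans; rewrite ler_piMl ?normc_ge0// invf_le1 ?twopi_gt0//.
by have := pi_ge2 R; lra.
Qed.

Variables (Phi : R -> R[i]) (A : R).
Hypothesis L2Phi : L2per Phi.
Hypothesis PhiA : forall s : seq int, uniq s ->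
  \sum_(j <- s) jb R j ^+ 2 * normc (fourier Phi j) <= A.

(** Multiplication convolves the coefficients, and a shift by [j] costs [jb j ^ 2] in the weighted
    norm, so [A] bounds the operator. It is done for truncations of [Phi]; [l2b_closed] gives the
    limit. *)
Lemma mult_weight (s : R) f B : `|s| <= 2 -> L2per f -> l2w s (fourier f) B ->
  l2w s (fourier (fun x => Phi x * f x)) (A * B).
Proof.
move=> s2 hf fB; have B0 := l2b_ge0 fB.
have A0 : 0 <= A by have := PhiA (s := [::]) isT; rewrite big_nil.
apply: l2b_closed => [|s0 e e0]; first exact: mulr_ge0.
(* [W] dominates every weight on [s0], so an L^2 approximation of [Phi] to within
   [e / W / (normL2 f + 1)] yields a weighted error at most [e]. *)
pose W := \sum_(n <- s0) wt s n + 1.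
have W0 : 0 < W by rewrite ltr_wpDl// sumr_ge0// => n _; exact: wt_ge0.
have d0 : 0 < e / W / (normL2 f + 1).
  by rewrite !divr_gt0// ltr_wpDl// normL2_ge0.
have [N /(_ N (leqnn _)) hN] := trig_approx L2Phi d0.
exists (fun n => (wt s n)%:C * \sum_(j <- box N) fourier Phi j * fourier f (n - j)).
  have h j : l2b (fun n => fourier Phi j * ((wt s n)%:C * fourier f (n - j)))
      (normc (fourier Phi j) * (jb R j ^+ 2 * B)).
    by apply: l2b_scale; exact: l2w_shift.
  have := l2b_sum (box N) h => h2.
  apply: (@l2b_le _ _ _ (\sum_(j <- box N) normc (fourier Phi j) * (jb R j ^+ 2 * B))).
    under eq_bigr do rewrite mulrA; rewrite -mulr_suml ler_wpM2r//.
    by under eq_bigr do rewrite mulrC; exact/PhiA/box_uniq.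
  apply: l2b_dom h2 => n; rewrite mulr_sumr le_eqVlt; apply/orP; left; apply/eqP.
  by congr normc; apply: eq_bigr => j _; rewrite mulrCA.
move=> n ns; rewrite -mulrBr normcM normcR ger0_norm ?wt_ge0//.
rewrite -fourier_mul_trig//.
apply: (@le_trans _ _ (W * (e / W))); last by rewrite mulrC divfK// gt_eqF.
apply: ler_pM; rewrite ?wt_ge0 ?normc_ge0//.
  rewrite /W (big_rem n ns)/= -addrA lerDl addr_ge0// sumr_ge0// => k _; exact: wt_ge0.
apply: le_trans (fourier_mul_diff _ L2Phi (L2per_trig _ _) hf) _.
apply: (@le_trans _ _ (e / W / (normL2 f + 1) * normL2 f)).
  by rewrite ler_wpM2r ?normL2_ge0.
rewrite mulrAC ler_pdivrMr; last by rewrite ltr_wpDl// normL2_ge0.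
by rewrite ler_pM2l ?divr_gt0// lerDl.
Qed.

End multiplication.

(** * The resolvent equation on Fourier coefficients *)

Lemma normr_int_ge (R : realType) (k : nat) (n : int) :
  (k <= `|n|)%N -> k%:R <= `|n%:~R : R|.
Proof.
by move=> kn; rewrite -intr_norm -[k%:R]/((k%:Z)%:~R) ler_int; lia.
Qed.

Section symbols.
Variables (R : realType) (alpha c : R).
Hypothesis alpha_gt0 : 0 < alpha.
Hypothesis alpha_le2 : alpha <= 2.
Implicit Types (n : int).

Definition absa n : R := `|n%:~R| `^ alpha.
(** Symbols of J and, next, of the constant-coefficient part c D^alpha + c - 1 of L; [i omega] is
    the symbol of their product. *)
Definition symJ n : R[i] := (0 +i* n%:~R) / (1 + absa n)%:C.
Definition symL n : R := c * absa n + c - 1.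
Definition omega n : R := n%:~R * (symL n / (1 + absa n)).

Lemma norm_1Balpha : `|1 - alpha| <= 2.
Proof. by move: alpha_gt0 alpha_le2 => h1 h2; rewrite ler_norml; lra. Qed.

Lemma absa_ge0 n : 0 <= absa n. Proof. exact: powR_ge0. Qed.

Lemma absaD_gt0 n : 0 < 1 + absa n. Proof. by rewrite ltr_wpDr ?absa_ge0. Qed.

Lemma absa_ge n (k : nat) : (k <= `|n|)%N -> k%:R `^ alpha <= absa n.
Proof.
move=> kn; apply: ge0_ler_powR; rewrite ?nnegrE ?(ltW alpha_gt0)//.
exact: normr_int_ge.
Qed.

Lemma absaN n : absa (- n) = absa n. Proof. by rewrite /absa intrN normrN. Qed.

(** For n <> 0, [1 + |n| <= 2 |n|], and [2^alpha <= 4] as [alpha <= 2]. *)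
Lemma wt_absa n : wt alpha n <= 4 * (1 + absa n).
Proof.
have [->|n0] := eqVneq n 0.
  rewrite /wt /jb /absa normr0 addr0 powR1 powR0 ?gt_eqF// addr0; lra.
have n1 : 1 <= `|n%:~R : R| by apply: (@normr_int_ge R 1); lia.
apply: (@le_trans _ _ ((2 * `|n%:~R|) `^ alpha)).
  apply: ge0_ler_powR; rewrite ?nnegrE ?(ltW alpha_gt0) ?(ltW (jb_gt0 _ _)) ?mulr_ge0//.
  by rewrite /jb; lra.
rewrite powRM// -/(absa n); apply: (@le_trans _ _ (4 * absa n)).
  rewrite ler_wpM2r ?absa_ge0//; have -> : 4 = 2 `^ 2%:R :> R.
    by rewrite powR_mulrn// expr2; lra.
  by apply: ler_powR => //; lra.
by rewrite ler_pM2l// lerDr.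
Qed.

Lemma normc_Jsym n : normc (symJ n) = `|n%:~R| / (1 + absa n).
Proof.
rewrite /symJ normcM normcV normcR (gtr0_norm (absaD_gt0 n)).
by rewrite /= expr0n add0r sqrtr_sqr.
Qed.

Lemma Jsym_le n : normc (symJ n) <= 4 * wt (1 - alpha) n.
Proof.
rewrite normc_Jsym ler_pdivrMr ?absaD_gt0//.
apply: (@le_trans _ _ (wt (1 - alpha) n * wt alpha n)).
  by rewrite -wtD subrK wt1 /jb lerDr.
rewrite (mulrC 4) -mulrA ler_pM2l ?wt_gt0//; exact: wt_absa.
Qed.

(** J has order [1 - alpha]. Together with the derivative gained by dividing by [dl], this makes a
    net gain of [alpha]. *)
Lemma wt_Jsym_le t s n (z : R[i]) : t <= s + alpha ->
  normc ((wt (t - 1) n)%:C * (symJ n * z)) <= normc (4%:C * ((wt s n)%:C * z)).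
Proof.
move=> ts; have := Jsym_le n; move: (symJ n) => w hw.
rewrite !normcM !normcR !ger0_norm ?wt_ge0// !mulrA ler_wpM2r ?normc_ge0//.
apply: (@le_trans _ _ (wt (t - 1) n * (4 * wt (1 - alpha) n))).
  by rewrite ler_pM2l ?wt_gt0.
by rewrite mulrCA -wtD ler_pM2l//; apply: wt_mono; move: ts; lra.
Qed.

Lemma Jsym_ell n : symJ n * (symL n)%:C = 0 +i* omega n.
Proof.
have E (x y : R) : (0 +i* x) * y%:C = 0 +i* (x * y).
  by apply/eqP; rewrite eq_complex /=; apply/andP; split; apply/eqP; ring.
by rewrite /symJ -fmorphV !E /omega mulrAC mulrA.
Qed.

Lemma Jsym0 : symJ 0 = 0.
Proof. by rewrite /symJ -[0 +i* 0]/(0 : R[i]) mul0r. Qed.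

Lemma omegaE n : omega n = n%:~R * (c - (1 + absa n)^-1).
Proof. by rewrite /omega /symL; congr (_ * _); field; rewrite gt_eqF ?absaD_gt0. Qed.

Lemma invD_le1 n : 0 <= (1 + absa n)^-1 <= 1.
Proof. by rewrite invr_ge0 (ltW (absaD_gt0 n)) invf_le1 ?absaD_gt0// lerDl absa_ge0. Qed.

Lemma omega_le n : `|omega n| <= (`|c| + 1) * jb R n.
Proof.
rewrite omegaE normrM mulrC; apply: ler_pM => //; last by rewrite /jb lerDr.
apply: le_trans (ler_normB _ _) _; rewrite lerD2l.
by have /andP[h1 h2] := invD_le1 n; rewrite ger0_norm.
Qed.

Hypothesis c_ge : 2^-1 <= c.

Lemma two_alpha_gt1 : 1 < 2 `^ alpha :> R.
Proof.
have := gt0_ltr_powR alpha_gt0 (_ : 1 \in Num.nneg) (_ : 2 \in Num.nneg) (ltr1n R 2 : 1 < 2 :> R).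
by rewrite powR1; apply; rewrite nnegrE.
Qed.

(** Lower bound of [|omega n| / |n|] for [|n| >= 2], positive because [c >= 1/2]. In [omega_ge] the
    subtracted [c'] covers [|n| <= 1], where [omega] can vanish. *)
Let c' := c - (1 + 2 `^ alpha)^-1.

Lemma c'_gt0 : 0 < c'.
Proof.
rewrite subr_gt0; apply: lt_le_trans c_ge.
by rewrite ltf_pV2 ?posrE//; have := two_alpha_gt1; lra.
Qed.

Lemma omega_ge n : c' * `|n%:~R| - c' <= `|omega n|.
Proof.
have [n2|n2] := leqP 2 `|n|; last first.
  apply: (@le_trans _ _ 0) => //; rewrite subr_le0 ger_pMr ?c'_gt0//.
  by rewrite -intr_norm -[1]/(1%:~R) ler_int; lia.
rewrite lerBlDr; apply: (@le_trans _ _ `|omega n|); last by rewrite lerDl ltW// c'_gt0.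
rewrite omegaE normrM mulrC; apply: ler_wpM2l => //.
apply: le_trans (ler_norm _); rewrite lerD2l lerN2.
rewrite lef_pV2 ?posrE ?absaD_gt0 ?ltr_wpDr ?powR_ge0//.
by rewrite lerD2l; exact: absa_ge n2.
Qed.

Variable lambda : R[i].
Hypothesis lambda_re : complex.Re lambda != 0.

Definition dl n : R[i] := lambda - (0 +i* omega n).

Lemma dl_ge : exists2 kappa : R, 0 < kappa & forall n, kappa * jb R n <= normc (dl n).
Proof.
pose rho := `|complex.Re lambda|; have rho0 : 0 < rho by rewrite normr_gt0.
pose D := normc lambda + 2 * c'.
have D0 : 0 <= D by rewrite addr_ge0 ?normc_ge0// mulr_ge0// ltW// c'_gt0.
have rD : 0 < rho + D by rewrite ltr_pwDl.
(* [|dl| >= rho] since [i omega] is imaginary, and [|dl| >= c' jb - D]. Adding [D] times the first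
   to [rho] times the second eliminates the constant. *)
exists (rho * c' / (rho + D)) => [|n]; first by rewrite divr_gt0// mulr_gt0// c'_gt0.
have h1 : rho <= normc (dl n).
  have := Re_le_normc (dl n); rewrite /dl /rho; case: (lambda) => u v /=.
  by rewrite oppr0 addr0.
have h2 : c' * jb R n - D <= normc (dl n).
  have := normc_lb (0 +i* omega n) (- lambda); rewrite normcN.
  have -> : 0 +i* omega n - lambda = - dl n by rewrite opprB.
  rewrite normcN; apply: le_trans.
  have -> : normc (0 +i* omega n) = `|omega n| by rewrite /= expr0n add0r sqrtr_sqr.
  by have := omega_ge n; rewrite /D /jb; lra.
rewrite mulrAC ler_pdivrMr//; move: h1 h2; set d := normc _; set b := jb R n => h1 h2.
by have := ler_wpM2l (ltW rho0) h2; have := ler_wpM2r D0 h1; lra.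
Qed.

Lemma dl_neq0 n : dl n != 0.
Proof.
have [k k0 hk] := dl_ge; rewrite -normc_eq0 gt_eqF//.
by apply: lt_le_trans (hk n); rewrite mulr_gt0// jb_gt0.
Qed.

End symbols.

Section resolvent_equation.
Variables (R : realType) (alpha c : R).
Hypothesis alpha_gt0 : 0 < alpha.
Hypothesis alpha_le2 : alpha <= 2.
Hypothesis c_ge : 2^-1 <= c.
Variables (Phi : R -> R[i]) (A Kphi : R).
Hypothesis L2Phi : L2per Phi.
Hypothesis PhiK : forall x, normc (Phi x) <= Kphi.
Hypothesis PhiA : forall s : seq int, uniq s ->
  \sum_(j <- s) jb R j ^+ 2 * normc (fourier Phi j) <= A.
Implicit Types (n : int) (u g : int -> R[i]) (B : R).

Definition mul_by (f : R -> R[i]) := fun x => Phi x * f x.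

Lemma L2per_mulPhi f : L2per f -> L2per (mul_by f).
Proof.
move=> hf; apply: L2per_mul hf; [exact: L2per_measC|by case: L2Phi|exact: PhiK].
Qed.

Lemma A_ge0 : 0 <= A. Proof. by have := PhiA (s := [::]) isT; rewrite big_nil. Qed.

Lemma fourier_mulPhi_synth f n : L2per f ->
  fourier (mul_by (synth (fourier f))) n = fourier (mul_by f) n.
Proof.
move=> hf; have l2f := l2_fourier hf; have hs := L2per_synth l2f.
apply: fourier_eqT; try exact: L2per_mulPhi.
have : eqT (synth (fourier f)) f.
  by apply: fourier_inj => // k; rewrite fourier_synth.
by apply: ae_imply => x h Tx; rewrite /mul_by h.
Qed.

Definition coefPhi u := fourier (mul_by (synth u)).

Lemma coefPhi_weight s u B : `|s| <= 2 -> l2 u -> l2w s u B -> l2w s (coefPhi u) (A * B).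
Proof.
move=> s2 l2u uB; apply: mult_weight => //; first exact: L2per_synth.
by apply: l2b_dom uB => n; rewrite fourier_synth.
Qed.

Lemma coefPhiD u v : l2 u -> l2 v ->
  coefPhi (fun n => u n + v n) = fun n => coefPhi u n + coefPhi v n.
Proof.
move=> hu hv; apply/funext => n; have huv := l2D hu hv.
have Su := L2per_synth hu; have Sv := L2per_synth hv.
rewrite /coefPhi -fourierD; [|exact: L2per_mulPhi..].
have -> : (fun x => mul_by (synth u) x + mul_by (synth v) x) =
    mul_by (fun x => synth u x + synth v x).
  by apply/funext => x; rewrite /mul_by mulrDr.
rewrite -[RHS]fourier_mulPhi_synth; last exact: L2per_D.
congr (fourier (mul_by (synth _)) n); apply/funext => k.
by rewrite fourierD// !fourier_synth.
Qed.

Lemma coefPhiZ k u : l2 u -> coefPhi (fun n => k * u n) = fun n => k * coefPhi u n.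
Proof.
move=> hu; apply/funext => n; have hku := l2Z k hu.
have Su := L2per_synth hu.
rewrite /coefPhi -fourierZ; last exact: L2per_mulPhi.
have -> : (fun x => k * mul_by (synth u) x) = mul_by (fun x => k * synth u x).
  by apply/funext => x; rewrite /mul_by mulrCA.
rewrite -[RHS]fourier_mulPhi_synth; last exact: L2per_Z.
congr (fourier (mul_by (synth _)) n); apply/funext => j.
by rewrite fourierZ// !fourier_synth.
Qed.

Variable lambda : R[i].
Hypothesis lambda_re : complex.Re lambda != 0.
Local Notation dl := (dl alpha c lambda).
Local Notation Jsym := (symJ alpha).
Local Notation ell := (symL alpha c).

(** In the unknown [g = dl * u] the equation [(lambda - J L) u = f] becomes [g = f + Cop g], the
    form required by [fredholm]. *)
Definition Cop g := fun n => - (Jsym n * coefPhi (fun k => (dl k)^-1 * g k) n).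

(* The coefficients of (lambda - J L) u. *)
Definition lambda_JL u := fun n => lambda * u n - Jsym n * ((ell n)%:C * u n - coefPhi u n).

Lemma resolvE u n : lambda_JL u n = dl n * u n + Jsym n * coefPhi u n.
Proof. by rewrite /lambda_JL /dl -Jsym_ell//; ring. Qed.

Lemma l2b_divdl kappa s g B : 0 < kappa -> (forall n, kappa * jb R n <= normc (dl n)) ->
  l2w (s - 1) g B -> l2w s (fun n => (dl n)^-1 * g n) (kappa^-1 * B).
Proof.
move=> k0 hk /(@l2b_scale _ _ _ _ (kappa^-1)%:C).
rewrite normcR ger0_norm ?invr_ge0 ?(ltW k0)//; apply: l2b_dom => n.
rewrite !normcM normcV !normcR !ger0_norm ?wt_ge0 ?invr_ge0 ?(ltW k0)//.
rewrite !mulrA ler_wpM2r ?normc_ge0//.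
have p : 0 < normc (dl n) by apply: lt_le_trans (hk n); rewrite mulr_gt0// jb_gt0.
rewrite ler_pdivrMr// -mulrA mulrC -ler_pdivrMr ?invr_gt0// invrK.
rewrite -{1}(subrK 1 s) wtD wt1 -mulrA ler_pM2l ?wt_gt0// mulrC; exact: hk.
Qed.

(** The gain of [alpha] derivatives: an estimate of [g] in the weight [- alpha] suffices. [B']
    certifies that the sequence lies in [l2], so that [synth] is meaningful. *)
Lemma Cop_le kappa g B B' : 0 < kappa -> (forall n, kappa * jb R n <= normc (dl n)) ->
  l2b g B' -> l2w (- alpha) g B -> l2b (Cop g) (4 * (A * (kappa^-1 * B))).
Proof.
move=> k0 hk l2g gB.
have l2u : l2 (fun n => (dl n)^-1 * g n).
  exists (kappa^-1 * B'); apply/l2w0; apply: l2b_divdl => //.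
  by apply: l2w_le (_ : _ <= 0) _; [lra|apply/l2w0].
have uB : l2w (1 - alpha) (fun n => (dl n)^-1 * g n) (kappa^-1 * B).
  by apply: l2b_divdl => //; have -> : 1 - alpha - 1 = - alpha by ring.
have a2 := norm_1Balpha alpha_gt0 alpha_le2.
have := l2b_scale 4%:C (coefPhi_weight a2 l2u uB); rewrite normcR ger0_norm//.
apply: l2b_dom => n; rewrite /Cop normcN.
have := @wt_Jsym_le R alpha alpha_gt0 alpha_le2 1 (1 - alpha) n (coefPhi (fun k => (dl k)^-1 * g k) n).
by rewrite subrr wt0 mul1r; apply; rewrite subrK.
Qed.

Lemma CopD u v : l2 u -> l2 v -> Cop (fun n => u n + v n) = fun n => Cop u n + Cop v n.
Proof.
move=> hu hv; have [kappa k0 hk] := dl_ge alpha_gt0 alpha_le2 c_ge lambda_re.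
have hl w : l2 w -> l2 (fun n => (dl n)^-1 * w n).
  move=> [B wB]; exists (kappa^-1 * B); apply/l2w0; apply: l2b_divdl => //.
  by apply: l2w_le (_ : _ <= 0) _; [lra|apply/l2w0].
apply/funext => n; rewrite /Cop -opprD -mulrDr.
have := coefPhiD (hl _ hu) (hl _ hv) => /(congr1 (fun f => f n)) /= <-.
by congr (- (_ * coefPhi _ n)); apply/funext => k; rewrite mulrDr.
Qed.

Lemma CopZ z u : l2 u -> Cop (fun n => z * u n) = fun n => z * Cop u n.
Proof.
move=> hu; have [kappa k0 hk] := dl_ge alpha_gt0 alpha_le2 c_ge lambda_re.
have hl w : l2 w -> l2 (fun n => (dl n)^-1 * w n).
  move=> [B wB]; exists (kappa^-1 * B); apply/l2w0; apply: l2b_divdl => //.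
  by apply: l2w_le (_ : _ <= 0) _; [lra|apply/l2w0].
apply/funext => n; rewrite /Cop.
have -> : (fun k => (dl k)^-1 * (z * u k)) = fun k => z * ((dl k)^-1 * u k).
  by apply/funext => k; rewrite mulrCA.
by rewrite coefPhiZ; [ring|exact: hl].
Qed.

Lemma wtN_small (M : R) : exists N : nat, forall n, n \notin box N ->
  M * wt (- alpha) n <= 1.
Proof.
pose M1 := Num.max M 1; have M10 : 0 < M1 by rewrite lt_max ltr01 orbT.
pose x := M1 `^ alpha^-1; have x0 : 0 <= x by exact: powR_ge0.
exists (Num.bound x) => n; rewrite mem_box -ltnNge => hn.
rewrite /wt powRN ler_pdivrMr ?powR_gt0 ?jb_gt0// mul1r.
apply: (@le_trans _ _ M1); first by rewrite le_max lexx.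
have -> : M1 = x `^ alpha by rewrite -powRrM mulVf ?gt_eqF// powRr1// ltW.
apply: ge0_ler_powR; rewrite ?nnegrE ?(ltW alpha_gt0) ?(ltW (jb_gt0 _ _))//.
apply: le_trans (ltW (archi_boundP x0)) _.
apply: (@le_trans _ _ `|n%:~R|); last by rewrite /jb lerDr.
by apply: normr_int_ge; exact: ltnW.
Qed.

Hypothesis resolv_inj : forall u B, l2w 1 u B -> (forall n, lambda_JL u n = 0) -> u = fun=> 0.

Lemma Cop_inj g : l2 g -> (forall n, g n = Cop g n) -> g = fun=> 0.
Proof.
move=> [B gB] gC; have [kappa k0 hk] := dl_ge alpha_gt0 alpha_le2 c_ge lambda_re.
have dn0 := dl_neq0 alpha_gt0 alpha_le2 c_ge lambda_re.
have uB : l2w 1 (fun n => (dl n)^-1 * g n) (kappa^-1 * B).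
  by apply: l2b_divdl => //; rewrite subrr; apply/l2w0.
have u0 := resolv_inj uB (fun n => _).
apply/funext => n; rewrite -[LHS](mulVKf (dn0 n)).
have -> : (dl n)^-1 * g n = 0; last by rewrite mulr0.
rewrite -[LHS]/((fun n => (dl n)^-1 * g n) n) u0// => k.
by rewrite resolvE (mulVKf (dn0 k)) gC /Cop addNr.
Qed.

Lemma resolv_solve : exists2 K : R, 0 <= K & forall f B, l2b f B ->
  exists u, [/\ l2w 1 u (K * B), l2b u (K * B) & forall n, lambda_JL u n = f n].
Proof.
have [kappa k0 hk] := dl_ge alpha_gt0 alpha_le2 c_ge lambda_re.
have dn0 := dl_neq0 alpha_gt0 alpha_le2 c_ge lambda_re.
pose M := 4 * (A * kappa^-1).
have M0 : 0 <= M by rewrite !mulr_ge0 ?A_ge0 ?invr_ge0 ?(ltW k0).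
have Cbnd u B : l2b u B -> l2b (Cop u) (M * B).
  move=> uB; have -> : M * B = 4 * (A * (kappa^-1 * B)) by rewrite /M; ring.
  apply: (Cop_le k0 hk uB); apply: (@l2w_le _ _ 0); last by apply/l2w0.
  by rewrite oppr_le0 ltW.
(* For [M <> 0], the weight [- alpha] is at most [1 / (2 M)] off this box, which turns [Cop_le] into
   a contraction by 1/2. *)
have [N hN] := wtN_small (2 * M).
have Csmall u B : (forall n, n \in box N -> u n = 0) -> l2b u B -> l2b (Cop u) (B / 2).
  move=> u0 uB; have B0 := l2b_ge0 uB.
  have [M00|Mn0] := eqVneq M 0.
    apply: l2b_le (Cbnd u B uB); rewrite M00 mul0r divr_ge0//.
  have Mp : 0 < M by rewrite lt_neqAle eq_sym Mn0.
  have -> : B / 2 = 4 * (A * (kappa^-1 * ((2 * M)^-1 * B))).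
    have -> : 4 * (A * (kappa^-1 * ((2 * M)^-1 * B))) = M * ((2 * M)^-1 * B) by rewrite /M; ring.
    by field.
  apply: (Cop_le k0 hk uB).
  have p2 : 0 < 2 * M by rewrite mulr_gt0.
  have p2i : 0 <= (2 * M)^-1 by rewrite invr_ge0 ltW.
  have := l2b_scale ((2 * M)^-1)%:C uB; rewrite normcR ger0_norm//.
  apply: l2b_dom => n; have [nN|nN] := boolP (n \in box N).
    by rewrite u0// !mulr0.
  rewrite !normcM !normcR ger0_norm ?wt_ge0// ger0_norm//.
  apply: ler_wpM2r; first exact: normc_ge0.
  by rewrite -(ler_pM2l p2) mulfV ?gt_eqF//; exact: hN.
have [K K0 hK] := fredholm CopD CopZ M0 Cbnd (box_uniq N) Csmall Cop_inj.
exists (kappa^-1 * K) => [|f B fB]; first by rewrite mulr_ge0// invr_ge0 ltW.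
have [g gB gC] := hK f B fB.
have uB : l2w 1 (fun n => (dl n)^-1 * g n) (kappa^-1 * K * B).
  by rewrite -mulrA; apply: l2b_divdl => //; rewrite subrr; apply/l2w0.
exists (fun n => (dl n)^-1 * g n); split => //.
  by apply/l2w0; apply: l2w_le uB; lra.
by move=> n; rewrite resolvE (mulVKf (dn0 n)) gC /Cop subrK.
Qed.

(* Each step gains alpha derivatives, up to the first one. *)
Lemma resolv_regular u f B : l2 u -> l2b f B -> (forall n, lambda_JL u n = f n) ->
  exists B', l2w 1 u B'.
Proof.
move=> l2u fB uf; have [kappa k0 hk] := dl_ge alpha_gt0 alpha_le2 c_ge lambda_re.
have dn0 := dl_neq0 alpha_gt0 alpha_le2 c_ge lambda_re.
have uE : u = fun n => (dl n)^-1 * (f n - Jsym n * coefPhi u n).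
  by apply/funext => n; rewrite -uf resolvE addrK mulKf.
have step s : 0 <= s <= 1 -> (exists B', l2w s u B') ->
    exists B', l2w (Num.min 1 (s + alpha)) u B'.
  move=> /andP[s0 s1] [B' uB'].
  pose t := Num.min 1 (s + alpha).
  have t1 : t <= 1 by rewrite /t ge_min lexx.
  have ts : t <= s + alpha by rewrite /t ge_min lexx orbT.
  have s2 : `|s| <= 2 by rewrite ger0_norm//; lra.
  have pB := coefPhi_weight s2 l2u uB'.
  have JB : l2w (t - 1) (fun n => Jsym n * coefPhi u n) (4 * (A * B')).
    have := l2b_scale 4%:C pB; rewrite normcR ger0_norm//; apply: l2b_dom => n.
    exact: wt_Jsym_le.
  have fB' : l2w (t - 1) f B by apply: l2w_le (_ : _ <= 0) _; [lra|apply/l2w0].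
  exists (kappa^-1 * (B + 4 * (A * B'))); rewrite uE; apply: l2b_divdl => //.
  by apply: l2b_dom (l2b_sub fB' JB) => n; rewrite mulrBr.
have iter k : exists B', l2w (Num.min 1 (k%:R * alpha)) u B'.
  elim: k => [|k IH].
    have [B' uB'] := l2u; exists B'; rewrite mul0r min_r//; exact/l2w0.
  have [h|h] := leP 1 (k%:R * alpha).
    move: IH; rewrite !min_l//; apply: le_trans h _.
    by rewrite ler_pM2r// ler_nat.
  move: IH; rewrite min_r ?(ltW h)// => IH.
  have := step _ _ IH; rewrite mulrS mulrDl mul1r addrC; apply.
  by rewrite (ltW h) mulr_ge0// ltW.
(* After more than [1 / alpha] steps the regularity reaches the cap 1. *)
have [B' hB'] := iter (Num.bound alpha^-1); exists B'.
have a0 : 0 <= alpha^-1 by rewrite invr_ge0 ltW.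
move: hB'; rewrite min_l//.
by rewrite -ler_pdivrMr// div1r; exact/ltW/archi_boundP.
Qed.

End resolvent_equation.

(** * Absence of unstable eigenvalues *)

Section inner_product_limits.
Variable R : realType.
Implicit Types (f g : R -> R[i]) (n : int).
Local Notation ip := (@innerL2 R).

Lemma ip_le f g f' g' : L2per f -> L2per g -> L2per f' -> L2per g' ->
  (forall M, complex.Re (psum f g M) <= complex.Re (psum f' g' M)) ->
  complex.Re (ip f g) <= complex.Re (ip f' g').
Proof.
move=> hf hg hf' hg' E; apply/ler_addgt0Pr => e e0.
have e2 : 0 < e / 2 by rewrite divr_gt0.
have [N1 h1] := ip_approx hf hg e2; have [N2 h2] := ip_approx hf' hg' e2.
have := h1 (maxn N1 N2) (leq_maxl _ _); have := h2 (maxn N1 N2) (leq_maxr _ _).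
have := E (maxn N1 N2); set M := maxn N1 N2.
move=> hM /(le_trans (Re_le_normc _)) {}h2 /(le_trans (Re_le_normc _)) {}h1.
have RB (z w : R[i]) : complex.Re (z - w) = complex.Re z - complex.Re w.
  by case: z w => ? ? [].
have RZ (r : R) (z : R[i]) : complex.Re (r%:C * z) = r * complex.Re z.
  by case: z => ? ? /=; rewrite mul0r subr0.
move: h1 h2; rewrite !RB !RZ !ler_norml => /andP[_ h1] /andP[h2 _].
by have := ler_wpM2l (ltW (@twopi_gt0 R)) hM; move: h1 h2; lra.
Qed.

Lemma int_ge2 n : (2 <= `|n|)%N -> (n == 1) = false /\ (n == -1) = false.
Proof. by move=> h; split; lia. Qed.

Lemma int_lt2 n : ~~ (2 <= `|n|)%N -> [\/ n = 0, n = 1 | n = -1].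
Proof.
move=> h; have [|[|]] : n = 0 \/ n = 1 \/ n = -1 by lia.
- by constructor 1.
- by constructor 2.
- by constructor 3.
Qed.

Lemma ReR (x : R) : complex.Re x%:C = x. Proof. by []. Qed.

Lemma mul_conjcZ (k : R) (z : R[i]) : z^* * (k%:C * z) = (k * normc z ^+ 2)%:C.
Proof. by rewrite mulrCA mul_conjc -rmorphM. Qed.

Lemma sum_box_opp (F : int -> R[i]) N : \sum_(n <- box N) F (- n) = \sum_(n <- box N) F n.
Proof.
rewrite -(big_map (fun n => - n) xpredT F); apply: perm_big; apply: uniq_perm.
- by rewrite map_inj_uniq ?box_uniq//; exact: oppr_inj.
- exact: box_uniq.
move=> n; apply/mapP/idP => [[m hm ->]|hn].
  by move: hm; rewrite !mem_box abszN.
by exists (- n); rewrite ?opprK//; move: hn; rewrite !mem_box abszN.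
Qed.

Lemma ip_odd f g : L2per f -> L2per g ->
  (forall n, (fourier f (- n))^* * fourier g (- n) = - ((fourier f n)^* * fourier g n)) ->
  ip f g = 0.
Proof.
move=> hf hg E; have : ip f g = - ip f g.
  rewrite -mulN1r -ipZr//; apply: ip_ext => //; first exact: L2per_Z.
  move=> M; rewrite /psum -sum_box_opp; apply: eq_bigr => n _.
  by rewrite E fourierZ// mulN1r mulrN.
move/eqP; rewrite -subr_eq0 opprK -mulr2n mulrn_eq0 => /eqP//.
Qed.

Lemma fourier_real (phi : R -> R) n : L2per (toC phi) ->
  fourier (toC phi) (- n) = (fourier (toC phi) n)^*.
Proof.
move=> hp; rewrite !fourierE conjcM conjcR; congr (_ * _).
rewrite /innerL2 -integralT_J; last by apply: intC_ip => //; exact: L2per_expi.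
congr integralT; apply/funext => x.
by rewrite conjcM conjCK /toC conjcR expiJ opprK.
Qed.

Lemma normL2_one : normL2 (fun=> 1 : R[i]) = r2pi R.
Proof.
apply/eqP; rewrite -(@eqrXn2 _ 2) ?normL2_ge0 ?(ltW (@r2pi_gt0 R))// r2pi_sqr.
rewrite -(inj_eq (@complexI R)) -ip_norm.
have -> : (fun=> 1 : R[i]) = expi 0 :> (R -> R[i]) by apply/funext => x; rewrite expi0.
by rewrite ip_expi eqxx.
Qed.

Lemma normL2_bounded f K : measC f -> perC f -> (forall x, normc (f x) <= K) ->
  normL2 f <= K * r2pi R.
Proof.
move=> mf pf fK; have := normL2_mul mf pf fK (L2per_cst (1 : R[i])).
by rewrite normL2_one; under eq_fun do rewrite mulr1.
Qed.

Lemma l2b_of_sum (a : int -> R[i]) A :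
  (forall s : seq int, uniq s -> \sum_(j <- s) normc (a j) <= A) -> l2b a A.
Proof.
move=> h; have A0 : 0 <= A by have := h [::] isT; rewrite big_nil.
split=> // s us; apply: (@le_trans _ _ ((\sum_(j <- s) normc (a j)) ^+ 2)); last first.
  by rewrite ler_pXn2r ?nnegrE ?h// sumr_ge0// => j _; exact: normc_ge0.
rewrite expr2 mulr_suml big_seq [leRHS]big_seq; apply: ler_sum => j js.
rewrite expr2 ler_wpM2l ?normc_ge0// (big_rem j)//= lerDl.
by rewrite sumr_ge0// => k _; exact: normc_ge0.
Qed.

Lemma fourier_norm_eq0 f n : L2per f -> normL2 f = 0 -> fourier f n = 0.
Proof.
move=> hf h; apply/eqP; rewrite -normc_eq0 eq_le normc_ge0 andbT.
by have := l2b_coef n (bessel hf); rewrite h mul0r.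
Qed.

End inner_product_limits.

Local Opaque fourier.

Section no_unstable_eigenvalue.
Variables (R : realType) (alpha c : R).
Hypothesis alpha_gt0 : 0 < alpha.
Hypothesis alpha_le2 : alpha <= 2.
Hypothesis c_ge : 2^-1 <= c.
Variables (phi : R -> R) (a K A : R).
Local Notation Phi := (toC phi).
Hypothesis a_gt0 : 0 < a.
Hypothesis K_ge0 : 0 <= K.
Hypothesis L2Phi : L2per Phi.
Hypothesis phi_le : forall x, `|phi x| <= K * a.
Hypothesis phi_cos : forall x, `|phi x - a * cos x| <= K * a ^+ 2.
Hypothesis PhiA : forall s : seq int, uniq s ->
  \sum_(j <- s) jb R j ^+ 2 * normc (fourier Phi j) <= A.
Local Notation mulPhi := (mul_by Phi).
Local Notation coefPhi := (coefPhi Phi).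
Local Notation ell := (symL alpha c).
Local Notation absa := (absa alpha).
Local Notation Jsym := (symJ alpha).
Local Notation ip := (@innerL2 R).
Hypothesis Phi0 : fourier Phi 0 = 0.
Hypothesis wave : forall n, n != 0 ->
  (ell n)%:C * fourier Phi n = 2^-1 * fourier (mulPhi Phi) n.
(** The symbol of c D^alpha + c - 1 at n = 2 for c = 1/2, a lower bound for all [|n| >= 2] when
    [c >= 1/2]. *)
Let kap : R := (2 `^ alpha - 1) / 2.
Hypothesis small1 : 4 * K * a < kap.
Hypothesis small2 : 4 * (K + K ^+ 2 / 2) * a <= 1.
Implicit Types (n : int) (u g : int -> R[i]) (B : R) (f : R -> R[i]).

Let PhiK x : normc (Phi x) <= K * a.
Proof. by rewrite normcR. Qed.

Let Ka0 : 0 <= K * a. Proof. by rewrite mulr_ge0// ltW. Qed.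

Let L2mul f : L2per f -> L2per (mulPhi f).
Proof. exact: L2per_mulPhi PhiK _. Qed.

Let mul_le f : L2per f -> normL2 (mulPhi f) <= K * a * normL2 f.
Proof. move=> hf; apply: normL2_mul => //; [exact: L2per_measC|by case: L2Phi]. Qed.

Let ip_mulC f1 f2 : ip (mulPhi f1) f2 = ip f1 (mulPhi f2).
Proof.
by congr integralT; apply/funext => x; rewrite /mulPhi /toC conjcM conjcR; ring.
Qed.

(** Coefficients of phi'. The derivative [dPhi] exists only through them, so its product rule and
    its realness are proved on coefficients. *)
Let in_phi n : R[i] := (0 +i* n%:~R) * fourier Phi n.

Let normc_in n : normc (0 +i* (n%:~R : R)) = `|n%:~R|.
Proof. by rewrite /= expr0n add0r sqrtr_sqr. Qed.

Let conj_in n : (0 +i* (n%:~R : R))^* = - (0 +i* n%:~R).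
Proof. by apply/eqP; rewrite conjcE eq_complex /= oppr0 !eqxx. Qed.

Let l2_in_phi : l2 in_phi.
Proof.
exists A; apply: l2b_of_sum => s us; apply: le_trans (PhiA us); apply: ler_sum => n _.
rewrite normcM normc_in ler_wpM2r ?normc_ge0//.
apply: (@le_trans _ _ (jb R n)); first by rewrite /jb lerDr.
by rewrite expr2 ler_peMr ?jb_ge1// ltW// jb_gt0.
Qed.

Let dPhi := synth in_phi.
Let L2dPhi : L2per dPhi. Proof. exact: L2per_synth. Qed.
Let fourier_dPhi n : fourier dPhi n = in_phi n. Proof. exact: fourier_synth. Qed.

Let fourier_dPhiJ n : fourier (fun x => (dPhi x)^*) n = in_phi n.
Proof.
rewrite fourierE.
have -> : ip (expi n) (fun x => (dPhi x)^*) = (ip (expi (- n)) dPhi)^*.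
  rewrite /innerL2 -integralT_J; last by apply: intC_ip => //; exact: L2per_expi.
  by congr integralT; apply/funext => x; rewrite conjcM conjCK !expiJ.
rewrite -(conjcR (2 * pi)^-1) -conjcM -fourierE fourier_dPhi /in_phi fourier_real//.
by rewrite conjcM conjCK conj_in intrN; congr (_ * _); apply/eqP; rewrite eq_complex /= oppr0 opprK !eqxx.
Qed.

Let L2expi_mul f n : L2per f -> L2per (fun x => f x * expi n x).
Proof.
by move=> hf; have := L2per_expi_mul n hf; congr L2per; apply/funext => x; rewrite mulrC.
Qed.

Let fourier_mul_expi f n k : L2per f -> fourier (fun x => f x * expi n x) k = fourier f (k - n).
Proof.
by move=> hf; rewrite -(fourier_shift n k hf); congr (fourier _ k); apply/funext => x; rewrite mulrC.
Qed.

Let fourier_mulPhi f n : fourier (mulPhi f) n =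
  ((2 * pi)^-1)%:C * ip (fun x => Phi x * expi n x) f.
Proof.
by rewrite fourier_mulE; congr (_ * innerL2 _ f); apply/funext => x; rewrite /toC conjcR.
Qed.

(* (phi^2)' = 2 phi phi' *)
Let product_rule n :
  (0 +i* n%:~R) * fourier (mulPhi Phi) n = 2 * fourier (mulPhi dPhi) n.
Proof.
(* Integration by parts on coefficients: [i k = i n + i (k - n)]. *)
have h1 : ip (fun x => Phi x * expi n x) dPhi =
    (0 +i* n%:~R) * ip (fun x => Phi x * expi n x) Phi - ip (fun x => dPhi x * expi n x) Phi.
  have hP := L2expi_mul n L2Phi; have hd := L2expi_mul n L2dPhi.
  have -> : (0 +i* n%:~R) * ip (fun x => Phi x * expi n x) Phi - ip (fun x => dPhi x * expi n x) Phi
    = ip (fun x => (- (0 +i* n%:~R)) * (Phi x * expi n x) - dPhi x * expi n x) Phi.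
    rewrite ipBl//; last exact: L2per_Z.
    rewrite ipZl//; congr (_ * _ - _).
    by rewrite -conj_in conjCK.
  apply: ip_ext_coef => // [|k]; first by apply: L2per_B => //; exact: L2per_Z.
  rewrite fourierB//; last exact: L2per_Z.
  rewrite fourierZ// !fourier_mul_expi// !fourier_dPhi /in_phi.
  rewrite conjcB conjcM [in RHS]conjcM -conj_in conjCK conj_in intrB.
  have -> : 0 +i* (k%:~R - n%:~R : R) = (0 +i* k%:~R) - (0 +i* n%:~R).
    by apply/eqP; rewrite eq_complex /= subr0 !eqxx.
  by ring.
have h2 : ip (fun x => dPhi x * expi n x) Phi = (2 * pi)%:C * fourier (mulPhi dPhi) n.
  have -> : ip (fun x => dPhi x * expi n x) Phi = ip (expi n) (mulPhi (fun x => (dPhi x)^*)).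
    by congr integralT; apply/funext => x; rewrite /mulPhi conjcM; ring.
  have -> : ip (expi n) (mulPhi (fun x => (dPhi x)^*)) = ip (expi n) (mulPhi dPhi).
    apply: ip_eqTr => //; try by apply: L2mul => //; exact: L2per_J.
    have : eqT (fun x => (dPhi x)^*) dPhi.
      by apply: fourier_inj => // [|k]; [exact: L2per_J|rewrite fourier_dPhiJ fourier_dPhi].
    by apply: ae_imply => x h Tx; rewrite /mulPhi h.
  exact: ip_expi_fourier.
move: h1; rewrite h2 !fourier_mulPhi mulrA -rmorphM divff ?gt_eqF ?twopi_gt0// mul1r.
move: (ip _ dPhi) (ip _ Phi) => Y X h1.
by rewrite mulrCA [in RHS]mulrCA; congr (_ * _); rewrite [in RHS]mulr_natl mulr2n {2}h1 addrC subrK.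
Qed.

(** The derivative of the wave equation, that is L phi' = 0; mode zero is excluded by the projection
    in that equation. *)
Let wave_dPhi n : n != 0 -> fourier (mulPhi dPhi) n = (ell n)%:C * in_phi n.
Proof.
move=> n0; rewrite /in_phi mulrCA wave// mulrCA product_rule.
by rewrite mulrA mulVf ?mul1r// pnatr_eq0.
Qed.

(** Symmetry of L together with L phi' = 0. The mean of [Z] being zero removes mode zero, which
    [wave_dPhi] leaves out. *)
Let dPhi_L Z DZ : L2per Z -> L2per DZ -> fourier Z 0 = 0 ->
  (forall n, fourier DZ n = (ell n)%:C * fourier Z n) ->
  ip dPhi DZ = ip dPhi (mulPhi Z).
Proof.
move=> hZ hDZ Z0 DZE; rewrite -ip_mulC; apply: ip_ext_coef => // [|n]; first exact: L2mul.
have [->|n0] := eqVneq n 0; first by rewrite DZE Z0 !mulr0.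
by rewrite DZE wave_dPhi// fourier_dPhi conjcM conjcR; ring.
Qed.

Let ell_ge n : (2 <= `|n|)%N -> kap <= ell n.
Proof.
move=> n2; have h := absa_ge alpha_gt0 n2; rewrite /kap /ell.
have := ler_pM (_ : 0 <= 2^-1 :> R) (powR_ge0 2 alpha) c_ge h.
rewrite invr_ge0 ler0n => /(_ isT); have := c_ge; lra.
Qed.

Let ell_ge0 n : `|n|%N = 1%N -> 0 <= ell n.
Proof.
move=> n1; have -> : ell n = 2 * c - 1.
  rewrite /ell /absa -intr_norm -abszE n1.
  by rewrite powR1; ring.
by have := c_ge; lra.
Qed.

(** This pointwise form makes closeness to [a cos x] immediate; [Psi_coef] gives the other form, c
    (1 + D^alpha) phi off mode zero. *)
Let Psi x := Phi x + 2^-1 * mulPhi Phi x.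
Let L2Psi : L2per Psi. Proof. by apply: L2per_D => //; apply: L2per_Z; exact: L2mul. Qed.

Let K2 : R := K + K ^+ 2 / 2.
Let K2_ge0 : 0 <= K2. Proof. by rewrite addr_ge0// divr_ge0// sqr_ge0. Qed.

Let acos x : R[i] := (a / 2)%:C * (expi 1 x + expi (-1) x).

Let acosE x : acos x = (a * cos x)%:C.
Proof.
rewrite /acos /expi mulrN1z mul1r mulN1r cosN sinN.
by apply/eqP; rewrite eq_complex /=; apply/andP; split; apply/eqP; field.
Qed.

Let L2e11 : L2per (fun x : R => expi 1 x + expi (-1) x).
Proof. by apply: L2per_D; exact: L2per_expi. Qed.

Let L2acos : L2per acos. Proof. exact: L2per_Z. Qed.

Let Psi_acos : normL2 (fun x => Psi x - acos x) <= K2 * a ^+ 2 * r2pi R.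
Proof.
have hd := L2per_B L2Psi L2acos; apply: normL2_bounded; [exact: L2per_measC|by case: hd|].
move=> x; rewrite acosE /Psi addrAC; apply: le_trans (normcD _ _) _.
rewrite /K2 mulrDl; apply: lerD.
  by rewrite /toC -rmorphB normcR.
have -> : 2^-1 = (2^-1)%:C :> R[i] by rewrite fmorphV rmorph_nat.
rewrite /mulPhi /toC -!rmorphM normcR normrM normrM ger0_norm ?invr_ge0//.
have := ler_pM (normr_ge0 _) (normr_ge0 _) (phi_le x) (phi_le x).
by rewrite expr2 expr2 => h; move: h; lra.
Qed.

(** [Z] splits into its cosine part [Zc] and the modes [|n| >= 2], called [W]. Orthogonality to
    [Psi] gives [|Z| <= 2 |W|], and then [kap |W|^2 <= <Z, phi Z> <= K a |Z|^2 <= 4 K a |W|^2]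
    contradicts [small1] unless [W = 0]. *)
Let coercive Z DZ : L2per Z -> L2per DZ -> fourier Z 0 = 0 ->
  fourier Z (-1) = fourier Z 1 ->
  (forall n, fourier DZ n = (ell n)%:C * fourier Z n) ->
  ip Psi Z = 0 -> ip Z DZ = ip Z (mulPhi Z) -> normL2 Z = 0.
Proof.
move=> hZ hDZ Z0 Z1 DZE PsiZ QZ; pose r := fourier Z 1.
pose Zc x := r * (expi 1 x + expi (-1) x).
have L2Zc : L2per Zc by exact: L2per_Z.
pose W x := Z x - Zc x; have L2W : L2per W by exact: L2per_B.
have WE n : fourier W n = if (2 <= `|n|)%N then fourier Z n else 0.
  rewrite fourierB// fourierZ// fourierD ?fourier_expi//; try exact: L2per_expi.
  case: ifPn => n2.
    by have [-> ->] := int_ge2 n2; rewrite addr0 mulr0 subr0.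
  have [n0|n1|n1] := int_lt2 n2.
  - by rewrite n0 Z0 /= addr0 mulr0 subr0.
  - by rewrite n1 /= addr0 mulr1 subrr.
  - by rewrite n1 Z1 /= add0r mulr1 subrr.
have kap0 : 0 < kap by apply: le_lt_trans small1; rewrite -mulrA mulr_ge0.
have low : kap * normL2 W ^+ 2 <= complex.Re (ip Z DZ).
  have -> : kap * normL2 W ^+ 2 = complex.Re (ip W (fun x => kap%:C * W x)).
    by rewrite ipZr// ip_norm -rmorphM.
  apply: ip_le => // [|M]; first exact: L2per_Z.
  rewrite /psum !Re_sum; apply: ler_sum => n _.
  rewrite fourierZ// DZE !mul_conjcZ !ReR.
  rewrite WE; case: ifPn => n2; first by rewrite ler_wpM2r ?sqr_ge0// ell_ge.
  rewrite normcr0 expr0n mulr0.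
  have [n0|n0] := eqVneq n 0; first by rewrite n0 Z0 normcr0 expr0n mulr0.
  apply: mulr_ge0; last exact: sqr_ge0.
  by have [n1|->|->] := int_lt2 n2; [rewrite n1 in n0|exact: ell_ge0|exact: ell_ge0].
have up : complex.Re (ip Z DZ) <= K * a * normL2 Z ^+ 2.
  rewrite QZ; apply: le_trans (ler_norm _) _; apply: le_trans (Re_le_normc _) _.
  apply: le_trans (ip_cauchy_schwarz hZ (L2mul hZ)) _.
  rewrite expr2 mulrCA ler_wpM2l ?normL2_ge0//; exact: mul_le.
(* [<a cos, Z> = 2 pi a r] is also [- <Psi - a cos, Z>], of size [a^2]; dividing by [a] leaves a
   bound of order [a]. *)
have rle : r2pi R * normc r <= K2 * a * normL2 Z.
  have e1 : ip acos Z = (2 * pi * a)%:C * r.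
    rewrite ipZl// ipDl//; try exact: L2per_expi.
    rewrite !ip_expi_fourier Z1 conjcR -/r.
    have -> : (2 * pi * a)%:C = (a / 2)%:C * ((2 * pi)%:C + (2 * pi)%:C) :> R[i].
      by rewrite -rmorphD -rmorphM; congr (_%:C); field.
    by rewrite -mulrDl mulrA.
  have e2 : ip acos Z = - ip (fun x => Psi x - acos x) Z.
    by rewrite ipBl// PsiZ sub0r opprK.
  have hd := L2per_B L2Psi L2acos.
  have := ip_cauchy_schwarz hd hZ; rewrite -normcN -e2 e1 normcM normcR.
  have p0 := @r2pi_gt0 R.
  rewrite ger0_norm; last by rewrite mulr_ge0 ?(ltW a_gt0) ?(ltW (@twopi_gt0 R)).
  move=> h; have {}h := le_trans h (ler_wpM2r (normL2_ge0 _) Psi_acos).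
  rewrite -(ler_pM2l (mulr_gt0 p0 a_gt0)).
  move: h; rewrite -r2pi_sqr; lra.
(* [|Zc| <= 2 r2pi |r| <= 2 K2 a |Z|], and [small2] is [4 K2 a <= 1]. *)
have Zc_le : normL2 Zc <= normL2 Z / 2.
  rewrite normL2_Z//.
  have : normL2 (fun x : R => expi 1 x + expi (-1) x) <= 2 * r2pi R.
    apply: normL2_bounded; [exact: L2per_measC|by case: L2e11|].
    by move=> x; apply: le_trans (normcD _ _) _; rewrite !normc_expi; lra.
  move=> /(ler_wpM2l (normc_ge0 r)) /le_trans; apply.
  have := ler_wpM2r (normL2_ge0 Z) small2; rewrite -/K2; move: rle; lra.
have ZW : normL2 Z <= 2 * normL2 W.
  have := normL2_D L2W L2Zc; have -> : (fun x => W x + Zc x) = Z.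
    by apply/funext => x; rewrite /W subrK.
  by move: Zc_le; lra.
have WW : kap * normL2 W ^+ 2 <= 4 * K * a * normL2 W ^+ 2.
  apply: le_trans low _; apply: le_trans up _.
  have : normL2 Z ^+ 2 <= (2 * normL2 W) ^+ 2.
    by rewrite ler_pXn2r ?nnegrE ?mulr_ge0 ?normL2_ge0.
  by move=> /(ler_wpM2l Ka0); rewrite exprMn; lra.
have W0 : normL2 W = 0.
  apply/eqP; rewrite -sqrf_eq0 eq_le sqr_ge0 andbT.
  rewrite -(@pmulr_rle0 _ (kap - 4 * K * a)) ?subr_gt0//.
  by rewrite mulrBl subr_le0.
by apply/eqP; rewrite eq_le normL2_ge0 andbT; move: ZW; rewrite W0 mulr0.
Qed.

Let fourier_acos n : fourier acos n = (a / 2)%:C * ((n == 1)%:R + (n == -1)%:R).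
Proof.
rewrite fourierZ// fourierD ?fourier_expi//; exact: L2per_expi.
Qed.

(** The sum is [a] up to [2 K a^2], and [4 K a <= 1]. It is the denominator of the multiple of phi'
    to be subtracted. *)
Let phi1_neq0 : fourier Phi 1 + fourier Phi (-1) != 0.
Proof.
have hd := L2per_B L2Phi L2acos.
have nd : normL2 (fun x => Phi x - acos x) <= K * a ^+ 2 * r2pi R.
  apply: normL2_bounded; [exact: L2per_measC|by case: hd|].
  by move=> x; rewrite acosE /toC -rmorphB normcR.
have cd n : normc (fourier Phi n - fourier acos n) <= K * a ^+ 2.
  rewrite -fourierB//; apply: le_trans (l2b_coef n (bessel hd)) _.
  by rewrite ler_pdivrMr ?r2pi_gt0.
have := cd 1; have := cd (-1); rewrite !fourier_acos /= add0r addr0 mulr1.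
set p := fourier Phi (-1); set q := fourier Phi 1 => h1 h2.
apply/negP => /eqP E.
have : normc ((q - (a / 2)%:C) + (p - (a / 2)%:C)) <= K * a ^+ 2 + K * a ^+ 2.
  exact: le_trans (normcD _ _) (lerD h2 h1).
have -> : (q - (a / 2)%:C) + (p - (a / 2)%:C) = - a%:C.
  by rewrite addrACA E add0r -opprD -rmorphD; congr (- _%:C); field.
rewrite normcN normcR gtr0_norm// => h3.
have h4 : 4 * K * a <= 1.
  apply: le_trans small2; rewrite -!mulrA ler_pM2l// ler_wpM2r ?(ltW a_gt0)//.
  by rewrite lerDl !mulr_ge0// invr_ge0.
have := ler_wpM2r (ltW a_gt0) h4; move: h3 a_gt0; rewrite expr2; lra.
Qed.

Variable lambda : R[i].
Hypothesis lambda_re : complex.Re lambda != 0.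

Let I : R[i] := 0 +i* 1.
Let II : I * I = -1.
Proof. by apply/eqP; rewrite eq_complex /=; apply/andP; split; apply/eqP; ring. Qed.
Let IJ : I^* = - I.
Proof. by apply/eqP; rewrite conjcE eq_complex /= oppr0 !eqxx. Qed.
Let mulIn n : 0 +i* (n%:~R : R) = I * (n%:~R)%:C.
Proof. by apply/eqP; rewrite eq_complex /=; apply/andP; split; apply/eqP; ring. Qed.

(** The wave equation replaces half the coefficient of phi^2 by [ell n] times that of phi, and
    [1 + ell n = c (1 + |n|^alpha)]. *)
Let Psi_coef n : n != 0 -> fourier Psi n = (c * (1 + absa n))%:C * fourier Phi n.
Proof.
move=> n0; rewrite fourierD//; last by apply: L2per_Z; exact: L2mul.
rewrite fourierZ; last exact: L2mul.
rewrite -wave// -[X in X + _]mul1r -mulrDl; congr (_ * _).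
by rewrite -(rmorph1 (real_complex R)) -rmorphD; congr (_%:C); rewrite /ell; ring.
Qed.

Let ip_real f q : L2per f -> L2per q ->
  (forall n, (fourier f n)^* * fourier q n = (fourier q n)^* * fourier f n) ->
  (ip f q)^* = ip f q.
Proof. by move=> hf hg E; rewrite -ipC//; apply: ip_ext_coef. Qed.

(** The products of coefficients are [i n c (1 + |n|^alpha) |phi_n|^2], odd in n because phi is
    real. *)
Let Psi_dPhi : ip Psi dPhi = 0.
Proof.
apply: ip_odd => // n; rewrite !fourier_dPhi /in_phi.
have [->|n0] := eqVneq n 0.
  by rewrite oppr0 Phi0 !mulr0 oppr0.
have nn0 : - n != 0 by rewrite oppr_eq0.
rewrite !Psi_coef// absaN fourier_real//; move: (fourier Phi n) => z.
by rewrite !conjcM conjCK !conjcR !mulIn intrN rmorphN; ring.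
Qed.

Lemma no_unstable_eigenvalue u B : l2w 1 u B ->
  (forall n, lambda_JL alpha c Phi lambda u n = 0) -> u = fun=> 0.
Proof.
move=> uB ru.
have lam0 : lambda != 0 by apply: contraNneq lambda_re => ->.
have l2u : l2 u by exists B; apply/l2w0; apply: l2w_le uB.
pose U := synth u; have hU : L2per U by exact: L2per_synth.
have UE n : fourier U n = u n by exact: fourier_synth.
have equ n : lambda * u n = Jsym n * ((ell n)%:C * u n - coefPhi u n).
  by apply/eqP; rewrite -subr_eq0; apply/eqP; exact: ru.
have u0 : u 0 = 0.
  have := equ 0; rewrite Jsym0 mul0r => /eqP.
  by rewrite mulf_eq0 (negbTE lam0) => /eqP.
pose h n : R[i] := if n == 0 then 0 else ((1 + absa n) / n%:~R)%:C * u n.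
(* For [|n| >= 1] and [alpha <= 2], [(1 + |n|^alpha) / |n| <= 1 + |n|]; one derivative of u is
   enough. *)
have hB : l2b h B.
  apply: l2b_dom uB => n; rewrite /h; case: eqP => [_|/eqP n0].
    by rewrite normcr0 normc_ge0.
  have n1 : 1 <= `|n%:~R : R| by apply: (@normr_int_ge R 1); rewrite absz_gt0.
  rewrite !normcM !normcR wt1 ler_wpM2r ?normc_ge0// (ger0_norm (ltW (jb_gt0 _ _))).
  rewrite normrM normfV (gtr0_norm (absaD_gt0 _ _)) ler_pdivrMr; last exact: lt_le_trans n1.
  have : absa n <= `|n%:~R| ^+ 2.
    by rewrite -powR_mulrn// /absa; apply: ler_powR.
  by rewrite /jb; move: n1; rewrite expr2; lra.
have l2h : l2 h by exists B.
pose H := synth h; have hH : L2per H by exact: L2per_synth.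
have HE n : fourier H n = h n by exact: fourier_synth.
have wE n : n != 0 -> (ell n)%:C * u n - coefPhi u n = (- (I * lambda)) * h n.
  move=> n0; have nR : (n%:~R : R) != 0 by rewrite intr_eq0.
  have hn : lambda * h n = I * ((ell n)%:C * u n - coefPhi u n).
    rewrite /h (negbTE n0) mulrCA equ mulrA; congr (_ * _).
    have -> : Jsym n = I * (n%:~R / (1 + absa n))%:C.
      by rewrite /symJ mulIn -fmorphV -mulrA -rmorphM.
    rewrite mulrCA -rmorphM -[RHS]mulr1; congr (_ * _).
    rewrite -[RHS](rmorph1 (real_complex R)); congr (_%:C).
    by field; rewrite nR gt_eqF// absaD_gt0.
  by rewrite mulNr -mulrA hn mulrA II mulN1r opprK.
pose d n := (ell n)%:C * u n.
have hmU := L2mul hU.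
(* For [alpha > 1] the weight 1 does not bound [alpha] derivatives of u; the eigenvalue equation
   itself expresses [d] by the l2 sequences [h] and [(phi u)^]. *)
have l2d : l2 d.
  have -> : d = fun n => (if n == 0 then 0 else fourier (mulPhi U) n) + (- (I * lambda)) * h n.
    apply/funext => n; have [->|n0] := eqVneq n 0.
      by rewrite /d u0 /h eqxx !mulr0 addr0.
    by rewrite -wE// /d addrC subrK.
  apply: l2D; last exact: l2Z.
  have [B1 hB1] := l2_fourier hmU; exists B1; apply: l2b_dom hB1 => n.
  by case: eqP => _ //; rewrite normcr0 normc_ge0.
pose D := synth d; have hD : L2per D by exact: L2per_synth.
have DE n : fourier D n = (ell n)%:C * fourier U n by rewrite fourier_synth// UE.
have hDU := L2per_B hD hmU.
(* Off mode zero L u has coefficients [-i lambda h_n]; at mode zero the eigenvalue equation says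
   nothing about L u, hence the mean-zero test functions. *)
have key V : L2per V -> fourier V 0 = 0 ->
    ip V (fun x => D x - mulPhi U x) = - (I * lambda) * ip V H.
  move=> hV V0; rewrite -ipZr//; apply: ip_ext_coef => // [|n]; first exact: L2per_Z.
  have [->|n0] := eqVneq n 0; first by rewrite V0 conjC0 !mul0r.
  by rewrite fourierB// fourierZ// DE UE HE -wE.
have U0 : fourier U 0 = 0 by rewrite UE.
(* Both sides of [<u, L u> = -i lambda <u, h>] are compared with their conjugates:
   [i (conj lambda + lambda) <u, h> = 0]. *)
have rho0 : ip U H = 0.
  have rhoR : (ip U H)^* = ip U H.
    apply: ip_real => // n; rewrite UE HE /h; case: eqP => _; first by rewrite conjC0 mulr0 mul0r.
    by rewrite conjcM conjcR; ring.
  have := key U hU U0; rewrite ipBr// => E.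
  have : (ip U D - ip U (mulPhi U))^* = ip U D - ip U (mulPhi U).
    rewrite conjcB ip_real//; last by move=> n; rewrite DE conjcM conjcR; ring.
    by rewrite -(ipC hU)// ip_mulC.
  rewrite E conjcM rhoR.
  have -> : (- (I * lambda))^* = I * lambda^* by rewrite -mulNr conjcM -IJ conjCK.
  move/eqP; rewrite -subr_eq0 -mulrBl mulf_eq0 => /orP[|/eqP //].
  have -> : I * lambda^* - - (I * lambda) = I * (lambda^* + lambda) by ring.
  rewrite mulf_eq0 => /orP[/eqP I0|].
    by have := II; rewrite I0 mul0r => /esym/eqP; rewrite oppr_eq0 oner_eq0.
  case: (lambda) lambda_re => x y /= x0; rewrite conjcE eq_complex /= => /andP[/eqP x2 _].
  by move: x0; have -> : x = 0; [move: x2; lra|rewrite eqxx].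
have dPhi0 : fourier dPhi 0 = 0 by rewrite fourier_dPhi /in_phi Phi0 mulr0.
have dPhiH : ip dPhi H = 0.
  have := key dPhi L2dPhi dPhi0; rewrite ipBr// (dPhi_L hU hD U0 DE) subrr.
  move/esym/eqP; rewrite mulf_eq0 oppr_eq0 mulf_eq0 (negbTE lam0) orbF.
  case/orP => /eqP // I0; have := II; rewrite I0 mul0r => /esym/eqP.
  by rewrite oppr_eq0 oner_eq0.
(* The factor [n] from phi' cancels the [1 / n] in [h], leaving [c (1 + |n|^alpha)], the symbol that
   takes phi to psi. *)
have PsiU : ip Psi U = 0.
  have -> : ip Psi U = ip dPhi (fun x => (c%:C * I) * H x).
    apply: ip_ext_coef => // [|n]; first exact: L2per_Z.
    rewrite fourierZ// fourier_dPhi /in_phi HE UE.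
    have [->|n0] := eqVneq n 0; first by rewrite u0 /h eqxx !mulr0.
    have nR : (n%:~R : R) != 0 by rewrite intr_eq0.
    rewrite Psi_coef//; move: (fourier Phi n) => z.
    rewrite !conjcM conjcR mulIn conjcM IJ conjcR /h (negbTE n0).
    have -> : (c * (1 + absa n))%:C = (c%:C * ((n%:~R)%:C * ((1 + absa n) / n%:~R)%:C)) :> R[i].
      by rewrite -!rmorphM; congr (_%:C); field.
    have := II; move: I => J JJ.
    have -> : - J * (n%:~R)%:C * z^* * (c%:C * J * (((1 + absa n) / n%:~R)%:C * u n))
      = - (J * J) * ((n%:~R)%:C * z^* * (c%:C * (((1 + absa n) / n%:~R)%:C * u n))) by ring.
    by rewrite JJ opprK; ring.
  by rewrite ipZr// dPhiH mulr0.
(* Solves [z_1 = z_(-1)], since the coefficients of phi' at 1 and -1 differ by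
   [i (phi_1 + phi_(-1))]. *)
pose p := (u 1 - u (-1)) / (I * (fourier Phi 1 + fourier Phi (-1))).
have I0 : I != 0.
  by apply/eqP => I0; have := II; rewrite I0 mul0r => /esym/eqP; rewrite oppr_eq0 oner_eq0.
pose Z x := U x - p * dPhi x; pose DZ x := D x - p * mulPhi dPhi x.
have hpd := L2per_Z p L2dPhi; have hmd := L2mul L2dPhi; have hpmd := L2per_Z p hmd.
have hZ : L2per Z by exact: L2per_B.
have hDZ : L2per DZ by exact: L2per_B.
have ZE n : fourier Z n = u n - p * in_phi n by rewrite fourierB// fourierZ// UE fourier_dPhi.
have DZE n : fourier DZ n = (ell n)%:C * fourier Z n.
  rewrite fourierB// fourierZ// ZE DE UE.
  have [->|n0] := eqVneq n 0; last by rewrite wave_dPhi//; ring.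
  (* At mode zero the product rule says that phi phi' has mean zero, which the differentiated wave
     equation does not cover. *)
  have := product_rule 0; have -> : 0 +i* (0%:~R : R) = 0 by [].
  rewrite mul0r => /esym/eqP; rewrite mulf_eq0 pnatr_eq0 => /eqP ->.
  by rewrite u0 /in_phi Phi0 !mulr0 subrr mulr0.
have Z0 : fourier Z 0 = 0 by rewrite ZE u0 /in_phi Phi0 !mulr0 subrr.
have Z1 : fourier Z (-1) = fourier Z 1.
  rewrite !ZE /in_phi !mulIn mulrN1z rmorphN rmorph1.
  have pE : p * (I * (fourier Phi 1 + fourier Phi (-1))) = u 1 - u (-1).
    by rewrite /p divfK// mulf_neq0.
  have -> : u (-1) = u 1 - p * (I * (fourier Phi 1 + fourier Phi (-1))) by rewrite pE; ring.
  by rewrite rmorph1; ring.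
have PsiZ : ip Psi Z = 0 by rewrite ipBr// PsiU ipZr// Psi_dPhi mulr0 subrr.
have DZU : (fun x => DZ x - mulPhi Z x) = (fun x => D x - mulPhi U x).
  by apply/funext => x; rewrite /DZ /Z /mul_by; ring.
(* L z = L u, so [<z, L z>] is [-i lambda] times [<u, h> - conj(p) <phi', h>], both terms of which
   vanish. *)
have QZ : ip Z DZ = ip Z (mulPhi Z).
  apply/eqP; rewrite -subr_eq0 -ipBr//; last exact: L2mul.
  by rewrite DZU key// ipBl// ipZl// rho0 dPhiH !mulr0 subrr mulr0.
have nZ := coercive hZ hDZ Z0 Z1 DZE PsiZ QZ.
have nmZ : normL2 (mulPhi Z) = 0.
  apply/eqP; rewrite eq_le normL2_ge0 andbT; have := mul_le hZ.
  by rewrite nZ mulr0.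
(* [Z = 0] does not give u = 0 directly, only L u = L z = 0; then [lambda u = J L u = 0]. *)
apply/funext => n; apply: (mulfI lam0); rewrite equ mulr0.
have -> : (ell n)%:C * u n - coefPhi u n = fourier (fun x => D x - mulPhi U x) n.
  by rewrite fourierB// DE UE.
rewrite -DZU fourierB//; last exact: L2mul.
by rewrite DZE (fourier_norm_eq0 n hZ nZ) (fourier_norm_eq0 n (L2mul hZ) nmZ) mulr0 subrr mulr0.
Qed.

End no_unstable_eigenvalue.

Local Transparent fourier.

(** * The resolvent set of the closure *)

Section finite_sums.
Variable R : realType.

Lemma esum_seq_le (T : choiceType) (x : T -> R) (s : seq T) : uniq s ->
  (\esum_(n in [set: T]) (x n)%:E < +oo)%E -> (forall n, 0 <= x n) ->
  \sum_(n <- s) x n <= fine (\esum_(n in [set: T]) (x n)%:E).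
Proof.
move=> us fin x0; rewrite -lee_fin fineK; last first.
  by rewrite ge0_fin_numE// esum_ge0// => n _; rewrite lee_fin.
apply: esum_ge; exists [set` s]; first by split => //; exact: finite_seq.
by rewrite -fsbig_seq// sumEFin.
Qed.

Lemma esum_support_lty (T : choiceType) (x : T -> R) (s : seq T) :
  (forall n, n \notin s -> x n = 0) ->
  (forall n, 0 <= x n) ->
  (\esum_(n in [set: T]) (x n)%:E < +oo)%E.
Proof.
move=> xs x0; have -> : (\esum_(n in [set: T]) (x n)%:E = \esum_(n in [set` undup s]) (x n)%:E)%E.
  rewrite [RHS]esum_mkcond; apply: eq_esum => n _; case: ifPn => // /negP.
  by rewrite inE /= mem_undup => /negP /xs ->.
rewrite esum_fset ?finite_seq//; last by move=> n _; rewrite lee_fin.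
by rewrite -fsbig_seq ?undup_uniq// sumEFin ltry.
Qed.

End finite_sums.

Section coefficients.
Variable R : realType.
Implicit Types (f : R -> R[i]) (n : int).

Lemma fourier0 f : fourier f 0 = mean f.
Proof.
rewrite /fourier; congr mean; apply/funext => x.
by rewrite mul0r cos0 sin0 -[X in _ -i* X]oppr0 opprK mulr1.
Qed.

Lemma X0P f : X0 f <-> L2per f /\ fourier f 0 = 0.
Proof.
rewrite /X0 fourier0 /mean; split=> -[hf]; first by move=> ->; rewrite mulr0.
move/eqP; rewrite mulf_eq0 => /orP[/eqP[] /eqP|/eqP //].
by rewrite invr_eq0 gt_eqF// twopi_gt0.
Qed.

Lemma fourier_cst (k : R[i]) n : fourier (fun=> k) n = if n == 0 then k else 0.
Proof.
have -> : (fun=> k) = fun x : R => k * expi 0 x by apply/funext => x; rewrite expi0 mulr1.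
rewrite fourierZ ?fourier_expi; last exact: L2per_expi.
by case: eqP => _; rewrite ?mulr1 ?mulr0.
Qed.

Lemma normc_fourier f n : L2per f -> normc (fourier f n) <= normL2 f / r2pi R.
Proof. by move=> hf; apply: l2b_coef; exact: bessel. Qed.

End coefficients.

Section closure.
Variables (R : realType) (alpha c : R).
Hypothesis alpha_gt0 : 0 < alpha.
Hypothesis alpha_le2 : alpha <= 2.
Variables (phi : R -> R) (A Kphi : R).
Local Notation Phi := (toC phi).
Hypothesis L2Phi : L2per Phi.
Hypothesis PhiK : forall x, normc (Phi x) <= Kphi.
Hypothesis PhiA : forall s : seq int, uniq s ->
  \sum_(j <- s) jb R j ^+ 2 * normc (fourier Phi j) <= A.
Local Notation Jsym := (symJ alpha).
Local Notation ell := (symL alpha c).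
Local Notation mulPhi := (mul_by Phi).
Implicit Types (u v w : R -> R[i]) (n : int).

Let L2mul f : L2per f -> L2per (mulPhi f).
Proof. exact: L2per_mulPhi. Qed.

Let Kphi_ge0 : 0 <= Kphi. Proof. exact: le_trans (normc_ge0 _) (PhiK 0). Qed.

Lemma fourier_opL u l n : L2per u -> opL alpha c phi u l ->
  fourier l n = (ell n)%:C * fourier u n - fourier (mulPhi u) n.
Proof.
move=> hu [_ hl [d [_ hd dE] lE]].
have h1 := L2per_Z c%:C hd; have h2 := L2per_Z (c - 1)%:C hu; have h3 := L2mul hu.
have h12 := L2per_D h1 h2; have h := L2per_B h12 h3.
rewrite (fourier_eqT n hl h lE) fourierB// fourierD// !fourierZ// dE mulrA -mulrDl -rmorphM -rmorphD.
by rewrite /symL /absa addrA.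
Qed.

(** The constant distinguishing L restricted to X0 from L lives at mode zero, where the symbol of J
    vanishes. *)
Lemma fourier_opJL0 u v n : opJL0 alpha c phi u v ->
  fourier v n = Jsym n * ((ell n)%:C * fourier u n - fourier (mulPhi u) n).
Proof.
move=> [_ [w [[hu _] [hw _] [l lE wE]] [_ _ ->]]]; rewrite -/(Jsym n).
have [->|n0] := eqVneq n 0; first by rewrite Jsym0 !mul0r.
have hl : L2per l by case: lE.
congr (_ * _); rewrite -(fourier_opL n hu lE) (fourier_eqT n hw _ wE); last first.
  by apply: L2per_D => //; exact: L2per_cst.
by rewrite fourierD ?fourier_cst ?(negbTE n0) ?addr0//; exact: L2per_cst.
Qed.

(** For a fixed [n] both sides are L^2-continuous, with a constant [C] depending on [n], so the
    relation passes to the closure. *)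
Lemma fourier_closure u v n : closure_op (@X0 R) (opJL0 alpha c phi) u v ->
  fourier v n = Jsym n * ((ell n)%:C * fourier u n - fourier (mulPhi u) n).
Proof.
move=> [[hu _] [hv _] appr]; apply/eqP; rewrite -subr_eq0 -normc_eq0.
rewrite eq_le normc_ge0 andbT; apply/ler_addgt0Pr => e e0; rewrite add0r.
pose C := (1 + normc (Jsym n) * (`|ell n| + Kphi)) / r2pi R.
have C0 : 0 < C.
  by rewrite divr_gt0 ?r2pi_gt0// ltr_pwDl// mulr_ge0 ?normc_ge0// addr_ge0.
have [u' [v' [uv' hu' hv']]] := appr (e / C) (divr_gt0 e0 C0).
have L2u' : L2per u' by case: uv' => _ [w [[[]]]].
have L2v' : L2per v' by case: uv' => [[]].
have E := fourier_opJL0 n uv'.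
have L2du := L2per_B hu L2u'; have L2dv := L2per_B hv L2v'.
have hm : (fun x => mulPhi u x - mulPhi u' x) = mulPhi (fun x => u x - u' x).
  by apply/funext => x; rewrite /mul_by; ring.
have -> : fourier v n - Jsym n * ((ell n)%:C * fourier u n - fourier (mulPhi u) n) =
    fourier (fun x => v x - v' x) n - Jsym n * ((ell n)%:C * fourier (fun x => u x - u' x) n
      - fourier (mulPhi (fun x => u x - u' x)) n).
  by rewrite -hm !fourierB//; [rewrite E; ring|exact: L2mul..].
have b1 := normc_fourier n L2dv; have b2 := normc_fourier n L2du.
have b3 : normc (fourier (mulPhi (fun x => u x - u' x)) n) <= Kphi * (normL2 (fun x => u x - u' x) / r2pi R).
  apply: le_trans (normc_fourier n (L2mul L2du)) _; rewrite mulrA ler_pM2r ?invr_gt0 ?r2pi_gt0//.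
  by apply: normL2_mul => //; [exact: L2per_measC|case: L2Phi].
have r0 := r2pi_gt0 R.
have {}b1 : normc (fourier (fun x => v x - v' x) n) <= e / C / r2pi R.
  by apply: le_trans b1 _; rewrite ler_pM2r ?invr_gt0// ltW.
have nu : normL2 (fun x => u x - u' x) / r2pi R <= e / C / r2pi R.
  by rewrite ler_pM2r ?invr_gt0// ltW.
have {}b2 := le_trans b2 nu; have {}b3 := le_trans b3 (ler_wpM2l Kphi_ge0 nu).
apply: le_trans (normcB _ _) _.
have -> : e = e / C / r2pi R + normc (Jsym n) * (`|ell n| * (e / C / r2pi R) + Kphi * (e / C / r2pi R)).
  rewrite -{1}(divfK (lt0r_neq0 C0) e); move: (e / C) => q; rewrite /C; ring.
apply: lerD b1 _; rewrite normcM ler_wpM2l ?normc_ge0//.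
apply: le_trans (normcB _ _) _; apply: lerD => //.
by rewrite normcM normcR ler_wpM2l.
Qed.

(** The approximants are the truncations of [u] to boxes, which lie in every Sobolev space. J L has
    order one, so the weight 1 controls the error in [v] as well as in [u]. *)
Lemma closure_opJL0 u v B : L2per u -> L2per v -> fourier u 0 = 0 ->
  l2w 1 (fourier u) B ->
  (forall n, fourier v n = Jsym n * ((ell n)%:C * fourier u n - fourier (mulPhi u) n)) ->
  closure_op (@X0 R) (opJL0 alpha c phi) u v.
Proof.
move=> hu hv u0 uB vE.
have v0 : fourier v 0 = 0 by rewrite vE Jsym0 mul0r.
split; [exact/X0P|exact/X0P|] => e e0.
have r0 := r2pi_gt0 R; have A0 : 0 <= A by exact: A_ge0 PhiA.
pose C := r2pi R * (`|c| + 1 + 4 * A + 1).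
have C0 : 0 < C by rewrite mulr_gt0// ltr_wpDl// !addr_ge0// mulr_ge0.
pose e' := e / (C + 1); have e'0 : 0 < e' by rewrite divr_gt0// ltr_wpDl// ltW.
have Ce : C * e' < e.
  by rewrite /e' mulrCA gtr_pMr// ltr_pdivrMr ?mul1r ?ltrDl// ltr_wpDl// ltW.
have [N /(_ N (leqnn _)) hN] := l2b_tail uB e'0.
pose U := trig (box N) (fourier u).
have hU : L2per U by exact: L2per_trig.
have UE n : fourier U n = if n \in box N then fourier u n else 0.
  by rewrite fourier_trig// box_uniq.
have hT := L2per_B hu hU; set T := (fun x => u x - U x) in hT.
have TE n : fourier T n = if n \in box N then 0 else fourier u n.
  by rewrite fourierB// UE; case: ifP => _; rewrite ?subrr ?subr0.
have T1 : l2w 1 (fourier T) e'.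
  by apply: l2b_dom hN => n; rewrite TE; case: ifP => _ //; rewrite mulr0.
pose V' n := Jsym n * ((ell n)%:C * fourier U n - fourier (mulPhi U) n).
have mT : (fun x => mulPhi u x - mulPhi U x) = mulPhi T.
  by apply/funext => x; rewrite /mul_by /T; ring.
have dV n : fourier v n - V' n = (Jsym n * (ell n)%:C) * fourier T n - Jsym n * fourier (mulPhi T) n.
  by rewrite -mT !fourierB//; [rewrite vE /V'; ring|exact: L2mul..].
have dVb : l2b (fun n => fourier v n - V' n) ((`|c| + 1 + 4 * A) * e').
  have -> : (fun n => fourier v n - V' n) =
      fun n => (Jsym n * (ell n)%:C) * fourier T n - Jsym n * fourier (mulPhi T) n.
    exact/funext.
  rewrite mulrDl; apply: l2b_sub.
    have c1 : 0 <= `|c| + 1 by rewrite addr_ge0.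
    have := l2b_scale (`|c| + 1)%:C T1; rewrite normcR (ger0_norm c1).
    apply: l2b_dom => n; rewrite Jsym_ell//; move: (fourier T n) => z.
    rewrite !normcM !normcR wt1 [leRHS]mulrA ler_wpM2r ?normc_ge0//.
    rewrite (ger0_norm c1) (ger0_norm (ltW (jb_gt0 _ _))).
    by rewrite /= expr0n add0r sqrtr_sqr; exact: omega_le.
  have l1 : `|1 : R| <= 2 by rewrite normr1 ler1n.
  have := mult_weight L2Phi PhiA l1 hT T1; rewrite -/(mulPhi T).
  move=> /(@l2b_scale _ _ _ _ 4%:C); rewrite normcR ger0_norm// mulrA.
  apply: l2b_dom => n; have := Jsym_le alpha_gt0 alpha_le2 n.
  move: (Jsym n) (fourier _ n) => j z jn.
  rewrite !normcM !normcR !ger0_norm ?wt_ge0// [leRHS]mulrA ler_wpM2r ?normc_ge0//.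
  by apply: le_trans jn _; rewrite ler_pM2l// wt_mono// gerBl ltW.
have l2V' : l2 V'.
  have -> : V' = fun n => fourier v n - (fourier v n - V' n) by apply/funext => n; ring.
  by apply: l2B; [exact: l2_fourier|exists ((`|c| + 1 + 4 * A) * e')].
pose V := synth V'; have hV : L2per V by exact: L2per_synth.
have VE n : fourier V n = V' n by exact: fourier_synth.
exists U, V; split; last first.
- apply: le_lt_trans Ce; rewrite /C -mulrA.
  apply: (@le_trans _ _ (r2pi R * ((`|c| + 1 + 4 * A) * e'))).
    apply: parseval; first exact: L2per_B.
    by apply: l2b_dom dVb => n; rewrite fourierB// VE.
  by rewrite ler_pM2l// ler_pM2r// lerDl.
- apply: le_lt_trans Ce; rewrite /C -mulrA.
  apply: (@le_trans _ _ (r2pi R * e')).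
    by apply: parseval => //; apply/l2w0; apply: l2w_le T1.
  by rewrite ler_pM2l// ler_peMl ?(ltW e'0)// lerDr !addr_ge0// mulr_ge0.
have U0 : fourier U 0 = 0 by rewrite UE u0; case: ifP.
split; first by apply/X0P; rewrite VE /V' Jsym0 mul0r.
pose d := trig (box N) (fun n => (absa alpha n)%:C * fourier u n).
have hd : L2per d by exact: L2per_trig.
pose l x := c%:C * d x + (c - 1)%:C * U x - (phi x)%:C * U x.
have hl : L2per l.
  by apply: L2per_B; [apply: L2per_D; exact: L2per_Z|exact: L2mul].
have Ll : opL alpha c phi U l.
  split => //; last first.
    exists d; last exact: ae_eq_refl.
    split => // n; rewrite fourier_trig ?box_uniq// UE.
    by case: ifP => _; rewrite ?mulr0.
  split => //; apply: (@esum_support_lty _ _ _ (box N)) => n.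
    by move=> /negbTE nN; rewrite UE nN normcr0 expr0n mulr0.
  by rewrite mulr_ge0 ?powR_ge0 ?sqr_ge0.
pose k : R[i] := ((2 * pi)^-1)%:C * innerL2 Phi U.
have hw := L2per_D hl (L2per_cst k).
have wE n : fourier (fun x => l x + k) n = fourier l n + if n == 0 then k else 0.
  by rewrite fourierD ?fourier_cst//; exact: L2per_cst.
exists (fun x => l x + k).
  split; [exact/X0P| |by exists l => //; exact: ae_eq_refl].
  (* As [U] has mean zero, the mean of [l] is minus that of [phi U], which is exactly what [k]
     restores. *)
  apply/X0P; split => //; rewrite wE eqxx (fourier_opL _ hU Ll) U0 mulr0 sub0r fourier0.
  rewrite /mean /k [X in integralT X](_ : _ = fun x => (Phi x)^* * U x) ?addNr//.
  by apply/funext => x; rewrite conjcR.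
split => // n; rewrite -/(Jsym n) VE wE /V'.
have [->|n0] := eqVneq n 0; first by rewrite Jsym0 !mul0r.
by rewrite addr0 (fourier_opL _ hU Ll).
Qed.

End closure.

Section resolvent.
Variables (R : realType) (alpha c : R).
Hypothesis alpha_gt0 : 0 < alpha.
Hypothesis alpha_le2 : alpha <= 2.
Hypothesis c_ge : 2^-1 <= c.
Variables (phi : R -> R) (A Kphi : R).
Local Notation Phi := (toC phi).
Hypothesis L2Phi : L2per Phi.
Hypothesis PhiK : forall x, normc (Phi x) <= Kphi.
Hypothesis PhiA : forall s : seq int, uniq s ->
  \sum_(j <- s) jb R j ^+ 2 * normc (fourier Phi j) <= A.
Local Notation Jsym := (symJ alpha).
Local Notation ell := (symL alpha c).
Local Notation mulPhi := (mul_by Phi).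
Variable lambda : R[i].
Hypothesis lambda_re : complex.Re lambda != 0.
Local Notation resolv := (lambda_JL alpha c Phi lambda).
Hypothesis resolv_inj : forall u B, l2w 1 u B -> (forall n, resolv u n = 0) -> u = fun=> 0.
Local Notation clo := (closure_op (@X0 R) (opJL0 alpha c phi)).

Lemma resolv_closure u v n : clo u v ->
  resolv (fourier u) n = fourier (fun x => lambda * u x - v x) n.
Proof.
move=> uv; have [[hu _] [hv _] _] := uv; have hl := L2per_Z lambda hu.
rewrite fourierB// fourierZ// (fourier_closure L2Phi PhiK n uv) /lambda_JL.
by rewrite /coefPhi (fourier_mulPhi_synth L2Phi PhiK).
Qed.

(** Injectivity is known only with one derivative; [resolv_regular] provides it for both solutions
    before they are subtracted. *)
Lemma resolv_uniq u1 u2 f B : l2 u1 -> l2 u2 -> l2b f B ->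
  (forall n, resolv u1 n = f n) -> (forall n, resolv u2 n = f n) -> u1 = u2.
Proof.
move=> h1 h2 fB E1 E2.
have [B1 b1] := resolv_regular alpha_gt0 alpha_le2 c_ge L2Phi PhiA lambda_re h1 fB E1.
have [B2 b2] := resolv_regular alpha_gt0 alpha_le2 c_ge L2Phi PhiA lambda_re h2 fB E2.
have h2' := l2Z (-1) h2.
have : (fun n => u1 n + -1 * u2 n) = fun=> 0.
  apply: (@resolv_inj _ (B1 + normc (-1 : R[i]) * B2)) => [|n].
    have := l2b_add b1 (l2b_scale (-1) b2); apply: l2b_dom => n.
    by rewrite mulrDr mulrCA.
  have := E1 n; rewrite -(E2 n) => /eqP; rewrite -subr_eq0 => /eqP <-.
  rewrite /lambda_JL (coefPhiD L2Phi PhiK h1 h2') (coefPhiZ L2Phi PhiK _ h2).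
  by ring.
move=> E; apply/funext => n; have /eqP := congr1 (@^~ n) E.
by rewrite mulN1r subr_eq0 => /eqP.
Qed.

Lemma mem_resolvent_set : resolvent_set (@X0 R) clo lambda.
Proof.
have lam0 : lambda != 0 by apply: contraNneq lambda_re => ->.
have [K K0 solve] := resolv_solve alpha_gt0 alpha_le2 c_ge L2Phi PhiK PhiA lambda_re resolv_inj.
split=> [u v uv uv0|f /X0P[hf f0]|].
- have [[hu _] [hv _] _] := uv; apply: fourier_eq0 => // n.
  have := @resolv_uniq (fourier u) (fun=> 0) (fun=> 0) 0 (l2_fourier hu).
  have l20 : l2 (fun _ : int => 0 : R[i]) by exists 0; exact: l2b0.
  move=> /(_ l20 (l2b0 _ _)) -> // k.
    rewrite (resolv_closure _ uv) (fourier_eqT _ _ (L2per_cst 0) uv0) ?fourier_cst ?if_same//.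
    by apply: L2per_B => //; exact: L2per_Z.
  have E0 : (fun=> 0 : R[i]) = (fun n : int => 0 * 0 : R[i]) by apply/funext => ?; rewrite mul0r.
  by rewrite /lambda_JL E0 (coefPhiZ L2Phi PhiK 0 l20); ring.
- have [u [u1 u2 uE]] := solve _ _ (bessel hf).
  have l2u : l2 u by exists (K * (normL2 f / r2pi R)).
  have hU := L2per_synth l2u; have UE n := fourier_synth n l2u.
  have hlU := L2per_Z lambda hU; have hV := L2per_B hlU hf.
  exists (synth u), (fun x => lambda * synth u x - f x); split; last first.
    by rewrite (_ : (fun x => _) = f); [exact: ae_eq_refl|apply/funext => x; ring].
  (* The symbol of J vanishes at 0, so this mode reads [lambda u_0 = f_0 = 0]; the solution stays in
     X0. *)
  have u0 : u 0 = 0.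
    have := uE 0; rewrite f0 /lambda_JL Jsym0 mul0r subr0 => /eqP.
    by rewrite mulf_eq0 (negbTE lam0) => /eqP.
  apply: (@closure_opJL0 _ _ _ alpha_gt0 alpha_le2 _ _ _ L2Phi PhiK PhiA _ _ (K * (normL2 f / r2pi R))) => //.
  + by rewrite UE.
  + by apply: l2b_dom u1 => n; rewrite UE.
  + by move=> n; rewrite fourierB// fourierZ// UE -uE /lambda_JL /coefPhi; ring.
- exists K => u v uv; have [[hu _] [hv _] _] := uv.
  have hf := L2per_B (L2per_Z lambda hu) hv.
  (* By uniqueness the solution built by [solve] is [u] itself, which thus inherits its bound. *)
  have [u' [u1 u2 uE]] := solve _ _ (bessel hf).
  have l2u' : l2 u' by eexists; exact: u2.
  have E := resolv_uniq (l2_fourier hu) l2u' (bessel hf) (fun n => resolv_closure n uv) uE.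
  rewrite -E in u2; apply: le_trans (parseval hu u2) _.
  by rewrite mulrCA [r2pi R * _]mulrC divfK// gt_eqF// r2pi_gt0.
Qed.

End resolvent.

(** * Analytic hypotheses on phi deduced from the description of the waves *)

Section smooth_coefficients.
Variable R : realType.
Implicit Types (n : int) (s : seq int).

Lemma perm_boxS N : perm_eq (box N.+1) (N.+1%:Z :: - N.+1%:Z :: box N).
Proof.
apply: uniq_perm; first exact: box_uniq.
  by rewrite 2!cons_uniq box_uniq andbT mem_box in_cons mem_box; lia.
by move=> n; rewrite mem_box 2!in_cons mem_box; lia.
Qed.

(** The bound is shaped to telescope: [2 / (N+2)^2 <= 2 / ((N+1)(N+2)) = 2 / (N+1) - 2 / (N+2)]. *)
Lemma sum_box_jb N : \sum_(n <- box N) (jb R n)^-1 ^+ 2 <= 3 - 2 / N.+1%:R.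
Proof.
elim: N => [|N IH].
  have -> : box 0 = [:: 0] by [].
  by rewrite big_seq1 /jb normr0 addr0 invr1 expr1n; lra.
have -> : \sum_(n <- box N.+1) (jb R n)^-1 ^+ 2 =
    (jb R N.+1%:Z)^-1 ^+ 2 + (jb R (- N.+1%:Z))^-1 ^+ 2 + \sum_(n <- box N) (jb R n)^-1 ^+ 2.
  by rewrite (perm_big _ (perm_boxS N)) -addrA; move: (box N) => b; rewrite !big_cons.
have E (m : nat) : jb R m%:Z = m.+1%:R by rewrite /jb -pmulrn normr_nat -natr1 addrC.
have -> : jb R (- N.+1%:Z) = jb R N.+1%:Z by rewrite /jb intrN normrN.
rewrite E; apply: le_trans (lerD (lexx _) IH) _.
have a0 : 0 < N.+1%:R :> R by []; have -> : N.+2%:R = N.+1%:R + 1 :> R by rewrite -natr1.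
move: (N.+1%:R) a0 => x x0.
have -> : 3 - 2 / (x + 1) = 2 * (x^-1 * (x + 1)^-1) + (3 - 2 / x).
  by field; rewrite !gt_eqF// ltr_wpDr.
have : (x + 1)^-1 * (x + 1)^-1 <= x^-1 * (x + 1)^-1.
  rewrite ler_pM2r ?invr_gt0 ?ltr_wpDr//.
  by rewrite lef_pV2 ?posrE ?ltr_wpDr// lerDl.
by rewrite lerD2r expr2; lra.
Qed.

Lemma sum_jb s : uniq s -> \sum_(n <- s) (jb R n)^-1 ^+ 2 <= 3.
Proof.
move=> us; pose L := (\sum_(n <- s) `|n|)%N.
have h : \sum_(n <- s) (jb R n)^-1 ^+ 2 <= \sum_(n <- box L) (jb R n)^-1 ^+ 2.
  rewrite [leRHS](bigID (fun n => n \in s)) /=.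
  have -> : \sum_(n <- box L | n \in s) (jb R n)^-1 ^+ 2 = \sum_(n <- s) (jb R n)^-1 ^+ 2.
    rewrite -big_filter; apply: perm_big; apply: uniq_perm => //.
      by rewrite filter_uniq// box_uniq.
    move=> n; rewrite mem_filter andb_idr// mem_box => ns.
    by rewrite /L (big_rem n ns)/=; lia.
  by rewrite lerDl sumr_ge0// => n _; exact: sqr_ge0.
apply: le_trans h _; apply: le_trans (sum_box_jb L) _.
by rewrite gerBl divr_ge0.
Qed.

(** Cauchy-Schwarz on [jb^2 |f_n| = jb^-1 * (jb^3 |f_n|)]: 3 bounds the sum of [jb^-2], and 8 is the
    cube of 2 in [(1 + |n|)^2 <= 2 (1 + n^2)]. *)
Lemma Hper_sum (f : R -> R[i]) : Hper 3 f ->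
  exists A, forall s, uniq s -> \sum_(j <- s) jb R j ^+ 2 * normc (fourier f j) <= A.
Proof.
move=> [_ fin]; set E := esum _ _ in fin.
exists (Num.sqrt (3 * (8 * fine E))) => s us.
have S0 : 0 <= \sum_(j <- s) jb R j ^+ 2 * normc (fourier f j).
  by rewrite sumr_ge0// => j _; rewrite mulr_ge0 ?normc_ge0 ?sqr_ge0.
rewrite -(ger0_norm S0) -sqrtr_sqr; apply: ler_wsqrtr.
have -> : \sum_(j <- s) jb R j ^+ 2 * normc (fourier f j) =
    \sum_(j <- s) (jb R j)^-1 * (jb R j ^+ 3 * normc (fourier f j)).
  apply: eq_bigr => j _; rewrite mulrA; congr (_ * _).
  by rewrite exprS mulKf// gt_eqF// jb_gt0.
apply: le_trans (sum_cauchy_schwarz _ _ _) _.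
apply: ler_pM; [by rewrite sumr_ge0// => j _; exact: sqr_ge0..|exact: sum_jb|].
have h : \sum_(n <- s) (1 + n%:~R ^+ 2) `^ 3 * normc (fourier f n) ^+ 2 <= fine E.
  apply: esum_seq_le => // n.
  by rewrite mulr_ge0 ?powR_ge0 ?sqr_ge0.
apply: le_trans (ler_wpM2l (ler0n R 8) h); rewrite mulr_sumr; apply: ler_sum => n _.
rewrite exprMn [leRHS]mulrA ler_wpM2r ?sqr_ge0//.
rewrite powR_mulrn ?addr_ge0 ?sqr_ge0//.
have -> : 8 = 2 ^+ 3 :> R by rewrite -natrX.
rewrite -exprMn exprAC ler_pXn2r ?nnegrE ?sqr_ge0 ?mulr_ge0 ?addr_ge0 ?sqr_ge0//.
rewrite /jb -[n%:~R ^+ 2]real_normK ?num_real//.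
have := sqr_ge0 (1 - `|n%:~R : R|); rewrite !expr2; lra.
Qed.

Lemma fourier_wave (alpha c : R) (phi : R -> R) Kphi n : L2per (toC phi) ->
  (forall x, normc (toC phi x) <= Kphi) -> wave_eq alpha c phi -> n != 0 ->
  (symL alpha c n)%:C * fourier (toC phi) n = 2^-1 * fourier (mul_by (toC phi) (toC phi)) n.
Proof.
move=> hp pK [d [_ hd dE] wE] n0; have hm := L2per_mulPhi hp pK hp.
have E2 : toC (fun y => phi y ^+ 2) = mul_by (toC phi) (toC phi).
  by apply/funext => x; rewrite /toC /mul_by -rmorphM expr2.
rewrite E2 in wE.
have h1 := L2per_Z c%:C hd; have h2 := L2per_Z (c - 1)%:C hp.
have hk := L2per_cst (mean (mul_by (toC phi) (toC phi))).
have h3 := L2per_B hm hk.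
have := fourier_eqT n (L2per_D h1 h2) (L2per_Z (2^-1)%:C h3) wE.
rewrite fourierD// !fourierZ// fourierB// fourier_cst (negbTE n0) subr0 dE.
rewrite mulrA -mulrDl -rmorphM -rmorphD /symL /absa addrA => ->.
by rewrite fmorphV rmorph_nat.
Qed.

End smooth_coefficients.

(** The second harmonic, with coefficient [q a^2], and the cubic remainder are absorbed in a
    multiple of [a^2], using [a < 1]; the extra 1 in [K] pays for [a cos x]. *)
Lemma waves_remainder (R : realType) (alpha a0 : R) (phi : R -> R -> R) (c : R -> R) :
  0 < alpha -> small_amplitude_waves alpha a0 phi c ->
  exists K d : R, [/\ 0 <= K, 0 < d &
    forall a, 0 < a < d -> forall x,
      `|phi a x| <= K * a /\ `|phi a x - a * cos x| <= K * a ^+ 2].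
Proof.
move=> al0 W; have [K0] := saw_phi_expansion W.
rewrite near_withinE => /nbhs_ballP[d /= d0 hd].
have k0 : 0 < 2 `^ alpha - 1 :> R by rewrite subr_gt0 two_alpha_gt1.
pose q : R := (2 * (2 `^ alpha - 1))^-1.
have q0 : 0 <= q by rewrite invr_ge0 mulr_ge0// ltW.
exists (`|K0| + q + 1), (Num.min d 1); split.
- by rewrite !addr_ge0.
- by rewrite lt_min d0 ltr01.
move=> a /andP[a_gt0]; rewrite lt_min => /andP[ad a1] x.
have := hd a; rewrite /ball/= sub0r normrN gtr0_norm// => /(_ ad a_gt0 x).
set P := phi a x => hP.
have c2 : `|cos (2 * x)| <= 1 by rewrite ler_norml cos_geN1 cos_le1.
have c1 : `|cos x| <= 1 by rewrite ler_norml cos_geN1 cos_le1.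
have a2 : 0 <= a ^+ 2 by exact: sqr_ge0.
have a2a : a ^+ 2 <= a by rewrite expr2 ler_piMr// ltW.
have h3 : K0 * a ^+ 3 <= `|K0| * a ^+ 2.
  apply: (@le_trans _ _ (`|K0| * a ^+ 3)).
    by rewrite ler_wpM2r ?exprn_ge0 ?ler_norm// ltW.
  by rewrite ler_wpM2l// exprS ler_piMl// ltW.
have hc : `|P - a * cos x| <= (`|K0| + q) * a ^+ 2.
  have -> : P - a * cos x =
      (P - (a * cos x + a ^+ 2 / (2 * (2 `^ alpha - 1)) * cos (2 * x))) + a ^+ 2 * q * cos (2 * x).
    by rewrite /q; ring.
  apply: le_trans (ler_normD _ _) _; rewrite [leRHS]mulrDl; apply: lerD; first exact: le_trans h3.
  have qa : 0 <= a ^+ 2 * q by exact: mulr_ge0.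
  by rewrite normrM (ger0_norm qa) [leRHS]mulrC ler_piMr.
split; last by apply: le_trans hc _; rewrite [leRHS]mulrDl lerDl mul1r.
have -> : P = (P - a * cos x) + a * cos x by rewrite subrK.
apply: le_trans (ler_normD _ _) _; rewrite [leRHS]mulrDl mul1r; apply: lerD.
  by apply: le_trans hc _; rewrite ler_wpM2l// addr_ge0.
by rewrite normrM gtr0_norm// ler_piMr// ltW.
Qed.

Theorem proposition4p1 (R : realType) (alpha : R) (halpha : 0 < alpha <= 2)
  (a0 : R) (ha0 : 0 < a0) (phi : R -> R -> R) (c : R -> R)
  (hwaves : small_amplitude_waves alpha a0 phi c) :
  exists a1 : R, 0 < a1 <= a0 /\
    forall a : R, 0 < a < a1 ->
      spectrum_JL0 alpha (c a) (phi a) `<=` [set lambda : R[i] | complex.Re lambda = 0].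
Proof.
have /andP[al0 al2] := halpha.
have [K [d [K0 d0 hK]]] := waves_remainder al0 hwaves.
have k0 : 0 < (2 `^ alpha - 1) / 2 :> R by rewrite divr_gt0// subr_gt0 two_alpha_gt1.
(* [b1] and [b2] solve the smallness conditions of [no_unstable_eigenvalue] for [a]; the added 1
   keeps the denominators positive if [K = 0]. *)
pose b1 : R := (2 `^ alpha - 1) / 2 / (4 * K + 1).
pose b2 : R := (4 * (K + K ^+ 2 / 2) + 1)^-1.
have K1 : 0 < 4 * K + 1 by rewrite ltr_wpDl// mulr_ge0.
have K2 : 0 <= 4 * (K + K ^+ 2 / 2) by rewrite mulr_ge0// addr_ge0// divr_ge0// sqr_ge0.
have K3 : 0 < 4 * (K + K ^+ 2 / 2) + 1 by rewrite ltr_wpDl.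
exists (Num.min (Num.min a0 d) (Num.min b1 b2)); split.
  by rewrite !lt_min ha0 d0 divr_gt0//= invr_gt0 K3/= !ge_min lexx.
move=> a /andP[a_gt0]; rewrite !lt_min => /andP[/andP[aa0 ad] /andP[ab1 ab2]].
have Ha : 0 < a < a0 by rewrite a_gt0.
have hr := hK a; rewrite a_gt0 ad in hr; have {}hr := hr isT.
have phi_le x : `|phi a x| <= K * a by have [] := hr x.
have phi_cos x : `|phi a x - a * cos x| <= K * a ^+ 2 by have [] := hr x.
have /X0P[L2Phi Phi0] := saw_zero_mean hwaves Ha.
have [A PhiA] := Hper_sum (saw_smooth hwaves Ha (ler0n R 3)).
have PhiK x : normc (toC (phi a) x) <= K * a by rewrite normcR.
have c_ge := ltW (saw_speed hwaves Ha).
have wave := fun n => @fourier_wave _ alpha (c a) (phi a) _ n L2Phi PhiK (saw_eq hwaves Ha).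
have small1 : 4 * K * a < (2 `^ alpha - 1) / 2.
  by move: ab1; rewrite ltr_pdivlMr//; lra.
have small2 : 4 * (K + K ^+ 2 / 2) * a <= 1.
  by move: ab2; rewrite -[b2]div1r ltr_pdivlMr//; lra.
move=> lambda nres; apply/eqP; apply: contrapT => /negP lambda_re; apply: nres.
apply: (mem_resolvent_set al0 al2 c_ge L2Phi PhiK PhiA lambda_re) => u B.
exact: (no_unstable_eigenvalue al0 al2 c_ge a_gt0 K0 L2Phi phi_le phi_cos PhiA Phi0 wave small1 small2).
Qed.
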